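(* Let $m$ be a nonnegative integer, $r\in(0,\infty)$, and let $\mu$ be a nonnegative Borel measure on $\mathbb C$. (i) Suppose $0<p\le q<\infty$. Then there is a constant $C>0$ such that $$\|f\|_{L^q(\mathbb C,\mu)}\le C\|f\|_{\mathcal F^{p,m}}\quad\text{for all } f\in\mathcal F^{p,m}$$ if and only if $$\sup_{a\in\mathbb C}\frac{\mu(B(a,r))}{(1+|a|)^{mq}}<\infty.$$ Equivalently, the function $a\mapsto\mu(B(a,r))(1+|a|)^{-qm}$ belongs to $L^\infty(\mathbb C)$. (ii) Suppose $0<q<p<\infty$. Then there is a constant $C>0$ such that $$\|f\|_{L^q(\mathbb C,\mu)}\le C\|f\|_{\mathcal F^{p,m}}\quad\text{for all } f\in\mathcal F^{p,m}$$ if and only if, for every $s\in(0,\infty)$, $$\sum_{a\in s\mathbb Z^2}\left(\frac{\mu(B(a,r))}{(1+|a|)^{mq}}\right)^{\frac{p}{p-q}}<\infty.$$ Equivalently, the function $a\mapsto\mu(B(a,r))(1+|a|)^{-qm}$ belongs to $L^{p/(p-q)}(\mathbb C)$.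
   Context: $dA$ is the Euclidean area measure on $\mathbb C$, and $L^\infty(\mathbb C)$, $L^{p/(p-q)}(\mathbb C)$ are taken with respect to $dA$. $B(a,r)=\{z\in\mathbb C:|z-a|<r\}$. For $s>0$, $s\mathbb Z^2=\{s(n+ik): n,k\in\mathbb Z\}\subset\mathbb C$. For $0<p<\infty$ and a nonnegative integer $m$, the Fock-Sobolev space $\mathcal F^{p,m}$ consists of all entire functions $f:\mathbb C\to\mathbb C$ with $$\|f\|_{\mathcal F^{p,m}}=\left(\int_{\mathbb C}\left|z^mf(z)e^{-\frac{|z|^2}{2}}\right|^pdA(z)\right)^{1/p}<\infty.$$ For an entire function $f$ and $0<q<\infty$, the notation $\|f\|_{L^q(\mathbb C,\mu)}$ includes a Gaussian weight: $$\|f\|_{L^q(\mathbb C,\mu)}=\left(\int_{\mathbb C}\left|f(z)e^{-\frac{|z|^2}{2}}\right|^qd\mu(z)\right)^{1/q}.$$ *)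

(* Defs.v *)
From HB Require Import structures.
From mathcomp Require Import all_boot all_order all_algebra complex.
From mathcomp Require Import all_classical all_reals all_analysis.
From mathcomp Require Import measurable_realfun.

Set Implicit Arguments.
Unset Strict Implicit.
Unset Printing Implicit Defensive.

Import Order.TTheory GRing.Theory Num.Theory.
Import numFieldNormedType.Exports.

Local Open Scope classical_set_scope.
Local Open Scope complex_scope.
Local Open Scope ring_scope.

(* The topology and normed-module structures of MathComp-Analysis are not
   inferred on [R[i]] itself, only on terms of type [numFieldType]. *)
Definition Cplx (R : realType) : numFieldType := R[i].

Definition cabs (R : realType) (z : Cplx R) : R := Normc.normc z.

Lemma cabsE (R : realType) (z : Cplx R) : `|z| = (cabs z)%:C.
Proof. by case: z. Qed.

Definition borelC (R : realType) := g_sigma_algebraType (@open (Cplx R)).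

Local Notation plane R := (measurableTypeR R * measurableTypeR R)%type.

Definition complex_of_plane (R : realType) (xy : plane R) : borelC R :=
  xy.1 +i* xy.2.

Lemma cabs_le_Re_Im (R : realType) (x y : R) :
  cabs (x +i* y : Cplx R) <= `|x| + `|y|.
Proof.
rewrite -[leRHS]ger0_norm ?addr_ge0// -sqrtr_sqr ler_wsqrtr//.
by rewrite sqrrD !real_normK ?num_real// lerD2r lerDl mulrn_wge0 ?mulr_ge0.
Qed.

Lemma complex_of_plane_near (R : realType) (a b : R) (e : Cplx R) : 0 < e ->
  exists2 d : R, 0 < d & forall x y, `|a - x| < d -> `|b - y| < d ->
    ball (a +i* b : Cplx R) e (x +i* y : Cplx R).
Proof.
case: e => e e' /= /andP[/eqP -> e0]; exists (e / 2); first by rewrite divr_gt0.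
move=> x y ax by_; rewrite -ball_normE /= cabsE ltcR.
by rewrite (le_lt_trans (cabs_le_Re_Im _ _))// [ltRHS]splitr ltrD.
Qed.

Lemma measurable_complex_of_plane (R : realType) :
  measurable_fun [set: plane R] (@complex_of_plane R).
Proof.
apply: (@measurability _ _ _ (borelC R) _ _ (@open (Cplx R))) => //.
move=> _ [U oU <-]; rewrite setTI.
pose box (t : rat * rat * rat * rat) : set (plane R) :=
  `]ratr t.1.1.1, ratr t.1.1.2[%classic `*` `]ratr t.1.2, ratr t.2[%classic.
have -> : @complex_of_plane R @^-1` U =
    \bigcup_(t in [set t | box t `<=` @complex_of_plane R @^-1` U]) box t.
  apply/seteqP; split=> [[a b] /= Uab|xy [t /= +]]; last by apply.
  have [e e0 eU] : exists2 e, 0 < e & ball (a +i* b : Cplx R) e `<=` U.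
    by apply/nbhs_ballP; apply: open_nbhs_nbhs.
  have [d d0 dP] := complex_of_plane_near a b e0.
  have q (c : R) : exists2 uv : rat * rat, ratr uv.1 < c < ratr uv.2 &
      forall x, ratr uv.1 < x < ratr uv.2 -> `|c - x| < d.
    have /rat_in_itvoo[u] : c - d < c by rewrite ltrBlDr ltrDl.
    have /rat_in_itvoo[v] : c < c + d by rewrite ltrDl.
    rewrite !in_itv/= => /andP[cv vd] /andP[du uc]; exists (u, v) => /=.
      by rewrite uc cv.
    move=> x /andP[ux xv]; rewrite distrC ltr_distl.
    by rewrite (lt_trans du ux) (lt_trans xv vd).
  have [[u v] /= abu uvP] := q a; have [[w z] /= bwz wzP] := q b.
  exists (u, v, w, z); last by split; rewrite /= in_itv.
  move=> [x y] [/= ]; rewrite !in_itv/= => xuv ywz.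
  by apply: eU; apply: dP; [exact: uvP|exact: wzP].
rewrite bigcup_mkcond; apply: countable_bigcupT_measurable => // t.
by case: ifP => // _; apply: measurableX; exact: measurable_itv.
Qed.

Section area.
Variable R : realType.

Definition area : set (borelC R) -> \bar R :=
  pushforward (@lebesgue_measure R \x @lebesgue_measure R)%E
    (@complex_of_plane R).

Let area0 : area set0 = 0%E.
Proof. by rewrite /area /pushforward preimage_set0 measure0. Qed.

Let area_ge0 A : (0 <= area A)%E.
Proof. by rewrite /area /pushforward; exact: measure_ge0. Qed.

Let area_sigma_additive : semi_sigma_additive area.
Proof.
by apply: measure_semi_sigma_additive; exact: measurable_complex_of_plane.
Qed.

HB.instance Definition _ := isMeasure.Build _ _ _ area
  area0 area_ge0 area_sigma_additive.

End area.

Definition disc (R : realType) (a : Cplx R) (r : R) : set (borelC R) :=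
  [set z : Cplx R | cabs (z - a) < r].

Definition square_lattice (R : realType) (s : R) : set (Cplx R) :=
  range (fun nk : int * int =>
    (s * nk.1%:~R) +i* (s * nk.2%:~R) : Cplx R).

Definition entire (R : realType) (f : Cplx R -> Cplx R) : Prop :=
  forall z, derivable f z 1.

Definition gauss (R : realType) (z : Cplx R) : Cplx R :=
  (expR (- (cabs z ^+ 2 / 2)))%:C.

(* For 0 < p < 1, [Lnorm] is the usual quasi-norm (\int |f|^p)^(1/p). *)
Definition fock_sobolev_norm (R : realType) (p : R) (m : nat)
    (f : Cplx R -> Cplx R) : \bar R :=
  ('N[@area R]_(p%:E) [(fun z => (cabs (z ^+ m * f z * gauss z))%:E)])%E.

Definition fock_sobolev (R : realType) (p : R) (m : nat) :
    set (Cplx R -> Cplx R) :=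
  [set f | entire f /\ (fock_sobolev_norm p m f < +oo)%E].

Definition gauss_Lnorm (R : realType) (mu : {measure set (borelC R) -> \bar R})
    (q : R) (f : Cplx R -> Cplx R) : \bar R :=
  ('N[mu]_(q%:E) [(fun z => (cabs (f z * gauss z))%:E)])%E.

Definition fock_carleson (R : realType)
    (mu : {measure set (borelC R) -> \bar R}) (m : nat) (p q : R) : Prop :=
  exists2 C : R, 0 < C & forall f, fock_sobolev p m f ->
    (gauss_Lnorm mu q f <= C%:E * fock_sobolev_norm p m f)%E.

Definition averaging (R : realType)
    (mu : {measure set (borelC R) -> \bar R}) (m : nat) (q r : R)
    (a : Cplx R) : \bar R :=
  (mu (disc a r) / ((1 + cabs a) `^ (m%:R * q))%:E)%E.

(* Membership in L^t for extended-real-valued functions, since a value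
   [mu (disc a r)] may be infinite; [t] may be [+oo]. *)
Definition in_Lp (R : realType) (mu : {measure set (borelC R) -> \bar R})
    (t : \bar R) (g : borelC R -> \bar R) : Prop :=
  measurable_fun [set: borelC R] g /\ ('N[mu]_t [g] < +oo)%E.

(* Main.v *)
Require Import Defs.
From mathcomp Require Import all_boot all_order all_algebra complex.
From mathcomp Require Import all_classical all_reals all_analysis.
From mathcomp Require Import measurable_realfun ess_sup_inf ring lra.

Set Implicit Arguments.
Unset Strict Implicit.
Unset Printing Implicit Defensive.

Import Order.TTheory GRing.Theory Num.Theory.
Import numFieldNormedType.Exports.

Local Open Scope classical_set_scope.
Local Open Scope ring_scope.
Local Open Scope complex_scope.

(** Write [t a] for [averaging mu m q r a], that is
    mu(B(a,r)) / (1 + |a|)^(mq), and let kappa = p / (p - q) when q < p. The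
    embedding of F^(p,m) into L^q(mu) holds exactly when the values of [t] on
    nets of points (one point near each node of a square lattice) are bounded,
    if p <= q, or have a bounded sum of kappa-th powers, if q < p. One
    inequality for each direction carries the proof.

    Sufficiency. [weighted_estimate] bounds
    ((1 + |z|)^m |f(z)| exp(-|z|^2/2))^p by a constant times the integral of
    |w^m f(w) exp(-|w|^2/2)|^p over a square of fixed size around z. Cover the
    plane by discs B(w_k, r) centred at a net, and let x_k be the fraction of
    the p-th power of the norm of f that lives in the square around w_k. The
    estimate gives

      integral of |f exp(-|z|^2/2)|^q dmu <= C ||f||^q sum_k t(w_k) x_k^(q/p),

    where sum_k x_k is bounded, since the squares overlap boundedly. The right
    hand side is bounded when p <= q and t is bounded, because
    x^(q/p) <= x on [0,1]; when q < p it is bounded as soon as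
    sum_k t(w_k)^kappa is finite, by Young's inequality
    t x^(q/p) <= t^kappa + x. Both cases are [carleson_sufficiency].

    Necessity. The function z |-> exp(conj(w) z - |w|^2/2) has weighted
    modulus exp(-|z - w|^2/2). Testing the embedding on the sums of these
    functions over a net, with coefficients +- a_k (1 + |w_k|)^(-m), and
    averaging over the signs gives [carleson_sequences]:

      sum_k a_k^q t(w_k) <= K (sum_k a_k^p)^(q/p),

    with K the same for all nets of a given mesh. A single nonzero a_k shows
    that t is bounded; a_k = t(w_k)^(1/(p-q)) shows that the sums of
    t(w_k)^kappa are bounded.

    Comparison of the conditions. The lattice is itself a net, which settles
    the condition on sums. Being lower semicontinuous, t does not exceed its
    essential supremum, which settles p <= q. For the condition in L^kappa, a
    net may pick in each cell a point where t^kappa is nearly at least, or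
    nearly at most, its mean over the cell; this is why the inequalities above
    are proved for arbitrary nets.

    The local estimate needs some complex analysis for functions that are only
    assumed differentiable: Goursat's theorem on rectangles ([goursat]), and a
    substitute for Cauchy's formula ([cauchy_ineq]), namely
    4 rho |f(z)| <= integral of |f| over the boundary of a rectangle whose
    sides are at distance at least rho from z. Averaging over rectangles gives
    the mean value inequality in L^1, and then in L^p ([Lp_estimate]). *)

(** * Modulus and complex differentiability *)

Section cplx.
Variable R : realType.
Implicit Types z w : Cplx R.

Definition mkC (x y : R) : Cplx R := x +i* y.

Lemma cabs_ge0 z : 0 <= cabs z.
Proof. by rewrite -(@lecR R) -cabsE normr_ge0. Qed.

Lemma cabsM z w : cabs (z * w) = cabs z * cabs w.
Proof. exact: Normc.normcM. Qed.

Lemma cabsD z w : cabs (z + w) <= cabs z + cabs w.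
Proof. exact: le_normcD. Qed.

Lemma cabsN z : cabs (- z) = cabs z.
Proof. exact: normcN. Qed.

Lemma cabs0 : cabs (0 : Cplx R) = 0.
Proof. exact: Normc.normc0. Qed.

Lemma cabs1 : cabs (1 : Cplx R) = 1.
Proof. exact: Normc.normc1. Qed.

Lemma cabsV z : cabs z^-1 = (cabs z)^-1.
Proof. exact: Normc.normcV. Qed.

Lemma cabsX z n : cabs (z ^+ n) = cabs z ^+ n.
Proof. by elim: n => [|n ih]; rewrite ?expr0 ?cabs1// !exprS cabsM ih. Qed.

Lemma cabs_eq0 z : cabs z = 0 -> z = 0.
Proof. exact: Normc.eq0_normc. Qed.

Lemma cabs_gt0 z : (0 < cabs z) = (z != 0).
Proof.
rewrite lt_def cabs_ge0 andbT; apply/idP/idP; apply: contraNN => /eqP.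
  by move=> ->; rewrite cabs0.
by move/cabs_eq0 ->.
Qed.

Lemma cabs_real (x : R) : cabs (x%:C : Cplx R) = `|x|.
Proof. by rewrite /cabs /= expr0n /= addr0 sqrtr_sqr. Qed.

Lemma sqr_cabs z : cabs z ^+ 2 = complex.Re z ^+ 2 + complex.Im z ^+ 2.
Proof. by case: z => x y; rewrite /cabs /= sqr_sqrtr// addr_ge0 ?sqr_ge0. Qed.

Lemma Re_le_cabs z : `|complex.Re z| <= cabs z.
Proof.
by rewrite -(@ler_pXn2r _ 2) ?nnegrE ?cabs_ge0// sqr_cabs real_normK ?num_real// lerDl sqr_ge0.
Qed.

Lemma Im_le_cabs z : `|complex.Im z| <= cabs z.
Proof.
by rewrite -(@ler_pXn2r _ 2) ?nnegrE ?cabs_ge0// sqr_cabs real_normK ?num_real// lerDr sqr_ge0.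
Qed.

Lemma cabs_le z : cabs z <= `|complex.Re z| + `|complex.Im z|.
Proof. by case: z => x y; exact: cabs_le_Re_Im. Qed.

Lemma cabs_dist z w : `|cabs z - cabs w| <= cabs (z - w).
Proof.
have := cabsD (w - z) z; have := cabsD (z - w) w.
by rewrite !subrK -(cabsN (w - z)) opprB ler_norml; lra.
Qed.

Lemma cabs_distrC z w : cabs (z - w) = cabs (w - z).
Proof. by rewrite -cabsN opprB. Qed.

Lemma cabs_triangle w z t : cabs (z - t) <= cabs (z - w) + cabs (w - t).
Proof. by have := cabsD (z - w) (w - t); rewrite addrA subrK. Qed.

Lemma cabs_conj z : cabs (conjc z) = cabs z.
Proof. by case: z => x y; rewrite /cabs /= sqrrN. Qed.

Lemma ball_cabs z (e : R) w : ball z (e%:C : Cplx R) w <-> cabs (z - w) < e.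
Proof. by rewrite -ball_normE /= cabsE ltcR. Qed.

Lemma nbhs_cabsP z (P : set (Cplx R)) :
  nbhs z P <-> exists2 e : R, 0 < e & forall w, cabs (z - w) < e -> P w.
Proof.
split.
  move=> /nbhs_ballP[[e e'] /= /andP[/eqP-> e0] eP]; exists e => // w we.
  by apply: eP; apply/ball_cabs.
move=> [e e0 eP]; apply/nbhs_ballP; exists (e%:C : Cplx R).
  by rewrite /= ltcR.
by move=> w /ball_cabs; exact: eP.
Qed.

(** Division by [w - z] is cleared, so that [w = z] need not be excluded and
    estimates can be added directly. *)
Definition cdiff (f : Cplx R -> Cplx R) z (l : Cplx R) :=
  forall e : R, 0 < e -> exists2 d : R, 0 < d &
    forall w, cabs (w - z) < d -> cabs (f w - f z - l * (w - z)) <= e * cabs (w - z).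

Lemma derivable_cdiff f z : derivable f z 1 -> exists l, cdiff f z l.
Proof.
move=> /cvg_ex[l fl]; exists l => e e0.
have /fl : nbhs l [set w : Cplx R | cabs (l - w) < e].
  by apply/nbhs_cabsP; exists e.
move=> /nbhs_cabsP[d d0 dP]; exists d => // w wd.
have [->|wz] := eqVneq w z; first by rewrite !subrr mulr0 subrr cabs0 mulr0.
have /= := dP (w - z); rewrite sub0r cabsN => /(_ wd) ; rewrite subr_eq0 => /(_ wz).
rewrite /= /GRing.scale /= mulr1 subrK => H.
have -> : f w - f z - l * (w - z) = - (l - (w - z)^-1 * (f w - f z)) * (w - z).
  rewrite mulNr mulrBl mulrAC mulVf ?subr_eq0// mul1r opprB.
  by rewrite addrC.
by rewrite cabsM cabsN ler_wpM2r ?cabs_ge0// ltW.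
Qed.

Lemma cdiff_derivable f z l : cdiff f z l -> derivable f z 1.
Proof.
move=> fl; apply/cvg_ex; exists l => A /nbhs_cabsP[e e0 eA].
have [d d0 dP] := fl (e / 2) (divr_gt0 e0 (ltr0Sn _ _)).
apply/nbhs_cabsP; exists d => // w; rewrite sub0r cabsN => wd w0.
apply: eA; rewrite /GRing.scale /= mulr1.
have := dP (w + z); rewrite addrK => /(_ wd) H.
have -> : l - w^-1 * (f (w + z) - f z) = - (w^-1 * (f (w + z) - f z - l * w)).
  by field.
rewrite cabsN cabsM cabsV.
have w0' : 0 < cabs w by rewrite cabs_gt0.
rewrite mulrC ltr_pdivrMr//; apply: le_lt_trans H _.
by rewrite ltr_pM2r// ltr_pdivrMr// ltr_pMr// ltr1n.
Qed.

Lemma derivable_continuousC (f : Cplx R -> Cplx R) z : derivable f z 1 -> {for z, continuous f}.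
Proof. by move=> df; apply/differentiable_continuous; apply/derivable1_diffP. Qed.

Lemma continuousCP (f : Cplx R -> Cplx R) z : {for z, continuous f} <->
  forall e : R, 0 < e -> exists2 d : R, 0 < d &
    forall w, cabs (z - w) < d -> cabs (f z - f w) < e.
Proof.
split=> [fz e e0|H A /nbhs_cabsP[e e0 eA]].
  have /fz : nbhs (f z) [set w : Cplx R | cabs (f z - w) < e].
    by apply/nbhs_cabsP; exists e.
  by move=> /nbhs_cabsP.
by have [d d0 dP] := H e e0; apply/nbhs_cabsP; exists d => // w /dP /eA.
Qed.

(** The curve [g] is a horizontal or a vertical line in all applications. *)
Lemma continuous_Re_line (f : Cplx R -> Cplx R) (g : R -> Cplx R) x :
  (forall s t, cabs (g s - g t) <= `|s - t|) ->
  {for g x, continuous f} -> {for x, continuous (fun t => complex.Re (f (g t)))}.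
Proof.
move=> g1 /continuousCP fx; apply/cvgrPdist_lt => e e0.
have [d d0 dP] := fx e e0; near=> t; have : cabs (f (g x) - f (g t)) < e.
  apply: dP; apply: le_lt_trans (g1 _ _) _.
  by near: t; apply/nbhs_ballP; exists d.
by apply: le_lt_trans; apply: le_trans (Re_le_cabs _); case: (f _) => ? ?; case: (f _).
Unshelve. all: by end_near. Qed.

Lemma continuous_Im_line (f : Cplx R -> Cplx R) (g : R -> Cplx R) x :
  (forall s t, cabs (g s - g t) <= `|s - t|) ->
  {for g x, continuous f} -> {for x, continuous (fun t => complex.Im (f (g t)))}.
Proof.
move=> g1 /continuousCP fx; apply/cvgrPdist_lt => e e0.
have [d d0 dP] := fx e e0; near=> t; have : cabs (f (g x) - f (g t)) < e.
  apply: dP; apply: le_lt_trans (g1 _ _) _.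
  by near: t; apply/nbhs_ballP; exists d.
by apply: le_lt_trans; apply: le_trans (Im_le_cabs _); case: (f _) => ? ?; case: (f _).
Unshelve. all: by end_near. Qed.

Lemma continuous_cabs_line (f : Cplx R -> Cplx R) (g : R -> Cplx R) x :
  (forall s t, cabs (g s - g t) <= `|s - t|) ->
  {for g x, continuous f} -> {for x, continuous (fun t => cabs (f (g t)))}.
Proof.
move=> g1 /continuousCP fx; apply/cvgrPdist_lt => e e0.
have [d d0 dP] := fx e e0; near=> t; have : cabs (f (g x) - f (g t)) < e.
  apply: dP; apply: le_lt_trans (g1 _ _) _.
  by near: t; apply/nbhs_ballP; exists d.
by apply: le_lt_trans; apply: cabs_dist.
Unshelve. all: by end_near. Qed.

Lemma mkC_lineX y s t : cabs (mkC s y - mkC t y) <= `|s - t|.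
Proof. by apply: le_trans (cabs_le _) _; rewrite /= subrr normr0 addr0. Qed.

Lemma mkC_lineY x s t : cabs (mkC x s - mkC x t) <= `|s - t|.
Proof. by apply: le_trans (cabs_le _) _; rewrite /= subrr normr0 add0r. Qed.

End cplx.

(** * Integrals over segments *)

Section segint.
Variable R : realType.
Implicit Types (a b : R) (g h : R -> R).

Definition segint a b g : R := \int[@lebesgue_measure R]_(x in `[a, b]) g x.

Lemma segint_integrable a b g : (forall x, a <= x <= b -> {for x, continuous g}) ->
  (@lebesgue_measure R).-integrable `[a, b] (EFin \o g).
Proof.
move=> cg; apply: continuous_compact_integrable; first exact: segment_compact.
apply: continuous_in_subspaceT => x; rewrite inE /= in_itv /=; exact: cg.
Qed.

Lemma segint_cst a b k : a <= b -> segint a b (cst k) = k * (b - a).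
Proof.
move=> ab; rewrite /segint Rintegral_cst ?measurable_itv//=.
rewrite lebesgue_measure_itv /= lte_fin; case: ltgtP ab => //= -> _.
by rewrite subrr mulr0.
Qed.

Lemma segint_le a b g h :
  (forall x, a <= x <= b -> {for x, continuous g}) ->
  (forall x, a <= x <= b -> {for x, continuous h}) ->
  (forall x, a <= x <= b -> g x <= h x) -> segint a b g <= segint a b h.
Proof.
move=> cg ch gh; apply: le_Rintegral; first exact: measurable_itv.
- exact: segint_integrable.
- exact: segint_integrable.
by move=> x /=; rewrite in_itv /=; exact: gh.
Qed.

Lemma segintD a b g h :
  (forall x, a <= x <= b -> {for x, continuous g}) ->
  (forall x, a <= x <= b -> {for x, continuous h}) ->
  segint a b (fun x => g x + h x) = segint a b g + segint a b h.
Proof.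
by move=> cg ch; rewrite /segint RintegralD ?measurable_itv//; exact: segint_integrable.
Qed.

Lemma segint_cat a b c g : a <= c <= b ->
  (forall x, a <= x <= b -> {for x, continuous g}) ->
  segint a b g = segint a c g + segint c b g.
Proof.
move=> /andP[ac cb] cg; rewrite /segint.
have H := segint_integrable cg.
have := @Rintegral_itvB R g (BLeft a) (BRight b) c H.
rewrite !bnd_simp => /(_ ac cb).
rewrite Rintegral_itv_obnd_cbnd; first by move=> <-; rewrite addrC subrK.
by apply: integrableS H => //; apply: subset_itvr; rewrite bnd_simp.
Qed.

Lemma eq_segint a b g h : (forall x, a <= x <= b -> g x = h x) ->
  segint a b g = segint a b h.
Proof. by move=> gh; apply: eq_Rintegral => x; rewrite inE /= in_itv; exact: gh. Qed.

End segint.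

(** * Goursat's theorem for rectangles *)

Section goursat.
Variable R : realType.
Implicit Types (f : Cplx R -> Cplx R) (a b c d x y e : R).

(** The real part of the integral of [f] along the boundary of the rectangle
    with corners (a,c) and (b,d), counterclockwise. Its values on the
    constant multiples of [f] determine the whole integral. *)
Definition rect_form f a b c d : R :=
  segint a b (fun x => complex.Re (f (mkC x c)) - complex.Re (f (mkC x d))) +
  segint c d (fun y => complex.Im (f (mkC a y)) - complex.Im (f (mkC b y))).

Definition on_rect a b c d (P : Cplx R -> Prop) :=
  forall x y, a <= x <= b -> c <= y <= d -> P (mkC x y).

Let hor_cont f y x : {for mkC x y, continuous f} ->
  {for x, continuous (fun t => complex.Re (f (mkC t y)))}.
Proof. exact: (continuous_Re_line (mkC_lineX y)). Qed.

Let ver_cont f x y : {for mkC x y, continuous f} ->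
  {for y, continuous (fun t => complex.Im (f (mkC x t)))}.
Proof. exact: (continuous_Im_line (mkC_lineY x)). Qed.

(** Continuity is required on the edges only, so that a rectangle may be cut
    around a singular point. *)
Definition hcont f a b c := forall x, a <= x <= b -> {for mkC x c, continuous f}.
Definition vcont f a c d := forall y, c <= y <= d -> {for mkC a y, continuous f}.

Lemma hor_edges_cont f a b c d : hcont f a b c -> hcont f a b d ->
  forall x, a <= x <= b ->
  {for x, continuous (fun x => complex.Re (f (mkC x c)) - complex.Re (f (mkC x d)))}.
Proof.
by move=> fc fd x xab; apply: continuousB; apply: hor_cont; [exact: fc|exact: fd].
Qed.

Lemma ver_edges_cont f a b c d : vcont f a c d -> vcont f b c d ->
  forall y, c <= y <= d ->
  {for y, continuous (fun y => complex.Im (f (mkC a y)) - complex.Im (f (mkC b y)))}.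
Proof.
by move=> fa fb y ycd; apply: continuousB; apply: ver_cont; [exact: fa|exact: fb].
Qed.

Lemma on_rectS a b c d a' b' c' d' P : a <= a' -> b' <= b -> c <= c' -> d' <= d ->
  on_rect a b c d P -> on_rect a' b' c' d' P.
Proof.
move=> aa bb cc dd H x y /andP[ax xb] /andP[cy yd]; apply: H.
  by rewrite (le_trans aa ax) (le_trans xb bb).
by rewrite (le_trans cc cy) (le_trans yd dd).
Qed.

Lemma on_rect_hcont f a b c d e : c <= e <= d ->
  on_rect a b c d (fun z => {for z, continuous f}) -> hcont f a b e.
Proof. by move=> ce fc x xab; exact: fc. Qed.

Lemma on_rect_vcont f a b c d e : a <= e <= b ->
  on_rect a b c d (fun z => {for z, continuous f}) -> vcont f e c d.
Proof. by move=> ce fc x xab; exact: fc. Qed.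

Lemma hcontS f a b a' b' c : a <= a' -> b' <= b -> hcont f a b c -> hcont f a' b' c.
Proof.
move=> aa bb fc x /andP[ax xb]; apply: fc.
by rewrite (le_trans aa ax) (le_trans xb bb).
Qed.

Lemma rect_form_splitx f a b c d e : a <= e <= b ->
  hcont f a b c -> hcont f a b d -> vcont f a c d -> vcont f e c d -> vcont f b c d ->
  rect_form f a b c d = rect_form f a e c d + rect_form f e b c d.
Proof.
move=> aeb fc fd fa fe fb; rewrite /rect_form.
rewrite (@segint_cat _ a b e) ?aeb//; last exact: hor_edges_cont.
rewrite -!addrA; congr (_ + _); rewrite [RHS]addrCA; congr (_ + _).
rewrite -segintD; [|exact: ver_edges_cont..].
by apply: eq_segint => y _; rewrite addrA subrK.
Qed.

Lemma rect_form_splity f a b c d e : c <= e <= d ->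
  hcont f a b c -> hcont f a b e -> hcont f a b d -> vcont f a c d -> vcont f b c d ->
  rect_form f a b c d = rect_form f a b c e + rect_form f a b e d.
Proof.
move=> ced fc fe fd fa fb; rewrite /rect_form.
rewrite (@segint_cat _ c d e) ?ced//; last exact: ver_edges_cont.
rewrite [RHS]addrACA; congr (_ + _).
rewrite -segintD; [|exact: hor_edges_cont..].
by apply: eq_segint => y _; rewrite addrA subrK.
Qed.

Lemma segint_near_cst a b (k e : R) (g : R -> R) : a <= b ->
  (forall x, a <= x <= b -> {for x, continuous g}) ->
  (forall x, a <= x <= b -> `|g x - k| <= e) ->
  `|segint a b g - k * (b - a)| <= e * (b - a).
Proof.
move=> ab cg gk.
have cc (l : R) x : a <= x <= b -> {for x, continuous (cst l : R -> R)}.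
  by move=> _; exact: cst_continuous.
have : segint a b (cst (k - e)) <= segint a b g.
  apply: segint_le; [exact: cc|exact: cg|move=> x /gk].
  by rewrite ler_norml /cst; lra.
have : segint a b g <= segint a b (cst (k + e)).
  apply: segint_le; [exact: cg|exact: cc|move=> x /gk].
  by rewrite ler_norml /cst; lra.
by rewrite !segint_cst// ler_norml mulrDl mulrBl; lra.
Qed.

(** An affine function contributes nothing to the form, so only the error of
    the affine approximation is integrated. *)
Lemma rect_form_affine f l a b c d z e : a <= b -> c <= d -> 0 <= e ->
  a <= complex.Re z <= b -> c <= complex.Im z <= d ->
  on_rect a b c d (fun z => {for z, continuous f}) ->
  on_rect a b c d (fun w => cabs (f w - f z - l * (w - z)) <= e * cabs (w - z)) ->
  `|rect_form f a b c d| <= 2 * e * ((b - a) + (d - c)) ^+ 2.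
Proof.
move=> ab cd e0 za zc fc fl; set K := b - a + (d - c).
have close x y : a <= x <= b -> c <= y <= d ->
    cabs (f (mkC x y) - f z - l * (mkC x y - z)) <= e * K.
  move=> xab ycd; apply: le_trans (fl _ _ xab ycd) _; rewrite ler_wpM2l//.
  apply: le_trans (cabs_le _) _; rewrite /K; case: z za zc {fl} => z1 z2 /= za zc.
  by rewrite lerD// ler_norml; lra.
pose l2 := complex.Im l.
have K0 : 0 <= K by rewrite /K; lra.
have H1 : `|segint a b (fun x => complex.Re (f (mkC x c)) - complex.Re (f (mkC x d)))
    - (l2 * (d - c)) * (b - a)| <= (2 * (e * K)) * (b - a).
  apply: segint_near_cst => //.
    by apply: hor_edges_cont; apply: on_rect_hcont fc; rewrite lexx cd.
  move=> x xab; have := close x c xab; rewrite lexx cd => /(_ isT).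
  have := close x d xab; rewrite lexx cd => /(_ isT).
  move=> /(le_trans (Re_le_cabs _)) + /(le_trans (Re_le_cabs _)).
  case: (f (mkC x c)) => p1 p2; case: (f (mkC x d)) => q1 q2; case: (f z) => r1 r2.
  rewrite /l2; case: l {fl close l2} => l1 l2; case: z {za zc} => z1 z2 /=.
  by rewrite !ler_norml; nra.
have H2 : `|segint c d (fun y => complex.Im (f (mkC a y)) - complex.Im (f (mkC b y)))
    - (l2 * (a - b)) * (d - c)| <= (2 * (e * K)) * (d - c).
  apply: segint_near_cst => //.
    by apply: ver_edges_cont; apply: on_rect_vcont fc; rewrite lexx ab.
  move=> y ycd; have := close a y; rewrite lexx ab => /(_ isT ycd).
  have := close b y; rewrite lexx ab => /(_ isT ycd).
  move=> /(le_trans (Im_le_cabs _)) + /(le_trans (Im_le_cabs _)).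
  case: (f (mkC a y)) => p1 p2; case: (f (mkC b y)) => q1 q2; case: (f z) => r1 r2.
  rewrite /l2; case: l {fl close l2 H1} => l1 l2; case: z {za zc} => z1 z2 /=.
  by rewrite !ler_norml; nra.
rewrite /rect_form; set A := segint _ _ _ in H1 *; set B := segint _ _ _ in H2 *.
have -> : A + B = (A - l2 * (d - c) * (b - a)) + (B - l2 * (a - b) * (d - c)) by ring.
apply: le_trans (ler_normD _ _) _; apply: le_trans (lerD H1 H2) _.
by rewrite /K le_eqVlt; apply/orP; left; apply/eqP; ring.
Qed.

Lemma nested_segments (u v : nat -> R) :
  (forall n, u n <= u n.+1) -> (forall n, v n.+1 <= v n) -> (forall n, u n <= v n) ->
  exists x, forall n, u n <= x <= v n.
Proof.
move=> uS vS uv.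
have uM : {homo u : m n / (m <= n)%N >-> m <= n} by apply: homo_leq => //; apply: le_trans.
have vM : {homo v : m n / (m <= n)%N >-> n <= m}.
  by apply: homo_leq => // x y z xy yz; apply: le_trans yz xy.
have bd m n : u m <= v n.
  apply: (@le_trans _ _ (u (maxn m n))); first by rewrite uM ?leq_maxl.
  by apply: le_trans (uv _) _; rewrite vM ?leq_maxr.
exists (sup (range u)) => n; apply/andP; split.
  by apply: ub_le_sup; [exists (v 0%N) => _ [m _ <-]|exists n].
by apply: ge_sup; [exists (u 0%N); exists 0%N|move=> _ [m _ <-]].
Qed.

Lemma four_pieces (F1 F2 F3 F4 e : R) : 4 * e <= `|F1 + F2 + (F3 + F4)| ->
  [\/ e <= `|F1|, e <= `|F2|, e <= `|F3| | e <= `|F4|].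
Proof.
move=> ebad.
have [h1|h1] := leP e `|F1|; first by constructor 1.
have [h2|h2] := leP e `|F2|; first by constructor 2.
have [h3|h3] := leP e `|F3|; first by constructor 3.
have [h4|h4] := leP e `|F4|; first by constructor 4.
have := ler_normD (F1 + F2) (F3 + F4).
by have := ler_normD F1 F2; have := ler_normD F3 F4; lra.
Qed.

(** By repeated quartering: if the form were not zero, some quarter would
    carry at least a quarter of it. The rectangles so obtained shrink to a
    point, and [rect_form_affine] at that point makes the form too small. *)
Lemma goursat f a b c d : a <= b -> c <= d ->
  on_rect a b c d (fun z => derivable f z 1) -> rect_form f a b c d = 0.
Proof.
move=> ab cd df.
have fc : on_rect a b c d (fun z => {for z, continuous f}).
  by move=> x y xab ycd; apply: derivable_continuousC; apply: df.
apply/eqP/negPn/negP => /eqP/eqP; rewrite -normr_gt0; set e := `|_| => e0.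
pose W (n : nat) : R := (b - a) / 2 ^+ n; pose H (n : nat) : R := (d - c) / 2 ^+ n.
have WS n : W n = W n.+1 + W n.+1 by rewrite /W exprS; field; rewrite expf_neq0.
have HS n : H n = H n.+1 + H n.+1 by rewrite /H exprS; field; rewrite expf_neq0.
have W0 n : 0 <= W n by rewrite /W divr_ge0 ?subr_ge0// exprn_ge0.
have H0 n : 0 <= H n by rewrite /H divr_ge0 ?subr_ge0// exprn_ge0.
pose bad n (p : R * R) := [/\ a <= p.1, p.1 + W n <= b, c <= p.2, p.2 + H n <= d &
  e / 4 ^+ n <= `|rect_form f p.1 (p.1 + W n) p.2 (p.2 + H n)| ].
(* The implication is inside the existential so that choice yields a total
   function. *)
have quarter (np : nat * (R * R)) : exists q : R * R, bad np.1 np.2 ->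
    [/\ bad np.1.+1 q, np.2.1 <= q.1, q.1 + W np.1.+1 <= np.2.1 + W np.1,
        np.2.2 <= q.2 & q.2 + H np.1.+1 <= np.2.2 + H np.1].
  case: np => n [x y] /=.
  have [[/= ax xb cy yd ebad]|nb] := pselect (bad n (x, y)); last by exists 0.
  have := W0 n.+1; have := H0 n.+1; have := WS n; have := HS n.
  set w := W n.+1; set h := H n.+1 => Hn Wn h0 w0; rewrite Wn Hn in ebad xb yd *.
  have fc' : on_rect x (x + (w + w)) y (y + (h + h)) (fun z => {for z, continuous f}).
    by apply: on_rectS fc.
  have hc e' : y <= e' <= y + (h + h) -> hcont f x (x + (w + w)) e'.
    by move=> ?; apply: on_rect_hcont fc'.
  have vc e' : x <= e' <= x + (w + w) -> vcont f e' y (y + (h + h)).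
    by move=> ?; apply: on_rect_vcont fc'.
  have xw : x <= x + w <= x + (w + w) by clear -w0; lra.
  have yh : y <= y + h <= y + (h + h) by clear -h0; lra.
  have [x2 y2] : x <= x + (w + w) /\ y <= y + (h + h) by clear -w0 h0; lra.
  have [/andP[xw1 xw2] /andP[yh1 yh2]] := (xw, yh).
  have [xl xr] : x <= x <= x + (w + w) /\ x <= x + (w + w) <= x + (w + w) by rewrite !lexx x2.
  have [yl yr] : y <= y <= y + (h + h) /\ y <= y + (h + h) <= y + (h + h) by rewrite !lexx y2.
  have hl e' ye : hcont f x (x + w) e' := hcontS (lexx _) xw2 (hc e' ye).
  have hr e' ye : hcont f (x + w) (x + (w + w)) e' := hcontS xw1 (lexx _) (hc e' ye).
  rewrite (rect_form_splitx xw (hc _ yl) (hc _ yr) (vc _ xl) (vc _ xw) (vc _ xr)) in ebad.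
  rewrite (rect_form_splity yh (hl _ yl) (hl _ yh) (hl _ yr) (vc _ xl) (vc _ xw)) in ebad.
  rewrite (rect_form_splity yh (hr _ yl) (hr _ yh) (hr _ yr) (vc _ xw) (vc _ xr)) in ebad.
  have e1 : e / 4 ^+ n = 4 * (e / 4 ^+ n.+1).
    by rewrite exprS; field; rewrite expf_neq0.
  rewrite e1 !(addrA x) !(addrA y) in ebad.
  rewrite /bad -/w -/h /=; move: ebad; set e' := e / 4 ^+ n.+1.
  set F1 := rect_form _ _ _ _ _; set F2 := rect_form _ _ _ _ _.
  set F3 := rect_form _ _ _ _ _; set F4 := rect_form _ _ _ _ _ => ebad.
  have [h1|h2|h3|h4] := four_pieces ebad.
  - by exists (x, y) => _ /=; clear -xb yd h1 ax cy w0 h0; do !split => //; lra.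
  - by exists (x, y + h) => _ /=; clear -xb yd h2 ax cy w0 h0; do !split => //; lra.
  - by exists (x + w, y) => _ /=; clear -xb yd h3 ax cy w0 h0; do !split => //; lra.
  - by exists (x + w, y + h) => _ /=; clear -xb yd h4 ax cy w0 h0; do !split => //; lra.
have [next nextP] := choice quarter.
pose q := fix q n := if n is n'.+1 then next (n', q n') else (a, c).
have qbad n : bad n (q n).
  elim: n => [|n ih]; last by have [] := nextP (n, q n) ih.
  by rewrite /bad /W /H /= !expr0 !divr1 !(addrC _ (_ - _)) !subrK.
have qS n := nextP (n, q n) (qbad n).
have [x xP] : exists x, forall n, (q n).1 <= x <= (q n).1 + W n.
  apply: nested_segments => n; first by have [] := qS n.
    by have [] := qS n.
  by rewrite lerDl.
have [y yP] : exists y, forall n, (q n).2 <= y <= (q n).2 + H n.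
  apply: nested_segments => n; first by have [] := qS n.
    by have [] := qS n.
  by rewrite lerDl.
pose z := mkC x y; pose K := b - a + (d - c).
have K0 : 0 <= K by rewrite /K; lra.
have [|l fl] := @derivable_cdiff _ f z.
  have [/= ] := qbad 0%N; have := xP 0%N; have := yP 0%N => /=.
  by move=> yy xx u1 u2 u3 u4 _; apply: df; lra.
(* The rectangle of rank n has semi-perimeter K / 2^n and carries at least
   e / 4^n; the affine error must stay below that. *)
pose e' := e / (4 * (K ^+ 2 + 1)).
have K1 : 0 < K ^+ 2 + 1 by rewrite ltr_wpDl// sqr_ge0.
have [d' d'0 dP] := fl e' (divr_gt0 e0 (mulr_gt0 (ltr0Sn _ _) K1)).
have [n Kn] : exists n, K / 2 ^+ n < d'.
  exists (Num.truncn (K / d')).+1; rewrite ltr_pdivrMr ?exprn_gt0// mulrC -ltr_pdivrMr//.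
  apply: lt_trans (truncnS_gt _) _.
  by rewrite -natrX ltr_nat ltn_expl.
have [] := qbad n; move: (xP n) (yP n); case: (q n) => u v /= xu yv u1 u2 u3 u4 ebad.
have Wn0 := W0 n; have Hn0 := H0 n.
have e'0 : 0 < e' by rewrite divr_gt0// mulr_gt0.
have rc : on_rect u (u + W n) v (v + H n) (fun w => cabs (f w - f z - l * (w - z)) <= e' * cabs (w - z)).
  move=> s t su tv; apply: dP; apply: le_lt_trans Kn.
  apply: le_trans (cabs_le _) _; rewrite /K mulrDl; rewrite /=; apply: lerD.
    by move: su xu; rewrite -/(W n); clear; rewrite ler_norml; lra.
  by move: tv yv; rewrite -/(H n); clear; rewrite ler_norml; lra.
have uW : u <= u + W n by rewrite lerDl.
have vH : v <= v + H n by rewrite lerDl.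
have := @rect_form_affine f l u (u + W n) v (v + H n) z e' uW vH (ltW e'0) xu yv
  (on_rectS u1 u2 u3 u4 fc) rc.
have -> : (u + W n - u) + (v + H n - v) = K / 2 ^+ n.
  by rewrite /K mulrDl -/(W n) -/(H n); ring.
apply/negP; rewrite -ltNge; apply: lt_le_trans ebad.
have -> : e / 4 ^+ n = 4 * e' * (K ^+ 2 + 1) / 4 ^+ n.
  by rewrite /e'; field; rewrite expf_neq0//= gt_eqF.
have -> : 2 * e' * (K / 2 ^+ n) ^+ 2 = 2 * e' * K ^+ 2 / 4 ^+ n.
  have -> : 4 = 2 ^+ 2 :> R by rewrite -natrX.
  by rewrite expr_div_n -!exprM mulnC; ring.
rewrite ltr_pM2r ?invr_gt0 ?exprn_gt0//.
by move: e'0 (sqr_ge0 K); clear; nra.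
Qed.

End goursat.

(** * A Cauchy inequality on rectangles *)

Section cauchy_kernel.
Variable R : realType.
Implicit Types (f F : Cplx R -> Cplx R) (x y : R) (z w : Cplx R).

(** The subtracted terms are the real and imaginary parts of the Cauchy
    kernel -iA / (p + iq), whose numerator [F] stays close to -iA; the
    hypothesis on [t] says that p + iq lies outside the open square of
    half-side [t]. *)
Lemma kernel_bound (A dl t p q : R) (F : Cplx R) : 0 <= A -> 0 < t ->
  t <= `|p| \/ t <= `|q| -> cabs (F - mkC 0 (- A)) <= dl ->
  `|complex.Re (F / mkC p q) + A * q / (p ^+ 2 + q ^+ 2)| <= dl / t /\
  `|complex.Im (F / mkC p q) + A * p / (p ^+ 2 + q ^+ 2)| <= dl / t.
Proof.
move=> A0 t0 tpq Fd; have tn : t <= cabs (mkC p q).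
  by case: tpq => /le_trans; apply; [exact: (Re_le_cabs (mkC p q))|exact: (Im_le_cabs (mkC p q))].
have n0 : 0 < cabs (mkC p q) by exact: lt_le_trans tn.
have pq0 : p ^+ 2 + q ^+ 2 != 0.
  have := exprn_gt0 2 n0; rewrite sqr_cabs /= => h; exact: lt0r_neq0.
have B : cabs ((F - mkC 0 (- A)) / mkC p q) <= dl / t.
  rewrite cabsM cabsV ler_pM ?cabs_ge0 ?invr_ge0 ?cabs_ge0//.
  by rewrite lef_pV2 ?posrE.
have E : (F - mkC 0 (- A)) / mkC p q = F / mkC p q +
     mkC (A * q / (p ^+ 2 + q ^+ 2)) (A * p / (p ^+ 2 + q ^+ 2)).
  rewrite mulrBl; congr (_ + _).
  by apply/eqP; rewrite eq_complex /=; apply/andP; split; apply/eqP; field.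
rewrite E in B.
have := le_trans (Re_le_cabs _) B; have := le_trans (Im_le_cabs _) B.
by case: (F / mkC p q).
Qed.

(** For [F] constantly -iA the form equals 2 pi A. The lower bound 4A follows
    from a pointwise bound of the kernel on the edges, without computing the
    integral. *)
Lemma kernel_square F (a b A dl t : R) : 0 <= A -> 0 < t ->
  let G w := F w / (w - mkC a b) in
  hcont G (a - t) (a + t) (b - t) -> hcont G (a - t) (a + t) (b + t) ->
  vcont G (a - t) (b - t) (b + t) -> vcont G (a + t) (b - t) (b + t) ->
  (forall x y, `|x - a| <= t -> `|y - b| <= t -> cabs (F (mkC x y) - mkC 0 (- A)) <= dl) ->
  4 * A - 8 * dl <= rect_form G (a - t) (a + t) (b - t) (b + t).
Proof.
move=> A0 t0 G c1 c2 c3 c4 Fd.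
have key (s : R) : `|s| <= t -> A / t <= 2 * (A * t / (s ^+ 2 + t ^+ 2)).
  move=> st; have s2 : s ^+ 2 <= t ^+ 2.
    by rewrite -(real_normK (num_real s)) lerXn2r ?nnegrE// ltW.
  have t2 : 0 < t ^+ 2 by rewrite exprn_gt0.
  have h : 0 < s ^+ 2 + t ^+ 2 by rewrite ltr_wpDl ?sqr_ge0.
  rewrite mulrA ler_pdivlMr// mulrAC ler_pdivrMr//.
  have -> : 2 * (A * t) * t = A * (2 * t ^+ 2) by ring.
  by rewrite ler_wpM2l//; lra.
have GE x y : G (mkC x y) = F (mkC x y) / mkC (x - a) (y - b) by [].
have [Em Ep] : (forall s : R, s - t - s = - t) /\ (forall s : R, s + t - s = t).
  by split=> s; ring.
have tt : `|t| = t by rewrite gtr0_norm.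
have dl0 : 0 <= dl by apply: le_trans (Fd a b _ _); rewrite ?subrr ?normr0 ?cabs_ge0 ?ltW.
pose k := A / t - 2 * (dl / t).
have kE : k * (2 * t) = 2 * A - 4 * dl by rewrite /k; field; rewrite gt_eqF.
have cc (u v l x : R) : u <= x <= v -> {for x, continuous (cst l : R -> R)}.
  by move=> _; exact: cst_continuous.
have lenE s : s + t - (s - t) = 2 * t by ring.
have le s : s - t <= s + t by clear -t0; lra.
have H1 : segint (a - t) (a + t) (cst k) <= segint (a - t) (a + t)
   (fun x => complex.Re (G (mkC x (b - t))) - complex.Re (G (mkC x (b + t)))).
  apply: segint_le; [exact: cc|exact: hor_edges_cont|move=> x xt].
  have xa : `|x - a| <= t by rewrite ler_norml; move: xt; clear; lra.
  have bt1 : `|b - t - b| <= t by rewrite Em normrN tt.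
  have bt2 : `|b + t - b| <= t by rewrite Ep tt.
  have := @kernel_bound A dl t (x - a) (b - t - b) _ A0 t0 _ (Fd _ _ xa bt1).
  have := @kernel_bound A dl t (x - a) (b + t - b) _ A0 t0 _ (Fd _ _ xa bt2).
  rewrite !GE Em Ep normrN tt sqrrN.
  move=> /(_ (or_intror (lexx _)))[+ _] /(_ (or_intror (lexx _)))[+ _].
  have := key _ xa; rewrite /k /cst; set u := A * t / _; rewrite mulrN mulNr -/u.
  by rewrite !ler_norml; clear; lra.
have H2 : segint (b - t) (b + t) (cst k) <= segint (b - t) (b + t)
   (fun y => complex.Im (G (mkC (a - t) y)) - complex.Im (G (mkC (a + t) y))).
  apply: segint_le; [exact: cc|exact: ver_edges_cont|move=> y yt].
  have yb : `|y - b| <= t by rewrite ler_norml; move: yt; clear; lra.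
  have at1 : `|a - t - a| <= t by rewrite Em normrN tt.
  have at2 : `|a + t - a| <= t by rewrite Ep tt.
  have := @kernel_bound A dl t (a - t - a) (y - b) _ A0 t0 _ (Fd _ _ at1 yb).
  have := @kernel_bound A dl t (a + t - a) (y - b) _ A0 t0 _ (Fd _ _ at2 yb).
  rewrite !GE Em Ep normrN tt sqrrN.
  move=> /(_ (or_introl (lexx _)))[_ +] /(_ (or_introl (lexx _)))[_ +].
  have := key _ yb; rewrite /k /cst addrC; set u := A * t / _; rewrite mulrN mulNr -/u.
  by rewrite !ler_norml; clear; lra.
move: H1 H2; rewrite /rect_form !segint_cst// !lenE kE.
by set I1 := segint _ _ _; set I2 := segint _ _ _; clear; lra.
Qed.

End cauchy_kernel.

Section cauchy_inequality.
Variable R : realType.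
Implicit Types (f F : Cplx R -> Cplx R) (x y : R) (z w : Cplx R).

Lemma derivable_subr z w : derivable (fun u : Cplx R => u - z) w 1.
Proof.
apply: (@cdiff_derivable _ _ _ 1) => e e0; exists 1 => // u _.
by rewrite mul1r opprB addrA subrK subrr cabs0 mulr_ge0 ?cabs_ge0// ltW.
Qed.

(** Let F = -i conj(f(z)) f, so that F(z) = -i|f(z)|^2. By [goursat], the
    form of w |-> F(w) / (w - z) is the same on the given rectangle as on a
    tiny square around z. On the square it is at least nearly 4 |f(z)|^2 by
    [kernel_square]; on the rectangle it is at most |f(z)| / rho times the
    boundary integral of |f|. *)
Lemma cauchy_ineq f (a b x1 x2 y1 y2 rho : R) : entire f -> 0 < rho ->
  x1 <= a - rho -> a + rho <= x2 -> y1 <= b - rho -> b + rho <= y2 ->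
  4 * rho * cabs (f (mkC a b)) <=
    segint x1 x2 (fun x => cabs (f (mkC x y1)) + cabs (f (mkC x y2))) +
    segint y1 y2 (fun y => cabs (f (mkC x1 y)) + cabs (f (mkC x2 y))).
Proof.
move=> fE rho0 hx1 hx2 hy1 hy2; set z := mkC a b.
pose c0 := mkC 0 (-1) * conjc (f z); pose A := cabs (f z) ^+ 2.
pose F w := c0 * f w; pose G w := F w / (w - z).
have Fz : F z = mkC 0 (- A).
  rewrite /F /c0 /A sqr_cabs; case: (f z) => u v.
  by apply/eqP; rewrite eq_complex /=; apply/andP; split; apply/eqP; ring.
have dF w : derivable F w 1.
  by apply: derivableM; [exact: derivable_cst|exact: fE].
have dG w : w != z -> derivable G w 1.
  move=> wz; apply: derivableM => //; apply: derivableV; first by rewrite subr_eq0.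
  exact: derivable_subr.
have offx x y : x != a -> mkC x y != z.
  by move=> xa; rewrite eq_complex /= negb_and xa.
have offy x y : y != b -> mkC x y != z.
  by move=> xa; rewrite eq_complex /= negb_and xa orbT.
have hG u v e : e != b -> hcont G u v e.
  by move=> eb x _; apply: derivable_continuousC; apply: dG; exact: offy.
have vG u v e : e != a -> vcont G e u v.
  by move=> eb x _; apply: derivable_continuousC; apply: dG; exact: offx.
have shrink (t : R) : 0 < t -> t < rho ->
    rect_form G x1 x2 y1 y2 = rect_form G (a - t) (a + t) (b - t) (b + t).
  move=> t0 tr.
  have [? ?] : x1 != a /\ x2 != a by split; [rewrite lt_eqF//|rewrite gt_eqF//]; clear -hx1 hx2 rho0; lra.
  have [? ?] : y1 != b /\ y2 != b by split; [rewrite lt_eqF//|rewrite gt_eqF//]; clear -hy1 hy2 rho0; lra.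
  have [? ?] : a - t != a /\ a + t != a by split; [rewrite lt_eqF//|rewrite gt_eqF//]; clear -t0; lra.
  have [? ?] : b - t != b /\ b + t != b by split; [rewrite lt_eqF//|rewrite gt_eqF//]; clear -t0; lra.
  have ? : x1 <= a - t <= x2 by clear -hx1 hx2 t0 tr; lra.
  have ? : a - t <= a + t <= x2 by clear -hx1 hx2 t0 tr; lra.
  have ? : y1 <= b - t <= y2 by clear -hy1 hy2 t0 tr; lra.
  have ? : b - t <= b + t <= y2 by clear -hy1 hy2 t0 tr; lra.
  (* Cut the rectangle into the tiny square and four rectangles off z. *)
  rewrite (@rect_form_splitx _ G x1 x2 y1 y2 (a - t)); [|by auto..].
  rewrite (@rect_form_splitx _ G (a - t) x2 y1 y2 (a + t)); [|by auto..].
  rewrite (@rect_form_splity _ G (a - t) (a + t) y1 y2 (b - t)); [|by auto..].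
  rewrite (@rect_form_splity _ G (a - t) (a + t) (b - t) y2 (b + t)); [|by auto..].
  rewrite [X in X + _]goursat; [|by clear -hx1 hx2 hy1 hy2 rho0 t0 tr; lra..|]; last first.
    by move=> x y /andP[_ xa] _; apply: dG; apply: offx; rewrite lt_eqF//; clear -xa t0; lra.
  rewrite [X in _ + (_ + X)]goursat; [|by clear -hx1 hx2 hy1 hy2 rho0 t0 tr; lra..|]; last first.
    by move=> x y /andP[xa _] _; apply: dG; apply: offx; rewrite gt_eqF//; clear -xa t0; lra.
  rewrite [X in _ + (X + _ + _)]goursat; [|by clear -hx1 hx2 hy1 hy2 rho0 t0 tr; lra..|]; last first.
    by move=> x y _ /andP[_ xa]; apply: dG; apply: offy; rewrite lt_eqF//; clear -xa t0; lra.
  rewrite [X in _ + (_ + (_ + X) + _)]goursat; [|by clear -hx1 hx2 hy1 hy2 rho0 t0 tr; lra..|]; last first.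
    by move=> x y _ /andP[xa _]; apply: dG; apply: offy; rewrite gt_eqF//; clear -xa t0; lra.
  by rewrite !(addr0, add0r).
have low : 4 * A <= rect_form G x1 x2 y1 y2.
  apply/ler_addgt0Pr => e e0; rewrite -lerBlDr.
  have e8 : 0 < e / 8 by rewrite divr_gt0.
  have [d d0 dP] := (continuousCP F z).1 (derivable_continuousC (dF z)) _ e8.
  pose t : R := Num.min (rho / 2) (d / 4).
  have t0 : 0 < t by rewrite lt_min !divr_gt0.
  have tr : t < rho by rewrite gt_min; apply/orP; left; clear -rho0; lra.
  have td : t <= d / 4 by rewrite ge_min lexx orbT.
  rewrite (shrink t t0 tr); have -> : e = 8 * (e / 8) by field.
  apply: (@kernel_square _ F a b A (e / 8) t).
  - by rewrite /A exprn_ge0// cabs_ge0.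
  - exact: t0.
  - by apply: hG; rewrite lt_eqF// gtrBl.
  - by apply: hG; rewrite gt_eqF// ltrDl.
  - by apply: vG; rewrite lt_eqF// gtrBl.
  - by apply: vG; rewrite gt_eqF// ltrDl.
  - move=> x y xa yb; rewrite -Fz cabs_distrC ltW// dP// cabs_distrC.
    apply: le_lt_trans (cabs_le _) _; rewrite /=.
    by move: xa yb; set u := `|x - a|; set v := `|y - b|; clear -td d0 t0; lra.
(* The final division by |f(z)| requires this case apart. *)
have [fz0|fz0] := eqVneq (cabs (f z)) 0.
  rewrite fz0 mulr0; apply: addr_ge0; apply: Rintegral_ge0 => x _;
    by apply: addr_ge0; exact: cabs_ge0.
have fz1 : 0 < cabs (f z) by rewrite lt_def fz0 cabs_ge0.
have Gle x y : rho <= `|x - a| \/ rho <= `|y - b| ->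
    cabs (G (mkC x y)) <= cabs (f z) / rho * cabs (f (mkC x y)).
  move=> far; have rn : rho <= cabs (mkC x y - z).
    by case: far => /le_trans; apply; [exact: (Re_le_cabs (mkC x y - z))|exact: (Im_le_cabs (mkC x y - z))].
  rewrite /G /F /c0 !cabsM cabsV cabs_conj.
  have -> : cabs (mkC 0 (-1) : Cplx R) = 1.
    by rewrite /cabs /= expr0n /= add0r sqrrN expr1n sqrtr1.
  rewrite mul1r -!mulrA ler_wpM2l ?cabs_ge0// mulrC ler_wpM2r ?cabs_ge0//.
  by rewrite lef_pV2 ?posrE// (lt_le_trans rho0).
have cf w : {for w, continuous f} by apply: derivable_continuousC; exact: fE.
have cx y x : {for x, continuous (fun t => cabs (f (mkC t y)))}.
  by apply: (continuous_cabs_line (mkC_lineX y)); exact: cf.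
have cy x y : {for y, continuous (fun t => cabs (f (mkC x t)))}.
  by apply: (continuous_cabs_line (mkC_lineY x)); exact: cf.
pose k := cabs (f z) / rho.
have segZ u v (g : R -> R) : (forall x, u <= x <= v -> {for x, continuous g}) ->
    segint u v (fun x => k * g x) = k * segint u v g.
  by move=> cg; rewrite /segint RintegralZl//; exact: segint_integrable.
have cD (u v : R) g h : (forall x, {for x, continuous g}) -> (forall x, {for x, continuous h}) ->
    forall x, u <= x <= v -> {for x, continuous (fun x : R => g x + h x : R)}.
  by move=> cg ch x _; apply: continuousD.
have cZ (u v : R) (g : R -> R) : (forall x, u <= x <= v -> {for x, continuous g}) ->
    forall x, u <= x <= v -> {for x, continuous (fun x => k * g x)}.
  move=> cg x xuv; apply: continuousM; [exact: cst_continuous|exact: cg].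
have h1 : x1 != a by rewrite lt_eqF//; clear -hx1 rho0; lra.
have h2 : x2 != a by rewrite gt_eqF//; clear -hx2 rho0; lra.
have h3 : y1 != b by rewrite lt_eqF//; clear -hy1 rho0; lra.
have h4 : y2 != b by rewrite gt_eqF//; clear -hy2 rho0; lra.
have up1 : segint x1 x2 (fun x => complex.Re (G (mkC x y1)) - complex.Re (G (mkC x y2)))
   <= k * segint x1 x2 (fun x => cabs (f (mkC x y1)) + cabs (f (mkC x y2))).
  rewrite -segZ; last by apply: cD.
  apply: segint_le; [by apply: hor_edges_cont; exact: hG|by apply: cZ; apply: cD|].
  move=> x _; rewrite mulrDr.
  have := Gle x y1 _; have := Gle x y2 _; rewrite -/k !ler_normr => b2 b1.
  have {}b1 : cabs (G (mkC x y1)) <= k * cabs (f (mkC x y1)).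
    by apply: b1; right; clear -hy1; lra.
  have {}b2 : cabs (G (mkC x y2)) <= k * cabs (f (mkC x y2)).
    by apply: b2; right; clear -hy2; lra.
  have := le_trans (Re_le_cabs _) b1; have := le_trans (Re_le_cabs _) b2.
  by rewrite !ler_norml; clear; lra.
have up2 : segint y1 y2 (fun y => complex.Im (G (mkC x1 y)) - complex.Im (G (mkC x2 y)))
   <= k * segint y1 y2 (fun y => cabs (f (mkC x1 y)) + cabs (f (mkC x2 y))).
  rewrite -segZ; last by apply: cD.
  apply: segint_le; [by apply: ver_edges_cont; exact: vG|by apply: cZ; apply: cD|].
  move=> y _; rewrite mulrDr.
  have := Gle x1 y _; have := Gle x2 y _; rewrite -/k !ler_normr => b2 b1.
  have {}b1 : cabs (G (mkC x1 y)) <= k * cabs (f (mkC x1 y)).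
    by apply: b1; left; clear -hx1; lra.
  have {}b2 : cabs (G (mkC x2 y)) <= k * cabs (f (mkC x2 y)).
    by apply: b2; left; clear -hx2; lra.
  have := le_trans (Im_le_cabs _) b1; have := le_trans (Im_le_cabs _) b2.
  by rewrite !ler_norml; clear; lra.
have := le_trans low (lerD up1 up2); rewrite -mulrDr /k /A.
set I := _ + _ => H; rewrite -(ler_pM2l (divr_gt0 fz1 rho0)).
by apply: le_trans H; rewrite le_eqVlt; apply/orP; left; apply/eqP; field; rewrite gt_eqF.
Qed.

End cauchy_inequality.

(** * Integration with respect to area *)

Section area_integral.
Variable R : realType.
Local Open Scope ereal_scope.
Local Notation leb := (@lebesgue_measure R).

Lemma open_borelC (A : set (Cplx R)) : open A -> measurable (A : set (borelC R)).
Proof. by move=> oA; apply: sub_sigma_algebra. Qed.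

(** Semicontinuity is what the averages of a measure have; in general they
    are not continuous. *)
Lemma lsc_measurableC (g : Cplx R -> \bar R) :
  (forall c : R, open [set z | c%:E < g z]) ->
  measurable_fun [set: borelC R] (g : borelC R -> \bar R).
Proof.
move=> og; apply: (measurability _ (ErealGenOInfty.measurableE R)).
move=> /= _ [_ [c ->]] <-; apply: measurableI => //.
have -> : (g : borelC R -> \bar R) @^-1` `]c%:E, +oo[ = [set z | c%:E < g z].
  by apply/seteqP; split => z /=; rewrite in_itv /= andbT.
exact: open_borelC.
Qed.

Lemma continuous_measurableC (g : Cplx R -> R) :
  (forall z (e : R), (0 < e)%R -> exists2 d : R, (0 < d)%R &
    forall w, (cabs (z - w) < d)%R -> (`|g z - g w| < e)%R) ->
  measurable_fun [set: borelC R] (g : borelC R -> R).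
Proof.
move=> cg; apply/measurable_EFinP; apply: lsc_measurableC => c.
rewrite openE => z /=; rewrite lte_fin -subr_gt0 => /(cg z)[d d0 dP].
apply/nbhs_cabsP; exists d => // w /dP /=; rewrite ltr_norml lte_fin.
by clear; lra.
Qed.

Lemma measurable_cabs_continuous (f : Cplx R -> Cplx R) : continuous f ->
  measurable_fun [set: borelC R] (fun z : borelC R => cabs (f z)).
Proof.
move=> cf; apply: continuous_measurableC => z e e0.
have [d d0 dP] := (continuousCP f z).1 (cf z) e e0.
by exists d => // w /dP; apply: le_lt_trans; exact: cabs_dist.
Qed.

Let measurable_plane (F : borelC R -> \bar R) : measurable_fun setT F ->
  measurable_fun setT (F \o @complex_of_plane R).
Proof. by move=> mF; apply: measurableT_comp => //; exact: measurable_complex_of_plane. Qed.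

Lemma area_integralE (F : borelC R -> \bar R) :
  measurable_fun setT F -> (forall z, 0 <= F z) ->
  \int[@area R]_z F z = \int[leb]_x \int[leb]_y F (mkC x y).
Proof.
move=> mF F0.
rewrite (@ge0_integral_pushforward _ _ _ _ _ _ (@measurable_complex_of_plane R) _ setT F)//.
have mP := measurable_plane mF.
have P0 t : 0 <= (F \o @complex_of_plane R) t by exact: F0.
by rewrite preimage_setT fubini_tonelli1.
Qed.

Lemma area_integralE' (F : borelC R -> \bar R) :
  measurable_fun setT F -> (forall z, 0 <= F z) ->
  \int[@area R]_z F z = \int[leb]_y \int[leb]_x F (mkC x y).
Proof.
move=> mF F0; rewrite (area_integralE mF F0).
by apply: (@fubini_tonelli _ _ _ _ _ leb leb (F \o @complex_of_plane R)); [exact: measurable_plane|move=> t; exact: F0].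
Qed.

Lemma measurable_area_line (F : borelC R -> \bar R) :
  measurable_fun setT F -> (forall z, 0 <= F z) ->
  measurable_fun setT (fun x : measurableTypeR R => \int[leb]_y F (mkC x y)).
Proof.
move=> mF F0.
by apply: (@measurable_fun_fubini_tonelli_F _ _ _ _ _ leb (F \o @complex_of_plane R)); [exact: measurable_plane|move=> t; exact: F0].
Qed.

Lemma measurable_area_line' (F : borelC R -> \bar R) :
  measurable_fun setT F -> (forall z, 0 <= F z) ->
  measurable_fun setT (fun y : measurableTypeR R => \int[leb]_x F (mkC x y)).
Proof.
move=> mF F0.
by apply: (@measurable_fun_fubini_tonelli_G _ _ _ _ _ leb (F \o @complex_of_plane R)); [exact: measurable_plane|move=> t; exact: F0].
Qed.

Definition rect (a b c d : R) : set (borelC R) :=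
  [set z : Cplx R | (a <= complex.Re z <= b)%R /\ (c <= complex.Im z <= d)%R].

Lemma continuous_Re_C z (e : R) : (0 < e)%R -> exists2 d : R, (0 < d)%R &
    forall w : Cplx R, (cabs (z - w) < d)%R -> (`|complex.Re z - complex.Re w| < e)%R.
Proof.
move=> e0; exists e => // w; apply: le_lt_trans; apply: le_trans (Re_le_cabs _).
by case: z w => ? ? [? ?].
Qed.

Lemma continuous_Im_C z (e : R) : (0 < e)%R -> exists2 d : R, (0 < d)%R &
    forall w : Cplx R, (cabs (z - w) < d)%R -> (`|complex.Im z - complex.Im w| < e)%R.
Proof.
move=> e0; exists e => // w; apply: le_lt_trans; apply: le_trans (Im_le_cabs _).
by case: z w => ? ? [? ?].
Qed.

Lemma measurable_Re_C : measurable_fun [set: borelC R] (fun z : borelC R => complex.Re (z : Cplx R)).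
Proof. exact: continuous_measurableC continuous_Re_C. Qed.

Lemma measurable_Im_C : measurable_fun [set: borelC R] (fun z : borelC R => complex.Im (z : Cplx R)).
Proof. exact: continuous_measurableC continuous_Im_C. Qed.

Lemma measurable_rect a b c d : measurable (rect a b c d).
Proof.
have -> : rect a b c d =
   ((fun z : borelC R => complex.Re (z : Cplx R)) @^-1` `[a, b]) `&`
   ((fun z : borelC R => complex.Im (z : Cplx R)) @^-1` `[c, d]).
  by apply/seteqP; split => z; rewrite /= !in_itv.
apply: measurableI; rewrite -[X in measurable X]setTI.
  exact: measurable_Re_C.
exact: measurable_Im_C.
Qed.

Lemma area_rectE (F : borelC R -> \bar R) a b c d :
  measurable_fun setT F -> (forall z, 0 <= F z) ->
  \int[@area R]_(z in rect a b c d) F z =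
  \int[leb]_(x in `[a, b]) \int[leb]_(y in `[c, d]) F (mkC x y).
Proof.
move=> mF F0; rewrite integral_mkcond area_integralE; last 2 first.
- by apply/(measurable_restrictT _ _).1 => //; [exact: measurable_rect|exact: measurable_funTS].
- by move=> z; rewrite erestrict_ge0.
rewrite [RHS]integral_mkcond; apply: eq_integral => x _.
rewrite [RHS]patchE; case: ifPn => xab.
  rewrite [RHS]integral_mkcond; apply: eq_integral => y _.
  rewrite !patchE; congr (if _ then _ else _); apply/idP/idP; rewrite !inE /rect /= !in_itv /=.
    by case.
  by move: xab; rewrite inE /= in_itv.
rewrite integral0_eq// => y _; rewrite patchE ifF//.
apply/negbTE; apply: contra xab; rewrite !inE /rect /= in_itv /=.
by case.
Qed.

Lemma area_rectE' (F : borelC R -> \bar R) a b c d :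
  measurable_fun setT F -> (forall z, 0 <= F z) ->
  \int[@area R]_(z in rect a b c d) F z =
  \int[leb]_(y in `[c, d]) \int[leb]_(x in `[a, b]) F (mkC x y).
Proof.
move=> mF F0; rewrite integral_mkcond area_integralE'; last 2 first.
- by apply/(measurable_restrictT _ _).1 => //; [exact: measurable_rect|exact: measurable_funTS].
- by move=> z; rewrite erestrict_ge0.
rewrite [RHS]integral_mkcond; apply: eq_integral => y _.
rewrite [RHS]patchE; case: ifPn => xab.
  rewrite [RHS]integral_mkcond; apply: eq_integral => x _.
  rewrite !patchE; congr (if _ then _ else _); apply/idP/idP; rewrite !inE /rect /= !in_itv /=.
    by case.
  by move: xab; rewrite inE /= in_itv.
rewrite integral0_eq// => x _; rewrite patchE ifF//.
apply/negbTE; apply: contra xab; rewrite !inE /rect /= in_itv /=.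
by case.
Qed.

Lemma area_rect a b c d : (a <= b)%R -> (c <= d)%R ->
  @area R (rect a b c d) = ((b - a) * (d - c))%:E.
Proof.
move=> ab cd; rewrite -[LHS]mul1e -integral_cst; last exact: measurable_rect.
rewrite area_rectE//.
have len u v : (u <= v)%R -> leb `[u, v] = (v - u)%:E.
  by move=> uv; rewrite lebesgue_measure_itv /= lte_fin; case: ltgtP uv => //= -> _; rewrite subrr.
under eq_integral do rewrite integral_cst//= mul1e len//.
by rewrite integral_cst//= len// -EFinM mulrC.
Qed.

End area_integral.

(** * The mean value inequality in L^1 *)

Section L1_estimate.
Variable R : realType.
Local Notation leb := (@lebesgue_measure R).
Implicit Types f : Cplx R -> Cplx R.

Lemma entire_continuous f : entire f -> continuous f.
Proof. by move=> fE z; apply: derivable_continuousC; exact: fE. Qed.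

Lemma integral_le_point (Phi : R -> \bar R) (u v c : R) : u <= v ->
  measurable_fun [set: measurableTypeR R] Phi -> (forall y, (0 <= Phi y)%E) -> 0 <= c ->
  (\int[leb]_(y in `[u, v]) Phi y < (c * (v - u))%:E)%E ->
  exists2 y : R, u <= y <= v & (Phi y <= c%:E)%E.
Proof.
move=> uv mP P0 c0 Plt; apply: contrapT => nP; move: Plt; apply/negP; rewrite -leNgt.
have len : leb `[u, v] = (v - u)%:E.
  by rewrite lebesgue_measure_itv /= lte_fin; case: ltgtP uv => //= -> _; rewrite subrr.
rewrite EFinM -len -integral_cst//; apply: ge0_le_integral => //.
- by apply: measurable_funTS.
- move=> y /=; rewrite in_itv /= => yuv; rewrite leNgt; apply/negP => /ltW h.
  by apply: nP; exists y.
Qed.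

Lemma segint_EFin (u v : R) g : (forall x, u <= x <= v -> {for x, continuous g}) ->
  ((segint u v g)%:E = \int[leb]_(x in `[u, v]) (g x)%:E)%E.
Proof.
move=> cg; rewrite /segint /Rintegral fineK//.
by apply: integrable_fin_num => //; exact: segint_integrable.
Qed.

(** Cutting the function off outside a vertical strip reduces the inner
    integral over a segment to one over the whole line, for which
    measurability comes from Fubini's theorem. *)
Lemma measurable_slice_Re (F : borelC R -> \bar R) (a b : R) :
  measurable_fun setT F -> (forall z, 0 <= F z)%E ->
  measurable_fun [set: measurableTypeR R]
    (fun y : R => \int[leb]_(x in `[a, b]) F (mkC x y))%E.
Proof.
move=> mF F0; pose S : set (borelC R) := [set z : Cplx R | a <= complex.Re z <= b].
have mS : measurable S.
  have -> : S = (fun z : borelC R => complex.Re (z : Cplx R)) @^-1` `[a, b].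
    by apply/seteqP; split => z; rewrite /= in_itv.
  by rewrite -[X in measurable X]setTI; exact: measurable_Re_C.
have -> : (fun y : R => \int[leb]_(x in `[a, b]) F (mkC x y))%E =
    (fun y => \int[leb]_x (F \_ S) (mkC x y))%E.
  apply/funext => y; rewrite integral_mkcond; apply: eq_integral => x _.
  rewrite !patchE; congr (if _ then _ else _).
apply: measurable_area_line'; last by move=> z; rewrite erestrict_ge0.
by apply/(measurable_restrictT _ _).1 => //; exact: measurable_funTS.
Qed.

Lemma measurable_slice_Im (F : borelC R -> \bar R) (a b : R) :
  measurable_fun setT F -> (forall z, 0 <= F z)%E ->
  measurable_fun [set: measurableTypeR R]
    (fun x : R => \int[leb]_(y in `[a, b]) F (mkC x y))%E.
Proof.
move=> mF F0; pose S : set (borelC R) := [set z : Cplx R | a <= complex.Im z <= b].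
have mS : measurable S.
  have -> : S = (fun z : borelC R => complex.Im (z : Cplx R)) @^-1` `[a, b].
    by apply/seteqP; split => z; rewrite /= in_itv.
  by rewrite -[X in measurable X]setTI; exact: measurable_Im_C.
have -> : (fun x : R => \int[leb]_(y in `[a, b]) F (mkC x y))%E =
    (fun x => \int[leb]_y (F \_ S) (mkC x y))%E.
  apply/funext => x; rewrite integral_mkcond; apply: eq_integral => y _.
  rewrite !patchE; congr (if _ then _ else _).
apply: measurable_area_line; last by move=> z; rewrite erestrict_ge0.
by apply/(measurable_restrictT _ _).1 => //; exact: measurable_funTS.
Qed.

(** By Fubini's theorem each of the four strips of width d/2 along the sides
    of the square contains a segment over which the integral of |f| is at
    most about 2/d times the area integral. The four segments bound a
    rectangle at distance at least d/2 from the centre, to which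
    [cauchy_ineq] applies. *)
Lemma L1_estimate f (a b d : R) : entire f -> 0 < d ->
  ((d ^+ 2 * cabs (f (mkC a b)))%:E <=
  4%:E * \int[@area R]_(z in rect (a - d) (a + d) (b - d) (b + d)) (cabs (f z))%:E)%E.
Proof.
move=> fE d0; have cf := entire_continuous fE.
pose H z := (cabs (f z))%:E; have mH : measurable_fun [set: borelC R] H.
  by apply/measurable_EFinP; exact: measurable_cabs_continuous.
have H0 z : (0 <= H z)%E by rewrite lee_fin cabs_ge0.
set I := (\int[_]_(z in _) _)%E; have I0 : (0 <= I)%E by apply: integral_ge0 => z _; exact: H0.
have [->|Ifin] := eqVneq I +oo%E; first by rewrite gt0_muley ?lte_fin// leey.
have {Ifin} : I \is a fin_num by rewrite ge0_fin_numE// ltey.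
move=> /fineK If; rewrite -If -EFinM lee_fin.
set J := fine I in If *; have J0 : 0 <= J by rewrite /J fine_ge0.
apply/ler_addgt0Pr => e e0; pose J' := J + e / 4.
have J'0 : 0 <= J' by rewrite addr_ge0// ltW// divr_gt0.
(* The term e / 4 makes the mean over a strip strictly smaller than c. *)
pose c := J' / (d / 2); have c0 : 0 <= c by rewrite divr_ge0// ltW// divr_gt0.
have IJ : (I < (c * (d / 2))%:E)%E.
  by rewrite /c mulfVK ?gt_eqF ?divr_gt0// -If lte_fin /J' ltrDl divr_gt0.
pose Phi (y : R) := (\int[leb]_(x in `[(a - d)%R, (a + d)%R]) H (mkC x y))%E.
pose Psi (x : R) := (\int[leb]_(y in `[(b - d)%R, (b + d)%R]) H (mkC x y))%E.
have cx y x : {for x, continuous (fun t => cabs (f (mkC t y)))}.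
  by apply: (continuous_cabs_line (mkC_lineX y)); exact: cf.
have cy x y : {for y, continuous (fun t => cabs (f (mkC x t)))}.
  by apply: (continuous_cabs_line (mkC_lineY x)); exact: cf.
have mPhi : measurable_fun [set: measurableTypeR R] Phi.
  by apply: (@measurable_slice_Re H).
have mPsi : measurable_fun [set: measurableTypeR R] Psi.
  by apply: (@measurable_slice_Im H).
have Phi0 y : (0 <= Phi y)%E by apply: integral_ge0 => x _; exact: H0.
have Psi0 y : (0 <= Psi y)%E by apply: integral_ge0 => x _; exact: H0.
have goody (u : R) : b - d <= u -> u + d / 2 <= b + d ->
    exists2 y : R, u <= y <= u + d / 2 & (Phi y <= c%:E)%E.
  move=> bu ub; apply: integral_le_point => //; first by rewrite lerDl divr_ge0// ltW.
  rewrite [X in c * X]addrC addKr; apply: le_lt_trans IJ; rewrite /I area_rectE'//.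
  apply: ge0_subset_integral => //; first exact: measurable_funTS.
  by move=> y /=; rewrite !in_itv /= => /andP[h1 h2]; rewrite (le_trans bu h1) (le_trans h2 ub).
have goodx (u : R) : a - d <= u -> u + d / 2 <= a + d ->
    exists2 y : R, u <= y <= u + d / 2 & (Psi y <= c%:E)%E.
  move=> bu ub; apply: integral_le_point => //; first by rewrite lerDl divr_ge0// ltW.
  rewrite [X in c * X]addrC addKr; apply: le_lt_trans IJ; rewrite /I area_rectE//.
  apply: ge0_subset_integral => //; first exact: measurable_funTS.
  by move=> y /=; rewrite !in_itv /= => /andP[h1 h2]; rewrite (le_trans bu h1) (le_trans h2 ub).
have [y1 hy1 Py1] : exists2 y : R, b - d <= y <= b - d + d / 2 & (Phi y <= c%:E)%E.
  by apply: goody => //; clear -d0; lra.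
have [y2 hy2 Py2] : exists2 y : R, b + d / 2 <= y <= b + d / 2 + d / 2 & (Phi y <= c%:E)%E.
  by apply: goody => //; clear -d0; lra.
have [x1 hx1 Px1] : exists2 y : R, a - d <= y <= a - d + d / 2 & (Psi y <= c%:E)%E.
  by apply: goodx => //; clear -d0; lra.
have [x2 hx2 Px2] : exists2 y : R, a + d / 2 <= y <= a + d / 2 + d / 2 & (Psi y <= c%:E)%E.
  by apply: goodx => //; clear -d0; lra.
have segPhi y : (Phi y <= c%:E)%E -> segint x1 x2 (fun x => cabs (f (mkC x y))) <= c.
  rewrite -lee_fin => /(le_trans _); apply; rewrite segint_EFin; last by move=> x _; exact: cx.
  apply: ge0_subset_integral => //.
    apply: measurable_funTS; apply/measurable_EFinP; apply: continuous_measurable_fun => x; exact: cx.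
    by move=> x _; exact: H0.
  by move=> x /=; rewrite !in_itv /=; move: hx1 hx2; clear -d0; lra.
have segPsi x : (Psi x <= c%:E)%E -> segint y1 y2 (fun y => cabs (f (mkC x y))) <= c.
  rewrite -lee_fin => /(le_trans _); apply; rewrite segint_EFin; last by move=> y _; exact: cy.
  apply: ge0_subset_integral => //.
    apply: measurable_funTS; apply/measurable_EFinP; apply: continuous_measurable_fun => y; exact: cy.
    by move=> y _; exact: H0.
  by move=> y /=; rewrite !in_itv /=; move: hy1 hy2; clear -d0; lra.
have := @cauchy_ineq R f a b x1 x2 y1 y2 (d / 2) fE.
rewrite divr_gt0// => /(_ isT); rewrite !segintD; [|by move=> ? _; first [exact: cx|exact: cy]..].
have := segPhi _ Py1; have := segPhi _ Py2; have := segPsi _ Px1; have := segPsi _ Px2.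
set s1 := segint _ _ _; set s2 := segint _ _ _; set s3 := segint _ _ _; set s4 := segint _ _ _.
move=> b4 b3 b2 b1 key.
have {}key : 4 * (d / 2) * cabs (f (mkC a b)) <= 4 * c.
  apply: le_trans (key _ _ _ _) _; try by move: hx1 hx2 hy1 hy2; clear -d0; lra.
  by move: b1 b2 b3 b4; clear; lra.
have -> : 4 * J + e = (d / 2) * (4 * c).
  by rewrite /c /J'; field; rewrite gt_eqF.
have -> : d ^+ 2 * cabs (f (mkC a b)) = (d / 2) * (4 * (d / 2) * cabs (f (mkC a b))).
  by field.
by rewrite ler_pM2l// divr_gt0.
Qed.

End L1_estimate.

(** * The mean value inequality in L^p *)

Section Lp_estimate.
Variable R : realType.
Implicit Types f : Cplx R -> Cplx R.

Definition square (a b d : R) := rect (a - d) (a + d) (b - d) (b + d).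

Lemma bounded_on_rect f (a b c d : R) : continuous f ->
  exists2 B : R, 0 <= B & forall z, rect a b c d z -> cabs (f z) <= B.
Proof.
move=> cf; have [ab|/negP ab] := boolP (a <= b); last first.
  by exists 0 => // z [/andP[h1 h2] _]; case: ab; exact: le_trans h1 h2.
have [cd|/negP cd] := boolP (c <= d); last first.
  by exists 0 => // z [_ /andP[h1 h2]]; case: cd; exact: le_trans h1 h2.
pose g (p : R * R) : R := cabs (f (mkC p.1 p.2)).
have cg : continuous g.
  move=> [x y]; apply/cvgrPdist_lt => e e0.
  have [dl dl0 dP] := (continuousCP f (mkC x y)).1 (cf _) e e0.
  have dl2 : 0 < dl / 2 by rewrite divr_gt0.
  exists (ball x (dl / 2), ball y (dl / 2)); first by split; exact: nbhsx_ballx.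
  move=> [u v] [/= xu yv]; apply: le_lt_trans (cabs_dist _ _) _; apply: dP.
  apply: le_lt_trans (cabs_le _) _.
  by move: xu yv; rewrite /ball /= => xu yv; rewrite [ltRHS]splitr ltrD.
have [] := @compact_EVT_max _ R g (`[a, b] `*` `[c, d]).
- by exists (a, c); split; rewrite /= in_itv /= lexx.
- by apply: compact_setX; exact: segment_compact.
- exact: continuous_subspaceT.
move=> m _ mP; exists (g m); first exact: cabs_ge0.
move=> [x y] [xab ycd]; apply: (mP (x, y)).
by rewrite inE; split; rewrite /= in_itv.
Qed.

Lemma powR_mono (p x y : R) : 0 <= p -> 0 <= x -> x <= y -> x `^ p <= y `^ p.
Proof.
by move=> p0 x0 xy; apply: ge0_ler_powR; rewrite ?nnegrE// (le_trans x0).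
Qed.

Lemma powR_lec (p x y : R) : 0 < p -> 0 <= x -> 0 <= y -> (x `^ p <= y `^ p) = (x <= y).
Proof.
move=> p0 x0 y0; apply/idP/idP; last exact: powR_mono (ltW p0) x0.
by apply: contraTT; rewrite -!ltNge => yx; apply: gt0_ltr_powR; rewrite ?nnegrE.
Qed.

Lemma powRV (p x : R) : 0 <= x -> x^-1 `^ p = (x `^ p)^-1.
Proof. by move=> x0; rewrite -powR_inv1// powRAC powR_inv1// powR_ge0. Qed.

(** Absorbing a small multiple of [S] on the left turns a weak-type bound
    with a free parameter into a power bound; this replaces the inequalities
    of Hoelder and Jensen. *)
Lemma absorb (p K S I : R) : 0 < p -> 0 < K -> 0 <= S -> 0 <= I ->
  (forall l, 0 < l -> S <= l * K + l `^ (1 - p) * I) ->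
  S `^ p <= 2 * (2 * K) `^ (p - 1) * I.
Proof.
move=> p0 K0 S0 I0 H; have [->|Sn] := eqVneq S 0.
  by rewrite powR0 ?gt_eqF// !mulr_ge0// powR_ge0.
have {Sn}S0 : 0 < S by rewrite lt_def Sn.
have K20 : 0 < 2 * K by rewrite mulr_gt0.
have l0 : 0 < S / (2 * K) by rewrite divr_gt0.
have := H _ l0; have -> : S / (2 * K) * K = S / 2 by field; rewrite gt_eqF.
set L := _ `^ (1 - p) => h.
have E : S `^ (p - 1) * L = (2 * K) `^ (p - 1).
  rewrite /L powRM ?invr_ge0 ?(ltW S0) ?(ltW K20)// mulrA -powRD; last by rewrite (gt_eqF S0) implybT.
  have -> : p - 1 + (1 - p) = 0 by ring.
  rewrite powRr0 mul1r -powR_inv1 ?(ltW K20)// -powRrM; congr (_ `^ _); ring.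
have : S / 2 <= L * I by move: h; clear; lra.
have Sp0 : 0 < S `^ (p - 1) by rewrite powR_gt0.
rewrite -(ler_pM2l Sp0) (mulrA _ L) E => {}h.
have -> : S `^ p = S `^ (p - 1) * S.
  by rewrite mulrC mulr_powRB1// ltW.
by move: h; clear; lra.
Qed.

(** Either [x <= l], or the factor by which the last term exceeds [x], namely
    (x / l)^(p-1), is at least 1. *)
Lemma weak_split (p x l : R) : 1 <= p -> 0 <= x -> 0 < l ->
  x <= l + l `^ (1 - p) * x `^ p.
Proof.
move=> p1 x0 l0; have [xl|lx] := leP x l.
  by rewrite (le_trans xl)// lerDl mulr_ge0// powR_ge0.
have x0' := lt_trans l0 lx.
apply: (@le_trans _ _ (l `^ (1 - p) * x `^ p)); last by rewrite lerDr ltW.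
rewrite -(mulr_powRB1 x0 (lt_le_trans ltr01 p1)) mulrCA ler_peMr//.
have -> : l `^ (1 - p) = (l `^ (p - 1))^-1 by rewrite -powRN; congr (_ `^ _); ring.
rewrite mulrC ler_pdivlMr ?powR_gt0// mul1r.
by apply: ge0_ler_powR; rewrite ?nnegrE ?subr_ge0// ltW.
Qed.

Lemma measurable_cabs_powR f (p : R) : continuous f ->
  measurable_fun [set: borelC R] (fun z : borelC R => cabs (f z) `^ p).
Proof.
move=> cf; apply: (@measurableT_comp _ _ _ _ _ _ (fun x : R => x `^ p)) => //.
exact: measurable_cabs_continuous.
Qed.

Let powInt f (p a b d : R) := (\int[@area R]_(z in square a b d) (cabs (f z) `^ p)%:E)%E.

Let powInt_ge0 f p a b d : (0 <= powInt f p a b d)%E.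
Proof. by apply: integral_ge0 => z _; rewrite lee_fin powR_ge0. Qed.

(** Split |f| at an arbitrary level in the estimate for p = 1, and optimise
    over the level by [absorb]. *)
Lemma Lp_estimate_ge1 (p : R) : 1 <= p ->
  exists2 C : R, 0 < C & forall f a b, entire f ->
    ((cabs (f (mkC a b)) `^ p)%:E <= C%:E * powInt f p a b 1)%E.
Proof.
move=> p1; have p0 := lt_le_trans ltr01 p1.
have k16 : 0 < 2 * (16 : R) by [].
exists (2 * (2 * 16) `^ (p - 1) * 4); first by rewrite !mulr_gt0// powR_gt0.
move=> f a b fE; have cf := entire_continuous fE.
have [->|Ifin] := eqVneq (powInt f p a b 1) +oo%E.
  by rewrite gt0_muley ?lte_fin ?leey// !mulr_gt0// powR_gt0.
have {Ifin} Ifin : powInt f p a b 1 \is a fin_num by rewrite ge0_fin_numE// ltey.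
rewrite -(fineK Ifin); set I := fine _.
have I0 : 0 <= I by apply: fine_ge0; exact: powInt_ge0.
rewrite -EFinM lee_fin -[leRHS]mulrA; apply: (@absorb p 16 _ (4 * I) p0) => //; [exact: cabs_ge0|by rewrite mulr_ge0|].
move=> l l0; have := @L1_estimate R f a b 1 fE ltr01.
rewrite expr1n mul1r => H; rewrite -lee_fin; apply: le_trans H _.
have mC : measurable (square a b 1) by exact: measurable_rect.
have -> : (l * 16 + l `^ (1 - p) * (4 * I) = 4 * (l * 4 + l `^ (1 - p) * I))%R by ring.
rewrite EFinM lee_pmul2l// EFinD.
apply: (@le_trans _ _ (\int[@area R]_(z in square a b 1) (l%:E + (l `^ (1 - p))%:E * (cabs (f z) `^ p)%:E))%E).
  apply: ge0_le_integral => //.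
  - by move=> z _; rewrite lee_fin cabs_ge0.
  - by apply: measurable_funTS; apply/measurable_EFinP; exact: measurable_cabs_continuous.
  - apply: emeasurable_funD => //; apply: emeasurable_funM => //.
    by apply: measurable_funTS; apply/measurable_EFinP; exact: measurable_cabs_powR.
  - by move=> z _; rewrite -EFinM -EFinD lee_fin weak_split// cabs_ge0.
have mP : measurable_fun (square a b 1) (fun z : borelC R => (cabs (f z) `^ p)%:E).
  by apply: measurable_funTS; apply/measurable_EFinP; exact: measurable_cabs_powR.
rewrite ge0_integralD//; last 3 first.
- by move=> z _; rewrite lee_fin ltW.
- by move=> z _; rewrite -EFinM lee_fin mulr_ge0 ?powR_ge0.
- by apply: emeasurable_funM.
rewrite integral_cst//.
have -> : (@area R : {measure set (borelC R) -> \bar R}) (square a b 1) = 4%:E.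
  rewrite /square [LHS]area_rect; [|by clear; lra..].
  by congr (_%:E); ring.
rewrite ge0_integralZl//; last 2 first.
- by move=> z _; rewrite lee_fin powR_ge0.
- by rewrite lee_fin powR_ge0.
rewrite -EFinM leeD2l// EFinM; apply: lee_pmul => //.
  by rewrite lee_fin powR_ge0.
  exact: powInt_ge0.
by rewrite /I fineK.
Qed.

(** Let depth(w) be the distance from w to the sides of the square, and take
    w where |f(w)| depth(w)^(2/p) nearly attains its supremum M. On the
    square of half-side depth(w)/2 around w, |f| is at most a constant times
    |f(w)|, whence |f| <= (constant |f(w)|)^(1-p) |f|^p there, and the
    estimate for p = 1 on this square bounds |f(w)|^p depth(w)^2, that is
    M^p, by the integral of |f|^p. *)
Lemma Lp_estimate_lt1 (p : R) : 0 < p -> p < 1 ->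
  exists2 C : R, 0 < C & forall f a b, entire f ->
    ((cabs (f (mkC a b)) `^ p)%:E <= C%:E * powInt f p a b 1)%E.
Proof.
move=> p0 p1; pose C := 8 * 2 `^ (2 / p).
have C0 : 0 < C by rewrite mulr_gt0// powR_gt0.
exists C => // f a b fE; have cf := entire_continuous fE.
have [->|Ifin] := eqVneq (powInt f p a b 1) +oo%E.
  by rewrite gt0_muley ?lte_fin ?leey.
have {Ifin} Ifin : powInt f p a b 1 \is a fin_num by rewrite ge0_fin_numE// ltey.
rewrite -(fineK Ifin); set I := fine _.
have I0 : 0 <= I by apply: fine_ge0; exact: powInt_ge0.
rewrite -EFinM lee_fin.
pose depth (z : Cplx R) : R := 1 - Num.max `|complex.Re z - a| `|complex.Im z - b|.
pose g z := cabs (f z) * depth z `^ (2 / p).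
have q0 : 0 < 2 / p by rewrite divr_gt0.
have dep01 z : square a b 1 z -> 0 <= depth z <= 1.
  move=> [zx zy]; rewrite /depth subr_ge0 ge_max !ler_norml gerBl le_max normr_ge0 andbT.
  by move: zx zy; clear; lra.
have g0 z : 0 <= g z by rewrite mulr_ge0 ?cabs_ge0 ?powR_ge0.
have [B B0 fB] := @bounded_on_rect f (a - 1) (a + 1) (b - 1) (b + 1) cf.
pose G := [set g z | z in square a b 1].
have zin : square a b 1 (mkC a b) by split => /=; clear; lra.
have hsG : has_sup G.
  split; first by exists (g (mkC a b)); exists (mkC a b).
  exists B => _ [z zs <-]; rewrite /g -[leRHS]mulr1; apply: ler_pM => //.
  - exact: cabs_ge0.
  - exact: powR_ge0.
  - exact: fB.
  - have /andP[d0 d1] := dep01 z zs.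
    apply: (@le_trans _ _ (1 `^ (2 / p))); last by rewrite powR1.
    by apply: ge0_ler_powR; rewrite ?nnegrE// ltW.
pose M := sup G.
have gM z : square a b 1 z -> g z <= M.
  by move=> zs; apply: ub_le_sup; [exact: hsG.2|exists z].
have gz : g (mkC a b) = cabs (f (mkC a b)).
  by rewrite /g /depth /= !subrr normr0 maxxx subr0 powR1 mulr1.
have fzM : cabs (f (mkC a b)) <= M by rewrite -gz gM.
have [M0|M0] := leP M 0.
  have -> : cabs (f (mkC a b)) = 0.
    by apply/eqP; rewrite eq_le cabs_ge0 andbT (le_trans fzM).
  by rewrite powR0 ?gt_eqF// mulr_ge0// ltW.
apply: (@le_trans _ _ (M `^ p)).
  by apply: ge0_ler_powR; rewrite ?nnegrE ?cabs_ge0// ltW.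
have [_ [w ws <-] gw] := @sup_adherent _ G (M / 2) (divr_gt0 M0 (ltr0Sn _ _)) hsG.
have {}gw : M / 2 < g w by move: gw; rewrite -/M; clear; lra.
have /andP[dw0 dw1] := dep01 w ws.
have {dw0} dw0 : 0 < depth w.
  rewrite lt_def dw0 andbT; apply: contraTneq gw => dw; rewrite -leNgt /g dw.
  by rewrite powR0 ?gt_eqF// mulr0 divr_ge0// ltW.
pose d := depth w / 2; have d0 : 0 < d by rewrite divr_gt0.
pose D := d `^ (2 / p); have D0 : 0 < D by rewrite powR_gt0.
have Dp : D `^ p = d ^+ 2.
  by rewrite /D -powRrM mulfVK ?gt_eqF// powR_mulrn// ltW.
case: w ws gw dw0 dw1 @d d0 @D D0 Dp => u v ws gw dw0 dw1 d d0 D D0 Dp.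
have near z : square u v d z -> square a b 1 z /\ d <= depth z.
  move=> [zx zy]; have : depth (u +i* v)%C = 2 * d by rewrite /d; field.
  rewrite {1}/depth /= => dE.
  have [m1 m2] : `|u - a| <= 1 - 2 * d /\ `|v - b| <= 1 - 2 * d.
    have : Num.max `|u - a| `|v - b| <= 1 - 2 * d by rewrite -dE; clear; lra.
    by rewrite ge_max => /andP[].
  have [z1 z2] : `|complex.Re z - a| <= 1 - d /\ `|complex.Im z - b| <= 1 - d.
    by move: m1 m2 zx zy; clear; rewrite !ler_norml; lra.
  split; last first.
    have : Num.max `|complex.Re z - a| `|complex.Im z - b| <= 1 - d by rewrite ge_max z1 z2.
    by rewrite /depth; clear; lra.
  by move: z1 z2 d0; clear; rewrite !ler_norml /square /rect /=; lra.
have fD z : square u v d z -> cabs (f z) <= M / D.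
  move=> zs; have [z1 dz] := near z zs; rewrite ler_pdivlMr//.
  apply: le_trans (gM z z1); rewrite /g ler_wpM2l ?cabs_ge0//.
  by apply: ge0_ler_powR; rewrite ?nnegrE ?(ltW d0)// ?(ltW q0)// (le_trans (ltW d0)).
have MD0 : 0 < M / D by rewrite divr_gt0.
have fsplit z : square u v d z -> cabs (f z) <= (M / D) `^ (1 - p) * cabs (f z) `^ p.
  move=> zs; have [->|fz0] := eqVneq (cabs (f z)) 0.
    by rewrite powR0 ?gt_eqF// mulr0.
  have fz1 : 0 < cabs (f z) by rewrite lt_def fz0 cabs_ge0.
  (* The exponent 1 - p is positive, so the upper bound of |f| may be used. *)
  have {1}-> : cabs (f z) = cabs (f z) `^ (1 - p) * cabs (f z) `^ p.
    by rewrite -powRD ?subrK ?powRr1 ?(ltW fz1)// (gt_eqF fz1) implybT.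
  rewrite ler_wpM2r ?powR_ge0//.
  by apply: ge0_ler_powR; rewrite ?nnegrE ?subr_ge0 ?(ltW p1) ?(ltW fz1) ?(ltW MD0)// fD.
have mCd : measurable (square u v d) by exact: measurable_rect.
have mP (A : set (borelC R)) : measurable_fun A (fun z : borelC R => (cabs (f z) `^ p)%:E).
  by apply: measurable_funTS; apply/measurable_EFinP; exact: measurable_cabs_powR.
have key : d ^+ 2 * cabs (f (mkC u v)) <= 4 * ((M / D) `^ (1 - p) * I).
  rewrite -lee_fin; apply: le_trans (@L1_estimate R f u v d fE d0) _.
  rewrite EFinM lee_pmul2l//.
  apply: (@le_trans _ _ (\int[@area R]_(z in square u v d)
      (((M / D) `^ (1 - p))%:E * (cabs (f z) `^ p)%:E))%E).
    apply: ge0_le_integral => //.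
    - by move=> z _; rewrite lee_fin cabs_ge0.
    - by apply: measurable_funTS; apply/measurable_EFinP; exact: measurable_cabs_continuous.
    - by apply: emeasurable_funM.
  rewrite ge0_integralZl//; last 2 first.
  - by move=> z _; rewrite lee_fin powR_ge0.
  - by rewrite lee_fin powR_ge0.
  rewrite EFinM; apply: lee_pmul => //.
  - by rewrite lee_fin powR_ge0.
  - by apply: integral_ge0 => z _; rewrite lee_fin powR_ge0.
  rewrite /I fineK//; apply: ge0_subset_integral => //.
  - exact: measurable_rect.
  - by move=> z _; rewrite lee_fin powR_ge0.
  - by move=> z /near[].
have gwE : g (mkC u v) = cabs (f (mkC u v)) * (2 `^ (2 / p) * D).
  rewrite /g; congr (_ * _); rewrite /D -powRM ?(ltW d0)//; congr (_ `^ _).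
  by rewrite /d; field.
have MDp : (M / D) `^ (1 - p) = (M / D) * (d ^+ 2 / M `^ p).
  have -> : d ^+ 2 / M `^ p = (M / D) `^ (- p).
    rewrite powRN powRM ?invr_ge0 ?(ltW M0) ?(ltW D0)//.
    by rewrite (powRV _ (ltW D0)) Dp invfM invrK mulrC.
  by rewrite -{2}[M / D]powRr1 ?(ltW MD0)// -powRD// (gt_eqF MD0) implybT.
have Mp0 : 0 < M `^ p by rewrite powR_gt0.
have T0 : 0 < 2 `^ (2 / p) by rewrite powR_gt0.
rewrite MDp in key; move: gw; rewrite -/(mkC u v) gwE => gw.
move: key gw; rewrite /C; set F := cabs _; set T := 2 `^ _ in T0 *; set Mp := M `^ p in Mp0 *.
move=> key gw.
have {gw} gw : M / (2 * T * D) <= F.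
  rewrite ler_pdivrMr ?mulr_gt0//.
  have -> : F * (2 * T * D) = 2 * (F * (T * D)) by ring.
  by move: gw; clear; lra.
have h : d ^+ 2 * (M / (2 * T * D)) <= 4 * (M / D * (d ^+ 2 / Mp) * I).
  by apply: le_trans key; rewrite ler_wpM2l// sqr_ge0.
have nz : [/\ M != 0, D != 0, d != 0, T != 0 & Mp != 0] by split; rewrite gt_eqF.
case: nz => nM nD nd nT nMp.
have -> : Mp = d ^+ 2 * (M / (2 * T * D)) * (2 * T * D * Mp / (d ^+ 2 * M)).
  by field; do ![apply/andP; split => //].
have -> : 8 * T * I = 4 * (M / D * (d ^+ 2 / Mp) * I) * (2 * T * D * Mp / (d ^+ 2 * M)).
  by field; do ![apply/andP; split => //].
by rewrite ler_wpM2r// ltW// !(mulr_gt0, invr_gt0, exprn_gt0).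
Qed.

Lemma Lp_estimate (p : R) : 0 < p ->
  exists2 C : R, 0 < C & forall f a b, entire f ->
    ((cabs (f (mkC a b)) `^ p)%:E <=
     C%:E * \int[@area R]_(z in square a b 1) (cabs (f z) `^ p)%:E)%E.
Proof.
by move=> p0; have [p1|p1] := leP 1 p; [exact: Lp_estimate_ge1|exact: Lp_estimate_lt1].
Qed.

End Lp_estimate.

(** * The complex exponential and the Gaussian weight *)

Section complex_exponential.
Variable R : realType.
Implicit Types (x y : R) (z w c : Cplx R).

Definition cexp z : Cplx R :=
  mkC (expR (complex.Re z) * cos (complex.Im z)) (expR (complex.Re z) * sin (complex.Im z)).

Lemma cabs_cexp z : cabs (cexp z) = expR (complex.Re z).
Proof.
rewrite /cabs /cexp /= !exprMn -mulrDr cos2Dsin2 mulr1 sqrtr_sqr.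
by rewrite ger0_norm// expR_ge0.
Qed.

Lemma cexpD z w : cexp (z + w) = cexp z * cexp w.
Proof.
case: z w => a b [c d]; rewrite /cexp /= expRD cosD sinD.
by apply/eqP; rewrite eq_complex /=; apply/andP; split; apply/eqP; ring.
Qed.

(** The real counterpart of [cdiff]. *)
Lemma derive_eps (f : R -> R) (x l : R) : is_derive x 1 f l ->
  forall e : R, 0 < e -> exists2 d : R, 0 < d & forall h : R, `|h| < d ->
    `|f (h + x) - f x - l * h| <= e * `|h|.
Proof.
move=> fl e e0; have [df fE] := fl; move/cvg_ex: df => [l' fl'].
have ll : l' = l by rewrite -fE; apply/esym/cvg_lim.
rewrite {}ll {l'} in fl'; move/cvgrPdist_lt : fl' => /(_ e e0).
move=> /nbhs_ballP[d /= d0 dP]; exists d => // h hd.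
have [->|h0] := eqVneq h 0; first by rewrite add0r subrr mulr0 subrr normr0 mulr0.
have := dP h; rewrite /ball /= sub0r normrN => /(_ hd h0).
rewrite /GRing.scale /= mulr1 => H.
have -> : f (h + x) - f x - l * h = - (l - h^-1 * (f (h + x) - f x)) * h.
  by field.
by rewrite normrM normrN ler_wpM2r// ltW.
Qed.

(** Differentiability of the exponential at 0; the addition formula carries
    it to every other point. *)
Lemma cexp_near0 (e : R) : 0 < e -> exists2 d : R, 0 < d & forall h : Cplx R,
  cabs h < d -> cabs (cexp h - 1 - h) <= e * cabs h.
Proof.
move=> e0; have [k [k0 k1 k7]] : exists k : R, [/\ 0 < k, k <= 1 & 7 * k <= e].
  exists (Num.min (e / 7) 1); split; first by rewrite lt_min divr_gt0// ltr01.
    by rewrite ge_min lexx orbT.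
  by rewrite mulrC -ler_pdivlMr// ge_min lexx.
have [d1 d10 E1] := derive_eps (@is_derive_expR R 0) k0.
have [d2 d20 E2] := derive_eps (@is_derive_cos R 0) k0.
have [d3 d30 E3] := derive_eps (@is_derive_sin R 0) k0.
exists (Num.min k (Num.min d1 (Num.min d2 d3))).
  by rewrite !lt_min k0 d10 d20 d30.
move=> [x y] hd.
have : `|x| < _ := le_lt_trans (Re_le_cabs (x +i* y)%C) hd.
have : `|y| < _ := le_lt_trans (Im_le_cabs (x +i* y)%C) hd.
rewrite !lt_min => /and4P[yk y1 y2 y3] /and4P[xk x1 x2 x3].
have := E1 x x1; have := E2 y y2; have := E3 y y3.
rewrite !addr0 expR0 cos0 sin0 oppr0 mul0r subr0 addr0 !mul1r => S3 S2 S1.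
apply: le_trans (_ : 7 * k * cabs (x +i* y)%C <= _); last by rewrite ler_wpM2r// cabs_ge0.
apply: le_trans (cabs_le _) _; rewrite /= !subr0.
have c1 : `|cos y| <= 1 by rewrite ler_norml cos_geN1 cos_le1.
have s1 : `|sin y| <= 1 by rewrite ler_norml sin_geN1 sin_le1.
have x1' : `|1 + x| <= 2.
  by apply: le_trans (ler_normD _ _) _; rewrite normr1; move: xk k1; clear; lra.
have A1 : `|expR x * cos y - 1 - x| <= k * `|x| + 2 * (k * `|y|).
  have -> : expR x * cos y - 1 - x = (expR x - 1 - x) * cos y + (1 + x) * (cos y - 1) by ring.
  apply: le_trans (ler_normD _ _) _; rewrite !normrM; apply: lerD.
    by rewrite -[leRHS]mulr1 ler_pM.
  by rewrite ler_pM.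
have A2 : `|expR x * sin y - y| <= k * `|x| + 2 * (k * `|y|) + k * `|y|.
  have -> : expR x * sin y - y = (expR x - 1 - x) * sin y + (1 + x) * (sin y - y) + x * y by ring.
  apply: le_trans (ler_normD _ _) _; rewrite normrM; apply: lerD; last first.
    by rewrite ler_pM// ltW.
  apply: le_trans (ler_normD _ _) _; rewrite !normrM; apply: lerD.
    by rewrite -[leRHS]mulr1 ler_pM.
  by rewrite ler_pM.
apply: le_trans (lerD A1 A2) _.
have xc := Re_le_cabs (x +i* y)%C; have yc := Im_le_cabs (x +i* y)%C; rewrite /= in xc yc.
have := ler_wpM2l (ltW k0) xc; have := ler_wpM2l (ltW k0) yc.
by clear; rewrite -[7 * k * _]mulrA; lra.
Qed.

Lemma cexp_lin_derivable c z : derivable (fun w => cexp (c * w)) z 1.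
Proof.
apply: (@cdiff_derivable _ _ _ (cexp (c * z) * c)) => e e0.
pose N := cabs (cexp (c * z)) * cabs c + 1.
have N0 : 0 < N by rewrite ltr_wpDl// mulr_ge0// cabs_ge0.
have [d d0 dP] := cexp_near0 (divr_gt0 e0 N0).
have c10 : 0 < cabs c + 1 by rewrite ltr_wpDl// cabs_ge0.
exists (d / (cabs c + 1)); first by rewrite divr_gt0.
move=> w; rewrite ltr_pdivlMr// => wd; set h := w - z in wd *.
have -> : cexp (c * w) - cexp (c * z) - cexp (c * z) * c * h =
    cexp (c * z) * (cexp (c * h) - 1 - c * h).
  have -> : c * w = c * z + c * h by rewrite /h; ring.
  by rewrite cexpD; ring.
have hd : cabs (c * h) < d.
  rewrite cabsM; apply: le_lt_trans wd; rewrite mulrC ler_wpM2l ?cabs_ge0//.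
  by rewrite lerDl.
rewrite cabsM; apply: (@le_trans _ _ (cabs (cexp (c * z)) * (e / N * cabs (c * h)))).
  by rewrite ler_wpM2l ?cabs_ge0// dP.
rewrite [in leLHS]cabsM.
have -> : cabs (cexp (c * z)) * (e / N * (cabs c * cabs h)) =
   (e * cabs h) * ((N - 1) / N) by rewrite {2}/N addrK; ring.
rewrite -[leRHS]mulr1 ler_wpM2l ?mulr_ge0 ?cabs_ge0 ?(ltW e0)//.
by rewrite ler_pdivrMr// mul1r gerBl.
Qed.

Lemma cabs_gauss z : cabs (gauss z) = expR (- (cabs z ^+ 2 / 2)).
Proof. by rewrite /gauss cabs_real ger0_norm// expR_ge0. Qed.

Lemma measurable_cabs_gauss (f : Cplx R -> Cplx R) : continuous f ->
  measurable_fun [set: borelC R] (fun z : borelC R => cabs (f z * gauss z)).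
Proof.
move=> cf; have -> : (fun z : borelC R => cabs (f z * gauss z)) =
    (fun z => cabs (f z) * expR (- (cabs z ^+ 2 / 2))).
  by apply/funext => z; rewrite cabsM cabs_gauss.
apply: measurable_funM; first exact: measurable_cabs_continuous.
apply: measurableT_comp => //; apply: measurableT_comp => //; apply: measurable_funM => //.
apply: measurable_funX; apply: (@measurable_cabs_continuous R id) => w.
exact: cvg_id.
Qed.

Lemma measurable_gauss_powR (f : Cplx R -> Cplx R) (p : R) (A : set (borelC R)) : continuous f ->
  measurable_fun A (fun z : borelC R => (cabs (f z * gauss z) `^ p)%:E).
Proof.
move=> cf; apply: measurable_funTS; apply/measurable_EFinP.
apply: (@measurableT_comp _ _ _ _ _ _ (fun x : R => x `^ p)) => //.
exact: measurable_cabs_gauss.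
Qed.

(** Multiplying by the exponential of a linear function recentres the Gaussian
    weight at any chosen point. *)
Lemma recentre z w :
  expR (cabs z ^+ 2 / 2) * cabs (cexp (- conjc z * w)) =
  cabs (gauss w) * expR (cabs (w - z) ^+ 2 / 2).
Proof.
rewrite cabs_cexp cabs_gauss -!expRD; congr expR; rewrite !sqr_cabs.
by case: z w => a b [c d] /=; field.
Qed.

(** Apply [Lp_estimate] to f times the exponential that recentres the weight
    at the point ([recentre]): in the square of half-side 1 around it, the
    modulus of this product is the weighted modulus of f up to a factor
    between 1 and exp(1). *)
Lemma gauss_Lp_estimate (p : R) : 0 < p ->
  exists2 C : R, 0 < C & forall (f : Cplx R -> Cplx R) a b, entire f ->
    ((cabs (f (mkC a b) * gauss (mkC a b)) `^ p)%:E <=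
     C%:E * \int[@area R]_(z in square a b 1) (cabs (f z * gauss z) `^ p)%:E)%E.
Proof.
move=> p0; have [C C0 CP] := @Lp_estimate R p p0.
pose E := expR 1 `^ p : R; have E0 : 0 < E by rewrite powR_gt0// expR_gt0.
exists (C * E); first by rewrite mulr_gt0.
move=> f a b fE; set z0 := mkC a b.
pose k : Cplx R := ((expR (cabs z0 ^+ 2 / 2))%:C)%C.
have k_abs : cabs k = expR (cabs z0 ^+ 2 / 2) by rewrite cabs_real ger0_norm// expR_ge0.
pose g w := k * (f w * cexp (- conjc z0 * w)).
have gE : entire g.
  move=> w; apply: derivableM; first exact: derivable_cst.
  by apply: derivableM; [exact: fE|exact: cexp_lin_derivable].
have gA w : cabs (g w) = cabs (f w * gauss w) * expR (cabs (w - z0) ^+ 2 / 2).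
  by rewrite /g !cabsM k_abs mulrCA recentre mulrA.
have := CP g a b gE; rewrite -/z0 gA subrr cabs0 expr0n /= mul0r expR0 mulr1.
move=> /le_trans; apply; rewrite EFinM -muleA lee_pmul2l//.
have mC : measurable (square a b 1) by exact: measurable_rect.
have mfp : measurable_fun (square a b 1) (fun z : borelC R => (cabs (f z * gauss z) `^ p)%:E).
  by apply: measurable_gauss_powR; exact: entire_continuous.
rewrite -ge0_integralZl//; last 2 first.
- by move=> z _; rewrite lee_fin powR_ge0.
- by rewrite lee_fin ltW.
apply: ge0_le_integral => //.
- by move=> z _; rewrite lee_fin powR_ge0.
- apply: measurable_funTS; apply/measurable_EFinP.
  by apply: measurable_cabs_powR; exact: entire_continuous.
- exact: emeasurable_funM.
move=> z zs; rewrite -EFinM lee_fin gA powRM ?cabs_ge0 ?expR_ge0// mulrC.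
apply: ler_wpM2r; first exact: powR_ge0.
apply: powR_mono; [exact: ltW|exact: expR_ge0|].
rewrite ler_expR sqr_cabs; case: z zs => x y [/= h1 h2].
have h3 : `|x - a| <= 1 by rewrite ler_norml; move: h1; clear; lra.
have h4 : `|y - b| <= 1 by rewrite ler_norml; move: h2; clear; lra.
have : `|x - a| ^+ 2 <= 1 by rewrite expr_le1.
have : `|y - b| ^+ 2 <= 1 by rewrite expr_le1.
by rewrite !real_normK ?num_real//; clear; lra.
Qed.

End complex_exponential.

(** * The local estimate in Fock-Sobolev spaces *)

Section weighted_estimate.
Variable R : realType.
Implicit Types (f : Cplx R -> Cplx R) (z w : Cplx R).

(** A weak maximum principle. The annulus contains the boundary of the square
    of half-side d. *)
Lemma annulus_bound f (a b d B : R) : entire f -> 0 < d ->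
  (forall w, d <= cabs (w - mkC a b) <= 2 * d -> cabs (f w) <= B) ->
  cabs (f (mkC a b)) <= 2 * B.
Proof.
move=> fE d0 fB; have cf := entire_continuous fE.
have cx y x : {for x, continuous (fun t => cabs (f (mkC t y)))}.
  by apply: (continuous_cabs_line (mkC_lineX y)); exact: cf.
have cy x y : {for y, continuous (fun t => cabs (f (mkC x t)))}.
  by apply: (continuous_cabs_line (mkC_lineY x)); exact: cf.
have cc (u v l x : R) : u <= x <= v -> {for x, continuous (cst l : R -> R)}.
  by move=> _; exact: cst_continuous.
have bnd x y : `|x - a| <= d -> `|y - b| <= d -> d <= `|x - a| \/ d <= `|y - b| ->
    cabs (f (mkC x y)) <= B.
  move=> xa yb far; apply: fB; apply/andP; split.
    by case: far => /le_trans; apply;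
      [exact: (Re_le_cabs (mkC x y - mkC a b))|exact: (Im_le_cabs (mkC x y - mkC a b))].
  by apply: le_trans (cabs_le _) _; rewrite mulr_natl mulr2n lerD.
have dm s : `|s - d - s| = d.
  by rewrite (_ : s - d - s = - d) ?normrN ?gtr0_norm//; ring.
have dp s : `|s + d - s| = d.
  by rewrite (_ : s + d - s = d) ?gtr0_norm//; ring.
have le s : s - d <= s + d by clear -d0; lra.
have hor y : `|y - b| = d -> segint (a - d) (a + d) (fun x => cabs (f (mkC x y))) <= 2 * d * B.
  move=> yb; have -> : 2 * d * B = segint (a - d) (a + d) (cst B).
    by rewrite segint_cst//; ring.
  apply: segint_le; [by move=> x _; exact: cx|exact: cc|move=> x xd; apply: bnd].
  - by rewrite ler_norml; move: xd; clear; lra.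
  - by rewrite yb.
  - by right; rewrite yb.
have ver x : `|x - a| = d -> segint (b - d) (b + d) (fun y => cabs (f (mkC x y))) <= 2 * d * B.
  move=> xa; have -> : 2 * d * B = segint (b - d) (b + d) (cst B).
    by rewrite segint_cst//; ring.
  apply: segint_le; [by move=> y _; exact: cy|exact: cc|move=> y yd; apply: bnd].
  - by rewrite xa.
  - by rewrite ler_norml; move: yd; clear; lra.
  - by left; rewrite xa.
have := @cauchy_ineq R f a b (a - d) (a + d) (b - d) (b + d) d fE d0 (lexx _) (lexx _) (lexx _) (lexx _).
rewrite !segintD; [|by move=> ? _; first [exact: cx|exact: cy]..].
have := hor _ (dm b); have := hor _ (dp b); have := ver _ (dm a); have := ver _ (dp a).
set s1 := segint _ _ _; set s2 := segint _ _ _; set s3 := segint _ _ _; set s4 := segint _ _ _.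
move=> h1 h2 h3 h4 h5; rewrite -(ler_pM2l (_ : 0 < 4 * d)); last by rewrite mulr_gt0.
by apply: (le_trans h5); move: h1 h2 h3 h4; clear; lra.
Qed.

Lemma entire_monomial m : entire (fun z : Cplx R => z ^+ m).
Proof.
elim: m => [|m ih] z; first exact: derivable_cst.
have -> : (fun z : Cplx R => z ^+ m.+1) = (fun z => z * z ^+ m).
  by apply/funext => w; rewrite exprS.
by apply: derivableM; [exact: derivable_id|exact: ih].
Qed.

Lemma entireM f (g : Cplx R -> Cplx R) : entire f -> entire g -> entire (fun z => f z * g z).
Proof. by move=> fE gE z; apply: derivableM; [exact: fE|exact: gE]. Qed.

Definition weighted (m : nat) f : Cplx R -> Cplx R := fun z => z ^+ m * f z.

Lemma entire_weighted m f : entire f -> entire (weighted m f).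
Proof. by move=> fE; have := entireM (@entire_monomial m) fE. Qed.

Lemma cabs_weighted m f z : cabs (weighted m f z) = cabs z ^+ m * cabs (f z).
Proof. by rewrite /weighted cabsM cabsX. Qed.

Definition fockint f (p : R) (m : nat) (A : set (borelC R)) : \bar R :=
  (\int[@area R]_(w in A) (cabs (weighted m f w * gauss w) `^ p)%:E)%E.

Lemma fockint_ge0 f p m A : (0 <= fockint f p m A)%E.
Proof. by apply: integral_ge0 => z _; rewrite lee_fin powR_ge0. Qed.

Lemma fockintS f p m A B : entire f -> measurable A -> measurable B -> A `<=` B ->
  (fockint f p m A <= fockint f p m B)%E.
Proof.
move=> fE mA mB AB; apply: ge0_subset_integral => //.
  by apply: measurable_gauss_powR; apply: entire_continuous; exact: entire_weighted.
by move=> z _; rewrite lee_fin powR_ge0.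
Qed.

Lemma squareS (a b c d r s : R) : `|a - c| + r <= s -> `|b - d| + r <= s ->
  square a b r `<=` square c d s.
Proof.
move=> h1 h2 z [zx zy]; split.
  by have := ler_norm (a - c); have := ler_norm (c - a); rewrite distrC; move: h1 zx; clear; lra.
by have := ler_norm (b - d); have := ler_norm (d - b); rewrite distrC; move: h2 zy; clear; lra.
Qed.

(** If |z| >= 1, then |z|^m dominates (1 + |z|)^m up to a constant, and
    [gauss_Lp_estimate] applies to w^m f. If |z| < 1, then f(z) is first
    bounded by the values of f on the annulus 2 <= |w - z| <= 4, where |w| >=
    1. The squares of half-side 1 around these w lie in the square of
    half-side 5 around z. *)
Lemma weighted_estimate (p : R) (m : nat) : 0 < p ->
  exists2 C : R, 0 < C & forall f a b, entire f ->
    ((((1 + cabs (mkC a b)) ^+ m * cabs (f (mkC a b) * gauss (mkC a b))) `^ p)%:E <=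
     C%:E * fockint f p m (square a b 5))%E.
Proof.
move=> p0; have [C C0 CP] := @gauss_Lp_estimate R p p0.
pose K : R := (2 ^+ m) `^ p; have K0 : 0 < K by rewrite powR_gt0// exprn_gt0.
pose E : R := expR (25 / 2) `^ p; have E0 : 0 < E by rewrite powR_gt0// expR_gt0.
(* Three losses: K from 1 + |z| <= 2 max(1, |z|), T from the maximum
   principle, E from the Gaussian weight where |w| <= 5. *)
pose T : R := 2 `^ p; have T0 : 0 < T by rewrite powR_gt0.
have T1 : 1 <= T.
  apply: le_trans (_ : 1 `^ p <= T); first by rewrite powR1.
  by apply: powR_mono; [exact: ltW|by []|rewrite ler1n].
have E1 : 1 <= E.
  apply: le_trans (_ : 1 `^ p <= E); first by rewrite powR1.
  by apply: powR_mono; [exact: ltW|by []|rewrite -expR0 ler_expR divr_ge0].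
exists (K * T * E * C); first by rewrite !mulr_gt0.
move=> f a b fE; set z := mkC a b.
pose h := weighted m f; have hE : entire h by exact: entire_weighted.
have mS c d r : measurable (square c d r) by exact: measurable_rect.
have loc c d : `|c - a| + 1 <= 5 -> `|d - b| + 1 <= 5 ->
    ((cabs (h (mkC c d) * gauss (mkC c d)) `^ p)%:E <=
    C%:E * fockint f p m (square a b 5))%E.
  move=> ca db; apply: le_trans (CP h c d hE) _; rewrite lee_pmul2l//.
  by apply: fockintS => //; exact: squareS.
have [Iinf|Ifin] := eqVneq (fockint f p m (square a b 5)) +oo%E.
  by rewrite Iinf gt0_muley ?lte_fin ?leey// !mulr_gt0.
have {Ifin} Ifin : fockint f p m (square a b 5) \is a fin_num.
  by rewrite ge0_fin_numE ?fockint_ge0// ltey.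
rewrite -(fineK Ifin) in loc *; set I := fine _ in loc *.
have I0 : 0 <= I by apply: fine_ge0; exact: fockint_ge0.
rewrite -EFinM lee_fin.
have {}loc c d : `|c - a| + 1 <= 5 -> `|d - b| + 1 <= 5 ->
    cabs (h (mkC c d) * gauss (mkC c d)) `^ p <= C * I.
  by move=> ca db; rewrite -lee_fin EFinM; exact: loc.
have CI0 : 0 <= C * I by rewrite mulr_ge0// ltW.
have z1p : 0 <= 1 + cabs z by rewrite addr_ge0// cabs_ge0.
have [z1|z1] := leP 1 (cabs z).
  apply: (@le_trans _ _ ((2 ^+ m * cabs (h z * gauss z)) `^ p)).
    apply: powR_mono; first exact: ltW.
      by rewrite mulr_ge0 ?exprn_ge0// cabs_ge0.
    rewrite (cabsM (h z)) (cabsM (f z)) cabs_weighted !mulrA -exprMn.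
    do 2 (apply: ler_wpM2r; first exact: cabs_ge0).
    apply: lerXn2r; rewrite ?nnegrE//; first by rewrite mulr_ge0// cabs_ge0.
    by move: z1; clear; lra.
  rewrite powRM ?exprn_ge0 ?cabs_ge0// -/K -[leRHS]mulrA -(mulrA K) -(mulrA K) ler_pM2l//.
  apply: le_trans (loc a b _ _) _; try by rewrite subrr normr0; clear; lra.
  rewrite -[leLHS]mul1r; apply: ler_wpM2r => //.
  by rewrite -[leLHS]mulr1 ler_pM.
pose B : R := (E * (C * I)) `^ p^-1.
have EC0 : 0 <= E * (C * I) by rewrite mulr_ge0// ltW.
have B0 : 0 <= B by exact: powR_ge0.
have Bp : B `^ p = E * (C * I).
  by rewrite /B -powRrM mulVf ?gt_eqF// powRr1.
have fB w : 2 <= cabs (w - z) <= 2 * 2 -> cabs (f w) <= B.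
  move=> /andP[wz1 wz2].
  have w1 : 1 <= cabs w.
    by have := cabsD w (- z); rewrite cabsN; move: z1 wz1; clear; lra.
  have w5 : cabs w <= 5.
    by have := cabsD (w - z) z; rewrite subrK; move: z1 wz2; clear; lra.
  have hw : cabs (f w) <= expR (25 / 2) * cabs (h w * gauss w).
    rewrite (cabsM (h w)) cabs_weighted cabs_gauss.
    have -> : expR (25 / 2) * (cabs w ^+ m * cabs (f w) * expR (- (cabs w ^+ 2 / 2))) =
       (cabs w ^+ m * expR (25 / 2 - cabs w ^+ 2 / 2)) * cabs (f w).
      by rewrite expRD; ring.
    rewrite -[leLHS]mul1r ler_wpM2r ?cabs_ge0// -[leLHS]mulr1 ler_pM//.
      by rewrite exprn_ege1.
    rewrite -[leLHS]expR0 ler_expR subr_ge0 ler_pM2r ?invr_gt0//.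
    have -> : 25 = 5 ^+ 2 :> R by rewrite -natrX.
    by apply: lerXn2r; rewrite ?nnegrE ?cabs_ge0.
  have locw : cabs (h w * gauss w) `^ p <= C * I.
    have re : `|complex.Re w - a| <= cabs (w - z).
      by apply: le_trans (Re_le_cabs _); case: (w).
    have im : `|complex.Im w - b| <= cabs (w - z).
      by apply: le_trans (Im_le_cabs _); case: (w).
    have := loc (complex.Re w) (complex.Im w).
    rewrite (_ : mkC _ _ = w); last by case: (w).
    by apply; [move: re wz2|move: im wz2]; clear; lra.
  rewrite -(powR_lec p0 (cabs_ge0 _) B0) Bp.
  apply: le_trans (powR_mono (ltW p0) (cabs_ge0 _) hw) _.
  by rewrite powRM ?expR_ge0 ?cabs_ge0// ler_pM2l.
have fz : cabs (f z) <= 2 * B by apply: (@annulus_bound f a b 2).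
apply: (@le_trans _ _ ((2 ^+ m * (2 * B)) `^ p)).
  apply: powR_mono; first exact: ltW.
    by rewrite mulr_ge0 ?exprn_ge0 ?cabs_ge0.
  apply: ler_pM; rewrite ?exprn_ge0 ?cabs_ge0//.
    by apply: lerXn2r; rewrite ?nnegrE//; move: z1; clear; lra.
  rewrite cabsM cabs_gauss -[leRHS]mulr1 ler_pM ?cabs_ge0 ?expR_ge0//.
  by rewrite -[leRHS]expR0 ler_expR oppr_le0 divr_ge0// sqr_ge0.
rewrite powRM ?exprn_ge0 ?mulr_ge0// powRM// Bp -/K -/T.
by rewrite le_eqVlt; apply/orP; left; apply/eqP; ring.
Qed.

End weighted_estimate.

(** * Integrals over families of sets *)

Section sums_of_integrals.
Context d (T : measurableType d) (R : realType).
Local Open Scope ereal_scope.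

Lemma sum_integral_overlap (mu : {measure set T -> \bar R}) (A : nat -> set T)
    (F : T -> \bar R) (N : R) n :
  (0 <= N)%R -> (forall k, measurable (A k)) -> measurable_fun setT F -> (forall z, 0 <= F z) ->
  (forall z, (\sum_(k < n) \1_(A k) z <= N)%R) ->
  \sum_(k < n) \int[mu]_(z in A k) F z <= N%:E * \int[mu]_z F z.
Proof.
move=> N0 mA mF F0 AN.
rewrite -ge0_integralZl//.
under eq_bigr do rewrite integral_mkcond.
rewrite -(big_mkord xpredT (fun k => \int[mu]_z (F \_ (A k)) z)) -ge0_integral_sum//; last 2 first.
- by move=> k; apply/(measurable_restrictT _ _).1 => //; exact: measurable_funTS.
- by move=> k z _; rewrite erestrict_ge0.
apply: ge0_le_integral => //.
- by move=> z _; apply: sume_ge0 => k _; rewrite erestrict_ge0.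
- apply: emeasurable_sum => k; apply/(measurable_restrictT _ _).1 => //.
  exact: measurable_funTS.
- by apply: emeasurable_funM.
move=> z _; rewrite big_mkord.
apply: (@le_trans _ _ ((\sum_(k < n) \1_(A k) z)%:E * F z)).
  rewrite -sumEFin ge0_sume_distrl//.
  apply: lee_sum => k _; rewrite patchE indicE.
  by case: ifP => _; rewrite ?mul1e ?mul0e.
by rewrite lee_wpmul2r// lee_fin.
Qed.

Lemma integral_cover (mu : {measure set T -> \bar R}) (A : nat -> set T) (F : T -> \bar R) (B : \bar R) :
  (forall k, measurable (A k)) -> measurable_fun setT F -> (forall z, 0 <= F z) ->
  (forall z, exists k, A k z) ->
  (forall n, \sum_(k < n) \int[mu]_(z in A k) F z <= B) -> \int[mu]_z F z <= B.
Proof.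
move=> mA mF F0 cover HB; pose g k := F \_ (A k).
have g0 k z : 0 <= g k z by rewrite /g erestrict_ge0.
have mg k : measurable_fun setT (g k).
  by apply/(measurable_restrictT _ _).1 => //; exact: measurable_funTS.
apply: (@le_trans _ _ (\int[mu]_z (\sum_(k <oo) g k z))).
  apply: ge0_le_integral => //; first exact: ge0_emeasurable_sum.
  move=> z _; have [k zk] := cover z.
  apply: le_trans (nneseries_lim_ge k.+1 _) => //.
  rewrite big_nat_recr//= -[leLHS]add0e; apply: leeD; first exact: sume_ge0.
  by rewrite /g patchE mem_set.
rewrite integral_nneseries//; apply: lime_le.
  by apply: is_cvg_nneseries => k _ _; apply: integral_ge0.
apply: nearW => n; apply: le_trans (HB n); rewrite big_mkord.
by apply: lee_sum => k _; rewrite /g -integral_mkcond.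
Qed.

(** If the inequality failed at every point of [A], integrating it over [A]
    would contradict itself. The slack [e] makes the strict inequality
    survive integration. *)
Lemma mean_value_le (mu : {measure set T -> \bar R}) (A : set T) (F : T -> \bar R) (V e : R) :
  measurable A -> mu A = V%:E -> (0 < V)%R -> (0 < e)%R ->
  measurable_fun A F -> (forall z, A z -> 0 <= F z) -> \int[mu]_(z in A) F z < +oo ->
  exists2 z, A z & F z * V%:E <= \int[mu]_(z in A) F z + e%:E.
Proof.
move=> mA AV V0 e0 mF F0; have I0 : 0 <= \int[mu]_(z in A) F z by exact: integral_ge0.
move=> Ioo; apply: contrapT => no.
have Ifin : \int[mu]_(z in A) F z \is a fin_num by rewrite ge0_fin_numE.
pose c := fine (\int[mu]_(z in A) F z + e%:E).
have cE : c%:E = \int[mu]_(z in A) F z + e%:E by rewrite fineK// fin_numD Ifin.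
have c0 : (0 <= c)%R by rewrite -lee_fin cE adde_ge0// lee_fin ltW.
have : \int[mu]_(z in A) (c / V)%:E <= \int[mu]_(z in A) F z.
  apply: ge0_le_integral => //; first by move=> z _; rewrite lee_fin divr_ge0// ltW.
  move=> z Az; rewrite EFinM lee_pdivrMr// cE leNgt; apply/negP => H.
  by apply: no; exists z => //; exact: ltW.
rewrite integral_cst// AV -EFinM divfK ?gt_eqF// cE leNgt => /negP; apply.
by rewrite lteDl.
Qed.

Lemma mean_value_ge (mu : {measure set T -> \bar R}) (A : set T) (F : T -> \bar R) (V e : R) :
  measurable A -> mu A = V%:E -> (0 < V)%R -> (0 < e)%R ->
  measurable_fun A F -> (forall z, A z -> 0 <= F z) -> \int[mu]_(z in A) F z < +oo ->
  exists2 z, A z & \int[mu]_(z in A) F z <= F z * V%:E + e%:E.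
Proof.
move=> mA AV V0 e0 mF F0; have I0 : 0 <= \int[mu]_(z in A) F z by exact: integral_ge0.
move=> Ioo; apply: contrapT => no.
have Ifin : \int[mu]_(z in A) F z \is a fin_num by rewrite ge0_fin_numE.
pose c := fine (\int[mu]_(z in A) F z - e%:E).
have cE : c%:E = \int[mu]_(z in A) F z - e%:E by rewrite fineK// fin_numB Ifin.
have : \int[mu]_(z in A) F z <= \int[mu]_(z in A) (c / V)%:E.
  apply: ge0_le_integral => //.
  move=> z Az; rewrite EFinM lee_pdivlMr// cE leeBrDr// leNgt; apply/negP => H.
  by apply: no; exists z => //; exact: ltW.
rewrite integral_cst// AV -EFinM divfK ?gt_eqF// cE leeBrDr// leNgt => /negP; apply.
by rewrite lteDl.
Qed.

End sums_of_integrals.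

(** * Nets and Gaussian sums *)

Section gaussian_nets.
Variable R : realType.
Implicit Types (s : R) (z w : Cplx R).
Local Notation leb := (@lebesgue_measure R).

Lemma gauss_line (c : R) : 0 < c -> exists2 G : R, 0 < G &
  forall a, (\int[leb]_x (expR (- (c * (x - a) ^+ 2)))%:E = G%:E)%E.
Proof.
move=> c0; pose sg := Num.sqrt ((2 * c)^-1).
have c20 : 0 < (2 * c)^-1 by rewrite invr_gt0 mulr_gt0.
have sg0 : sg != 0 by rewrite gt_eqF// sqrtr_gt0.
have pk := normal_peak_gt0 sg0.
exists (normal_peak sg)^-1; first by rewrite invr_gt0.
move=> a; have := @integral_normal_pdf R a sg.
have E x : expR (- (c * (x - a) ^+ 2)) = (normal_peak sg)^-1 * normal_pdf a sg x.
  rewrite (normal_pdfE a sg0) mulrA mulVf ?gt_eqF// mul1r /normal_fun.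
  congr expR; rewrite /sg sqr_sqrtr ?ltW// mulNr; congr (- _).
  by rewrite -mulr_natl; field; rewrite gt_eqF.
move=> pdf1; transitivity (\int[leb]_x ((normal_peak sg)^-1%:E * (normal_pdf a sg x)%:E))%E.
  by apply: eq_integral => x _; rewrite E EFinM.
rewrite ge0_integralZl//; last 3 first.
- by apply/measurable_EFinP; exact: measurable_normal_pdf.
- by move=> x _; rewrite lee_fin normal_pdf_ge0.
- by rewrite lee_fin invr_ge0 ltW.
by rewrite pdf1 mule1.
Qed.

Definition bump (c : R) z : R := expR (- (c * cabs z ^+ 2)).

Lemma measurable_bump c z (A : set (borelC R)) :
  measurable_fun A (fun w : borelC R => bump c (z - w)).
Proof.
apply: measurable_funTS; rewrite /bump; apply: measurableT_comp => //.
apply: measurableT_comp => //; apply: measurable_funM => //; apply: measurable_funX.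
apply: (@measurable_cabs_continuous R (fun w => z - w)) => w.
by apply: derivable_continuousC; apply: derivableB; [exact: derivable_cst|exact: derivable_id].
Qed.

Lemma gauss_area (c : R) : 0 < c -> exists2 G : R, 0 < G &
  forall z, (\int[@area R]_w (bump c (z - w))%:E = G%:E)%E.
Proof.
move=> c0; have [G G0 GE] := gauss_line c0.
exists (G * G); first exact: mulr_gt0.
move=> z; rewrite area_integralE; last 2 first.
- by apply/measurable_EFinP; exact: measurable_bump.
- by move=> w; rewrite lee_fin expR_ge0.
case: z => a b.
have mg (v : R) : measurable_fun [set: measurableTypeR R] (fun x : R => (expR (- (c * (x - v) ^+ 2)))%:E).
  apply/measurable_EFinP; apply: measurableT_comp => //; apply: measurableT_comp => //.
  apply: measurable_funM => //; apply: measurable_funX; exact: measurable_funB.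
have inner (x : R) : (\int[leb]_y (bump c ((a +i* b)%C - mkC x y))%:E =
    G%:E * (expR (- (c * (x - a) ^+ 2)))%:E)%E.
  transitivity (\int[leb]_y ((expR (- (c * (x - a) ^+ 2)))%:E * (expR (- (c * (y - b) ^+ 2)))%:E))%E.
    apply: eq_integral => y _; rewrite -EFinM /bump -expRD; congr (expR _)%:E.
    by rewrite sqr_cabs /=; ring.
  rewrite ge0_integralZl//.
  by rewrite GE muleC.
under eq_integral do rewrite inner.
rewrite ge0_integralZl//; last by rewrite lee_fin ltW.
by rewrite GE -EFinM.
Qed.

(** The points are kept apart only through the distinct nodes near which they
    lie, so that each may be moved freely around its node. *)
Definition net s (c : nat -> int * int) (w : nat -> Cplx R) :=
  injective c /\ forall k, `|complex.Re (w k) - s * (c k).1%:~R| <= s /\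
                          `|complex.Im (w k) - s * (c k).2%:~R| <= s.

(** The full cells of the lattice, being closed, share sides; those of half
    the side are pairwise disjoint. *)
Definition half_cell s (n : int * int) : set (borelC R) :=
  rect (s * n.1%:~R) (s * n.1%:~R + s / 2) (s * n.2%:~R) (s * n.2%:~R + s / 2).

Lemma half_cell_inj s n n' z : 0 < s -> half_cell s n z -> half_cell s n' z -> n = n'.
Proof.
move=> s0; have key (x : R) (u v : int) : s * u%:~R <= x <= s * u%:~R + s / 2 ->
    s * v%:~R <= x <= s * v%:~R + s / 2 -> (u <= v)%R.
  move=> /andP[h1 h2] /andP[h3 h4]; rewrite -ltzD1 -(@ltr_int R) -(ltr_pM2l s0).
  by rewrite intrD mulrDr mulr1; move: h1 h4 s0; clear; lra.
case: n n' => a b [a' b'] [/= h1 h2] [/= h3 h4]; congr (_, _); apply/eqP; rewrite eq_le.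
  by rewrite (key _ _ _ h1 h3) (key _ _ _ h3 h1).
by rewrite (key _ _ _ h2 h4) (key _ _ _ h4 h2).
Qed.

Lemma half_cell_sum s (c : nat -> int * int) z n : 0 < s -> injective c ->
  \sum_(k < n) \1_(half_cell s (c k)) z <= 1 :> R.
Proof.
move=> s0 cinj; have [[i iz]|no] := pselect (exists i : 'I_n, half_cell s (c i) z).
  rewrite (bigD1 i)//= big1 ?addr0; first by rewrite indicE; case: (_ \in _).
  move=> j ji; rewrite indicE memNset// => jz; case/negP: ji.
  by apply/eqP/val_inj/cinj; exact: half_cell_inj jz iz.
rewrite big1 // => i _; rewrite indicE memNset// => iz; apply: no; by exists i.
Qed.

Lemma measurable_half_cell s n : measurable (half_cell s n).
Proof. exact: measurable_rect. Qed.

Lemma area_half_cell s n : 0 < s -> @area R (half_cell s n) = ((s / 2) ^+ 2)%:E.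
Proof.
move=> s0; rewrite area_rect ?lerDl ?divr_ge0 ?ltW//.
by congr (_%:E); ring.
Qed.

Lemma net_close s c (w : nat -> Cplx R) k z : 0 < s -> net s c w -> half_cell s (c k) z ->
  cabs (w k - z) <= 3 * s.
Proof.
move=> s0 [_ wc] [zx zy]; have [h1 h2] := wc k; apply: le_trans (cabs_le _) _.
have : `|complex.Re (w k - z)| <= 3 / 2 * s.
  rewrite raddfB /= ler_norml; move: h1 zx s0; rewrite ler_norml; clear; lra.
have : `|complex.Im (w k - z)| <= 3 / 2 * s.
  rewrite raddfB /= ler_norml; move: h2 zy s0; rewrite ler_norml; clear; lra.
by clear; lra.
Qed.

(** Each term is at most a constant times the mean of a wider Gaussian over the
    half cell of its node. These being disjoint, the sum is bounded by one
    Gaussian integral over the plane. *)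
Lemma net_bump_sum s (e : R) : 0 < s -> 0 < e -> exists2 K : R, 0 < K &
  forall c (w : nat -> Cplx R) z n, net s c w -> \sum_(k < n) bump e (z - w k) <= K.
Proof.
move=> s0 e0; have e20 : 0 < e / 2 by rewrite divr_gt0.
have [G G0 GE] := gauss_area e20.
pose L := expR (e * (3 * s) ^+ 2); have L0 : 0 < L by exact: expR_gt0.
have q0 : 0 < (s / 2) ^+ 2 by rewrite exprn_gt0// divr_gt0.
exists (L * G / (s / 2) ^+ 2); first by rewrite divr_gt0// mulr_gt0.
move=> c w z n wnet; rewrite ler_pdivlMr// mulrC mulr_sumr -lee_fin -sumEFin.
have pt k x : half_cell s (c k) x -> bump e (z - w k) <= L * bump (e / 2) (z - x).
  move=> xk; rewrite /bump /L -expRD ler_expR.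
  have h1 := net_close s0 wnet xk; have h2 := cabs_triangle (w k) z x.
  have h3 : cabs (z - x) ^+ 2 <= (cabs (z - w k) + 3 * s) ^+ 2.
    apply: lerXn2r; rewrite ?nnegrE ?cabs_ge0//.
      by rewrite addr_ge0 ?cabs_ge0// mulr_ge0// ltW.
    by apply: le_trans h2 _; rewrite lerD2l.
  have h4 : (cabs (z - w k) + 3 * s) ^+ 2 <= 2 * cabs (z - w k) ^+ 2 + 2 * (3 * s) ^+ 2.
    have := sqr_ge0 (cabs (z - w k) - 3 * s); rewrite sqrrB sqrrD -mulr_natl; clear; lra.
  have := ler_wpM2l (ltW e20) (le_trans h3 h4).
  by set u := cabs (z - w k) ^+ 2; set v := (3 * s) ^+ 2; set t := cabs (z - x) ^+ 2; clear; lra.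
have mB x (A : set (borelC R)) : measurable_fun A (fun y : borelC R => (bump (e / 2) (x - y))%:E).
  by apply/measurable_EFinP; exact: measurable_bump.
apply: (@le_trans _ _ (\sum_(k < n) L%:E * \int[@area R]_(x in half_cell s (c k)) (bump (e / 2) (z - x))%:E)%E).
  apply: lee_sum => k _; rewrite mulrC EFinM -(area_half_cell (c k) s0) -integral_cst; last exact: measurable_half_cell.
  rewrite -ge0_integralZl//; last 3 first.
  - exact: measurable_half_cell.
  - by move=> x _; rewrite lee_fin expR_ge0.
  - by rewrite lee_fin ltW.
  apply: ge0_le_integral => //.
  - exact: measurable_half_cell.
  - by move=> x _; rewrite lee_fin expR_ge0.
  - by apply: emeasurable_funM.
  - by move=> x xk; rewrite -EFinM lee_fin; exact: pt.
rewrite -ge0_sume_distrr; last first.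
  by move=> k _; apply: integral_ge0 => x _; rewrite lee_fin expR_ge0.
rewrite EFinM lee_pmul2l// -(GE z) -[leRHS]mul1e.
apply: (@sum_integral_overlap _ _ R (@area R) (fun k => half_cell s (c k)) _ 1 n) => //.
- by move=> k; exact: measurable_half_cell.
- by move=> x; rewrite lee_fin expR_ge0.
- by move=> x; apply: half_cell_sum => //; exact: wnet.1.
Qed.

(** The indicator of a disc is at most a constant times a Gaussian. *)
Lemma net_overlap s (rho : R) : 0 < s -> 0 <= rho -> exists2 N : R, 0 < N &
  forall c (w : nat -> Cplx R) z n, net s c w -> \sum_(k < n) (cabs (z - w k) <= rho)%R%:R <= N.
Proof.
move=> s0 rho0; have [K K0 KP] := net_bump_sum s0 ltr01.
exists (expR (rho ^+ 2) * K); first by rewrite mulr_gt0// expR_gt0.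
move=> c w z n wnet; apply: (@le_trans _ _ (\sum_(k < n) expR (rho ^+ 2) * bump 1 (z - w k))).
  apply: ler_sum => k _; case: (leP (cabs (z - w k)) rho) => h; last first.
    by rewrite mulr_ge0 ?expR_ge0.
  rewrite /bump -expRD mul1r -[leLHS]expR0 ler_expR subr_ge0.
  by apply: lerXn2r; rewrite ?nnegrE ?cabs_ge0.
by rewrite -mulr_sumr ler_pM2l ?expR_gt0//; exact: KP wnet.
Qed.

End gaussian_nets.

(** * Norms as integrals *)

Section norms.
Variable R : realType.
Local Open Scope ereal_scope.

Lemma LnormE d (T : measurableType d) (mu : {measure set T -> \bar R}) (p : R) (g : T -> R) :
  (forall z, (0 <= g z)%R) ->
  'N[mu]_(p%:E) [(fun z => (g z)%:E)] = (\int[mu]_z (g z `^ p)%:E) `^ p^-1.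
Proof.
move=> g0; rewrite unlock /= (eq_integral (fun z => (g z `^ p)%:E))// => z _.
by rewrite ger0_norm.
Qed.

Lemma fock_sobolev_normE (p : R) m f :
  fock_sobolev_norm p m f = fockint f p m setT `^ p^-1.
Proof. by rewrite /fock_sobolev_norm LnormE// => z; exact: cabs_ge0. Qed.

Lemma gauss_LnormE (mu : {measure set (borelC R) -> \bar R}) (q : R) f :
  gauss_Lnorm mu q f = (\int[mu]_z (cabs (f z * gauss z) `^ q)%:E) `^ q^-1.
Proof. by rewrite /gauss_Lnorm LnormE// => z; exact: cabs_ge0. Qed.

Lemma fock_sobolev_fin (p : R) m f : (0 < p)%R -> fock_sobolev p m f ->
  fockint f p m setT \is a fin_num.
Proof.
move=> p0 [_]; rewrite fock_sobolev_normE ge0_fin_numE ?fockint_ge0//.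
rewrite ltNge leye_eq => H; rewrite ltNge leye_eq; apply: contra H => /eqP ->.
by rewrite poweRyr// gt_eqF// invr_gt0.
Qed.

Lemma measurable_disc (a : Cplx R) (r : R) : measurable (disc a r).
Proof.
have -> : disc a r = (fun z : borelC R => cabs ((z : Cplx R) - a)) @^-1` `]-oo, r[.
  by apply/seteqP; split => z; rewrite /= in_itv.
rewrite -[X in measurable X]setTI; apply: measurable_cabs_continuous => //.
by move=> z; apply: derivable_continuousC; exact: derivable_subr.
Qed.

End norms.

(** * From averages on a net to the embedding *)

Section sufficiency.
Variable R : realType.
Variable mu : {measure set (borelC R) -> \bar R}.

Lemma averagingE m (q r : R) a : averaging mu m q r a =
  (((1 + cabs a) `^ (m%:R * q))^-1%:E * mu (disc a r))%E.
Proof.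
have h : 0 < (1 + cabs a) `^ (m%:R * q) by rewrite powR_gt0// ltr_wpDr// cabs_ge0.
by rewrite /averaging inver gt_eqF// muleC.
Qed.

Lemma averaging_ge0 m (q r : R) a : (0 <= averaging mu m q r a)%E.
Proof.
by rewrite averagingE mule_ge0 ?measure_ge0// lee_fin invr_ge0 powR_ge0.
Qed.

(** The numbers [tau] and [M] let one proof serve both ranges of exponents:
    [tau = 0] when p <= q, and [tau k] the power p / (p - q) of the average
    with [M = 1] when q < p. In the inequality that defines them, [x] is the
    fraction of the p-th power of the norm of f carried by the square around
    [w k]; these fractions have a bounded sum by [net_overlap]. *)
Lemma carleson_sufficiency (p q r s M T : R) (m : nat) c (w : nat -> Cplx R)
    (tau : nat -> R) :
  0 < p -> 0 < q -> 0 < r -> 0 < s -> 0 <= M -> net s c w ->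
  (forall z : Cplx R, exists k, cabs (z - w k) < r) ->
  (forall k x, 0 <= x <= 1 ->
    (averaging mu m q r (w k) * (x `^ (q / p))%:E <= (tau k + M * x)%:E)%E) ->
  (forall n, \sum_(k < n) tau k <= T) ->
  fock_carleson mu m p q.
Proof.
move=> p0 q0 r0 s0 M0 wnet cover Ht HT.
have [C C0 CP] := @weighted_estimate R p m p0.
have rho0 : 0 <= 2 * (5 + r) by rewrite mulr_ge0// addr_ge0// ltW.
have [N N0 NP] := net_overlap s0 rho0.
have qp0 : 0 < q / p by rewrite divr_gt0.
have r1 : 0 < 1 + r by rewrite addr_gt0.
pose D := C `^ (q / p) * (1 + r) `^ (m%:R * q).
have D0 : 0 < D by rewrite mulr_gt0// powR_gt0.
have T0 : 0 <= T by have := HT 0%N; rewrite big_ord0.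
have tau0 k : 0 <= tau k.
  have := Ht k 0; rewrite lexx ler01 => /(_ isT).
  by rewrite powR0 ?gt_eqF// mule0 mulr0 addr0 lee_fin.
pose L := D * (T + M * N); have L0 : 0 <= L.
  by apply: mulr_ge0; [exact: ltW|apply: addr_ge0 => //; apply: mulr_ge0 => //; exact: ltW].
exists ((L + 1) `^ q^-1); first by rewrite powR_gt0// ltr_wpDl.
move=> f fF; have fE := fF.1; have Jfin := fock_sobolev_fin p0 fF.
rewrite gauss_LnormE fock_sobolev_normE -(fineK Jfin); set J := fine _.
have J0 : 0 <= J by apply: fine_ge0; exact: fockint_ge0.
have mS a b d : measurable (square a b d : set (borelC R)) by exact: measurable_rect.
pose S k := square (complex.Re (w k)) (complex.Im (w k)) (5 + r).
pose Jk k := fine (fockint f p m (S k)).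
have Sfin k : fockint f p m (S k) \is a fin_num.
  rewrite ge0_fin_numE ?fockint_ge0//.
  apply: (@le_lt_trans _ _ (fockint f p m setT)); last by rewrite ltey_eq Jfin.
  by apply: fockintS => //; exact: mS.
have JkE k : fockint f p m (S k) = (Jk k)%:E by rewrite fineK.
have Jk0 k : 0 <= Jk k by apply: fine_ge0; exact: fockint_ge0.
have JkJ k : Jk k <= J.
  by rewrite -lee_fin -JkE fineK//; apply: fockintS => //; exact: mS.
(* If J = 0 the quotient is 0 by convention, and Jk k = J * x k still
   holds. *)
pose x k := Jk k / J.
have xJ k : Jk k = J * x k.
  rewrite /x; have [Jz|Jn] := eqVneq J 0; last by rewrite mulrCA mulfV// mulr1.
  by rewrite Jz mul0r; apply/eqP; rewrite eq_le Jk0 andbT -Jz.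
have x01 k : 0 <= x k <= 1.
  rewrite /x; have [->|Jn] := eqVneq J 0; first by rewrite invr0 mulr0 lexx ler01.
  have Jp : 0 < J by rewrite lt_def Jn.
  by rewrite divr_ge0//= ler_pdivrMr// mul1r.
have sumx n : \sum_(k < n) x k <= N.
  have sumJ : \sum_(k < n) Jk k <= N * J.
    rewrite -lee_fin -sumEFin EFinM fineK//.
    under eq_bigr do rewrite -JkE.
    apply: (@sum_integral_overlap _ _ R (@area R) S _ N n) => //.
    - by rewrite ltW.
    - by move=> k; exact: mS.
    - by apply: measurable_gauss_powR; apply: entire_continuous; exact: entire_weighted.
    - by move=> z; rewrite lee_fin powR_ge0.
    - move=> z; apply: le_trans (NP c w z n wnet); apply: ler_sum => k _.
      rewrite indicE; case: (boolP (z \in S k)) => //= /set_mem zS.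
      suff -> : cabs (z - w k) <= 2 * (5 + r) by [].
      apply: le_trans (cabs_le _) _; rewrite mulr_natl mulr2n.
      case: zS; case: (w k) => a b; case: z => u v /= h1 h2.
      by apply: lerD; rewrite ler_norml; [move: h1|move: h2]; clear; lra.
  rewrite /x -mulr_suml; have [->|Jn] := eqVneq J 0; first by rewrite invr0 mulr0 ltW.
  by rewrite ler_pdivrMr// lt_def Jn.
have ptwise k (z : Cplx R) : cabs (z - w k) < r -> cabs (f z * gauss z) `^ q <=
    D * Jk k `^ (q / p) * ((1 + cabs (w k)) `^ (m%:R * q))^-1.
  move=> zw; rewrite ler_pdivlMr; last by rewrite powR_gt0// ltr_wpDr// cabs_ge0.
  set A := (1 + cabs z) ^+ m * cabs (f z * gauss z).
  have A0 : 0 <= A by rewrite mulr_ge0 ?exprn_ge0 ?addr_ge0 ?cabs_ge0.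
  have Ap : A `^ p <= C * Jk k.
    rewrite -lee_fin EFinM -JkE /A; move: zw; case: z {A A0} => u v zw.
    apply: le_trans (CP f u v fE) _; rewrite lee_pmul2l//.
    apply: fockintS; [exact: fE|exact: mS|exact: mS|].
    have := Re_le_cabs ((u +i* v)%C - w k); have := Im_le_cabs ((u +i* v)%C - w k).
    rewrite !raddfB /= => h1 h2; apply: squareS.
      by move: (le_lt_trans h2 zw); clear; lra.
    by move: (le_lt_trans h1 zw); clear; lra.
  have Aq : A `^ q <= C `^ (q / p) * Jk k `^ (q / p).
    rewrite -powRM ?(ltW C0)// (_ : A `^ q = (A `^ p) `^ (q / p)); last first.
      by rewrite -powRrM mulrC divfK// gt_eqF.
    by apply: powR_mono Ap; rewrite ?powR_ge0// ltW.
  have mq0 : 0 <= m%:R * q by rewrite mulr_ge0// ltW.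
  have z1 : 0 <= 1 + cabs z by rewrite addr_ge0// cabs_ge0.
  have wz : (1 + cabs (w k)) `^ (m%:R * q) <=
      (1 + r) `^ (m%:R * q) * (1 + cabs z) `^ (m%:R * q).
    rewrite -powRM ?(ltW r1)//; apply: powR_mono => //.
      by rewrite addr_ge0// cabs_ge0.
    have h1 : cabs (w k) <= r + cabs z.
      have := cabsD (w k - z) z; rewrite subrK cabs_distrC => /le_trans; apply.
      by rewrite lerD2r ltW.
    have : 0 <= r * cabs z by rewrite mulr_ge0 ?cabs_ge0// ltW.
    by move: h1; clear; nra.
  have AE : A `^ q = (1 + cabs z) `^ (m%:R * q) * cabs (f z * gauss z) `^ q.
    by rewrite /A powRM ?exprn_ge0 ?cabs_ge0// powRrM powR_mulrn.
  apply: le_trans (ler_wpM2l (powR_ge0 _ _) wz) _.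
  have -> : cabs (f z * gauss z) `^ q * ((1 + r) `^ (m%:R * q) * (1 + cabs z) `^ (m%:R * q)) =
     (1 + r) `^ (m%:R * q) * A `^ q by rewrite AE; ring.
  rewrite /D [C `^ _ * _]mulrC -mulrA.
  by apply: ler_wpM2l Aq; exact: powR_ge0.
have mg : measurable_fun [set: borelC R] (fun z => (cabs (f z * gauss z) `^ q)%:E).
  by apply: measurable_gauss_powR; exact: entire_continuous.
have disck k : (\int[mu]_(z in disc (w k) r) (cabs (f z * gauss z) `^ q)%:E <=
    (D * J `^ (q / p) * (tau k + M * x k))%:E)%E.
  apply: (@le_trans _ _ (\int[mu]_(z in disc (w k) r)
     (D * Jk k `^ (q / p) * ((1 + cabs (w k)) `^ (m%:R * q))^-1)%:E)%E).
    apply: ge0_le_integral => //.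
    - exact: measurable_disc.
    - by move=> z _; rewrite lee_fin powR_ge0.
    - exact: measurable_funTS.
    - by move=> z zk; rewrite lee_fin; exact: ptwise.
  rewrite integral_cst; last exact: measurable_disc.
  rewrite EFinM -muleA -averagingE xJ powRM//; last by have /andP[] := x01 k.
  have -> : D * (J `^ (q / p) * x k `^ (q / p)) = D * J `^ (q / p) * x k `^ (q / p) by rewrite mulrA.
  rewrite [X in (X * _)%E]EFinM -muleA [leRHS]EFinM.
  apply: lee_wpmul2l; first by rewrite lee_fin mulr_ge0 ?powR_ge0// ltW.
  by rewrite muleC; exact: Ht.
have total : (\int[mu]_z (cabs (f z * gauss z) `^ q)%:E <= (L * J `^ (q / p))%:E)%E.
  apply: (integral_cover (A := fun k => disc (w k) r)) => // [k|z|n].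
  - exact: measurable_disc.
  - by rewrite lee_fin powR_ge0.
  apply: (@le_trans _ _ (\sum_(k < n) (D * J `^ (q / p) * (tau k + M * x k))%:E)%E).
    by apply: lee_sum => k _; exact: disck.
  rewrite sumEFin lee_fin -mulr_sumr big_split/= -mulr_sumr /L mulrAC.
  apply: ler_wpM2r; first exact: powR_ge0.
  apply: ler_wpM2l; first exact: ltW.
  by apply: lerD; [exact: HT|apply: ler_wpM2l => //; exact: sumx].
have q1 : 0 <= q^-1 by rewrite invr_ge0 ltW.
apply: le_trans (_ : ((L * J `^ (q / p))%:E `^ q^-1 <= _)%E).
  apply: gt0_ler_poweR => //; rewrite in_itv /= leey andbT.
    by apply: integral_ge0 => z _; rewrite lee_fin powR_ge0.
  by rewrite lee_fin mulr_ge0// powR_ge0.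
rewrite !poweR_EFin -EFinM lee_fin powRM ?powR_ge0// -powRrM.
have -> : q / p / q = p^-1 by field; rewrite !gt_eqF.
apply: ler_wpM2r; first exact: powR_ge0.
by apply: powR_mono => //; rewrite lerDl.
Qed.

End sufficiency.

Lemma lattice_enum : exists2 c : nat -> int * int, injective c & forall n, exists k, c k = n.
Proof.
have : ([set: nat] #= [set: int * int])%card.
  apply/card_eqPle; split; last exact: countableP.
  pose emb (n : nat) : int * int := (n%:Z, 0%:Z).
  have : (emb @` [set: nat] #= [set: nat])%card.
    by apply: inj_card_eq => i j _ _ [].
  move=> /card_eqPle[_ /card_le_trans]; apply; exact: subset_card_le.
move=> /card_esym/card_set_bijP[f [_ finj fsurj]].
have /choice[c cP] : forall k, exists n, f n = k.
  by move=> k; have [n _ <-] := fsurj k I; exists n.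
exists c => [i j ij|n]; first by rewrite -(cP i) -(cP j) ij.
by exists (f n); apply: finj; rewrite ?inE// cP.
Qed.

(** * Sums of reproducing kernels *)

Section kernels.
Variable R : realType.
Implicit Types (z a : Cplx R) (w : nat -> Cplx R).

(** The normalised reproducing kernel of the Fock space at [a]. Its weighted
    modulus is a Gaussian centred at [a], which makes it the natural test
    function there. *)
Definition kern a : Cplx R -> Cplx R :=
  fun z => (expR (- (cabs a ^+ 2 / 2)))%:C%C * cexp (conjc a * z).

Lemma entire_kern a : entire (kern a).
Proof.
by move=> z; apply: derivableM; [exact: derivable_cst|exact: cexp_lin_derivable].
Qed.

Lemma cabs_kern_gauss a z : cabs (kern a z * gauss z) = bump 2^-1 (z - a).
Proof.
rewrite /kern /bump !cabsM cabs_real ger0_norm ?expR_ge0// cabs_cexp cabs_gauss -!expRD.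
by congr expR; rewrite !sqr_cabs; case: a z => a b [c d] /=; field.
Qed.

Definition comb n (coef : 'I_n -> R) (w : nat -> Cplx R) : Cplx R -> Cplx R :=
  fun z => \sum_(k < n) (coef k)%:C%C * kern (w k) z.

Lemma entire_comb n (coef : 'I_n -> R) w : entire (comb coef w).
Proof.
have H (s : seq 'I_n) : entire (fun z => \sum_(k <- s) (coef k)%:C%C * kern (w k) z).
  elim: s => [|k s ih] z.
    rewrite (_ : (fun _ => _) = cst 0); first exact: derivable_cst.
    by apply/funext => u; rewrite big_nil.
  rewrite (_ : (fun _ => _) = (fun z => (coef k)%:C%C * kern (w k) z) +
      (fun z => \sum_(k <- s) (coef k)%:C%C * kern (w k) z)); last first.
    by apply/funext => u; rewrite big_cons.
  apply: derivableD; last exact: ih.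
  by apply: derivableM; [exact: derivable_cst|exact: entire_kern].
by move=> z; have := H (index_enum 'I_n) z.
Qed.

Lemma cabs_sum (I : Type) (s : seq I) (F : I -> Cplx R) :
  cabs (\sum_(i <- s) F i) <= \sum_(i <- s) cabs (F i).
Proof.
elim: s => [|i s ih]; first by rewrite !big_nil cabs0.
by rewrite !big_cons (le_trans (cabsD _ _))// lerD2l.
Qed.

(** Polynomial growth is absorbed by half of the Gaussian decay. *)
Lemma growth_bump m z : (1 + cabs z) ^+ m * bump 2^-1 z <= expR (m%:R ^+ 2) * bump 4^-1 z.
Proof.
have h : 1 + cabs z <= expR (cabs z) by exact: expR_ge1Dx.
apply: (@le_trans _ _ (expR (cabs z) ^+ m * bump 2^-1 z)).
  rewrite ler_wpM2r ?expR_ge0//; apply: lerXn2r; rewrite ?nnegrE ?expR_ge0//.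
  by rewrite addr_ge0 ?cabs_ge0.
rewrite -expRM_natl /bump -!expRD ler_expR.
have := sqr_ge0 (cabs z / 2 - m%:R); rewrite sqrrB.
by set t := cabs z; clear; rewrite expr_div_n -mulr_natl; lra.
Qed.

(** For p <= 1 this is the subadditivity of the p-th power, and the exponent
    of g is p; for p > 1 it is Jensen's inequality for the weights g, whose
    exponent stays 1. *)
Lemma power_sum (p K : R) : 0 < p -> 0 < K -> exists2 L : R, 0 < L &
  forall n (b : 'I_n -> R) (g : 'I_n -> R), (forall k, 0 <= b k) -> (forall k, 0 <= g k) ->
    \sum_(k < n) g k <= K ->
    (\sum_(k < n) b k * g k) `^ p <= L * \sum_(k < n) b k `^ p * g k `^ (Num.min p 1).
Proof.
move=> p0 K0; have [p1|p1] := leP 1 p.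
  exists (2 * (2 * K) `^ (p - 1)); first by rewrite mulr_gt0// powR_gt0// mulr_gt0.
  move=> n b g b0 g0 gK; apply: absorb => //.
  - by apply: sumr_ge0 => k _; rewrite mulr_ge0.
  - by apply: sumr_ge0 => k _; rewrite mulr_ge0// powR_ge0.
  move=> l l0; apply: (@le_trans _ _ (\sum_(k < n) (l * g k + l `^ (1 - p) * (b k `^ p * g k)))).
    apply: ler_sum => k _; rewrite mulrA -mulrDl ler_wpM2r//.
    exact: weak_split.
  rewrite big_split /= -!mulr_sumr; apply: lerD; first by rewrite ler_wpM2l// ltW.
  rewrite ler_wpM2l ?powR_ge0//; apply: ler_sum => k _.
  by rewrite powRr1.
exists 1 => // n b g b0 g0 _; rewrite mul1r.
set S := \sum_(k < n) b k * g k.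
have bg0 k : 0 <= b k * g k by rewrite mulr_ge0.
have S0 : 0 <= S by apply: sumr_ge0.
have [->|Sn] := eqVneq S 0.
  by rewrite powR0 ?gt_eqF//; apply: sumr_ge0 => k _; rewrite mulr_ge0// powR_ge0.
have {Sn} Sp : 0 < S by rewrite lt_def Sn.
have -> : S `^ p = S * S `^ (p - 1) by rewrite mulr_powRB1.
rewrite {1}/S mulr_suml; apply: ler_sum => k _.
have bgS : b k * g k <= S by rewrite /S (bigD1 k)//= lerDl sumr_ge0.
rewrite -powRM//; have [->|bn] := eqVneq (b k * g k) 0; first by rewrite mul0r powR_ge0.
rewrite -[leRHS]mulr_powRB1// ler_wpM2l//.
have bgp : 0 < b k * g k by rewrite lt_def bn bg0.
have -> : p - 1 = - (1 - p) by ring.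
rewrite !powRN lef_pV2 ?posrE ?powR_gt0//.
by apply: powR_mono => //; rewrite subr_ge0 ltW.
Qed.

Lemma bump_powR e (t : R) z : bump e z `^ t = bump (e * t) z.
Proof. by rewrite /bump -expRM; congr expR; ring. Qed.

(** Since 1 + |z| <= (1 + |w_k|) (1 + |z - w_k|), the weight at z moves to
    the nodes at the price of a polynomial factor that the Gaussian absorbs;
    [power_sum] then brings the p-th power inside the sum. *)
Lemma comb_norm (p s : R) (m : nat) : 0 < p -> 0 < s -> exists2 K : R, 0 < K &
  forall c w n (coef : 'I_n -> R), net s c w ->
    (fockint (comb coef w) p m setT <=
      (K * \sum_(k < n) (`|coef k| * (1 + cabs (w k)) ^+ m) `^ p)%:E)%E.
Proof.
move=> p0 s0; have q0 : 0 < (4^-1 : R) by [].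
have [K K0 KP] := net_bump_sum s0 q0.
have [L L0 LP] := power_sum p0 K0.
pose th : R := Num.min p 1; have th0 : 0 < th by rewrite lt_min p0 ltr01.
have [G G0 GE] := gauss_area (mulr_gt0 q0 th0).
pose E := expR (m%:R ^+ 2) `^ p : R; have E0 : 0 < E by rewrite powR_gt0// expR_gt0.
exists (E * L * G); first by rewrite !mulr_gt0.
move=> c w n coef wnet; set b := fun k : 'I_n => `|coef k| * (1 + cabs (w k)) ^+ m.
have b0 k : 0 <= b k by rewrite mulr_ge0// exprn_ge0// addr_ge0// cabs_ge0.
have pt z : cabs (weighted m (comb coef w) z * gauss z) `^ p <=
    E * (L * \sum_(k < n) b k `^ p * bump (4^-1 * th) (z - w k)).
  have -> : \sum_(k < n) b k `^ p * bump (4^-1 * th) (z - w k) =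
      \sum_(k < n) b k `^ p * bump 4^-1 (z - w k) `^ th.
    by apply: eq_bigr => k _; rewrite bump_powR.
  apply: (@le_trans _ _ ((expR (m%:R ^+ 2) * \sum_(k < n) b k * bump 4^-1 (z - w k)) `^ p)).
    apply: powR_mono; [exact: ltW|exact: cabs_ge0|].
    rewrite cabsM cabs_weighted -mulrA -cabsM /comb mulr_suml.
    apply: le_trans (ler_wpM2l _ (cabs_sum _ _)) _; first by rewrite exprn_ge0// cabs_ge0.
    rewrite !mulr_sumr; apply: ler_sum => k _.
    rewrite -mulrA cabsM cabs_real cabs_kern_gauss.
    rewrite mulrCA [leRHS]mulrCA -mulrA; apply: ler_wpM2l => //.
    apply: (@le_trans _ _ ((1 + cabs (w k)) ^+ m * ((1 + cabs (z - w k)) ^+ m * bump 2^-1 (z - w k)))).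
      rewrite mulrA; apply: ler_wpM2r; first exact: expR_ge0.
      rewrite -exprMn; apply: lerXn2r; rewrite ?nnegrE ?cabs_ge0//.
        by rewrite mulr_ge0// addr_ge0// cabs_ge0.
      have h1 : cabs z <= cabs (z - w k) + cabs (w k) by have := cabsD (z - w k) (w k); rewrite subrK.
      have := cabs_ge0 (z - w k); have := cabs_ge0 (w k); move: h1; clear; nra.
    by apply: ler_wpM2l; [rewrite exprn_ge0// addr_ge0// cabs_ge0|exact: growth_bump].
  rewrite powRM ?expR_ge0//; last by apply: sumr_ge0 => k _; rewrite mulr_ge0// expR_ge0.
  apply: ler_wpM2l; first exact: ltW.
  apply: LP => //; first by move=> k; exact: expR_ge0.
  exact: KP wnet.
have mB z : measurable_fun [set: borelC R] (fun x : borelC R => (bump (4^-1 * th) ((x : Cplx R) - z))%:E).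
  have -> : (fun x : borelC R => (bump (4^-1 * th) ((x : Cplx R) - z))%:E) =
      (fun x : borelC R => (bump (4^-1 * th) (z - x))%:E).
    by apply/funext => x; rewrite /bump cabs_distrC.
  by apply/measurable_EFinP; exact: measurable_bump.
have GE' z : (\int[@area R]_x (bump (4^-1 * th) ((x : Cplx R) - z))%:E = G%:E)%E.
  by rewrite -(GE z); apply: eq_integral => x _; rewrite /bump cabs_distrC.
apply: (@le_trans _ _ (\int[@area R]_z ((E * L)%:E * \sum_(k < n) (b k `^ p)%:E * (bump (4^-1 * th) ((z : Cplx R) - w k))%:E))%E).
  apply: ge0_le_integral => //.
  - by move=> z _; rewrite lee_fin powR_ge0.
  - by apply: measurable_gauss_powR; apply: entire_continuous; apply: entire_weighted; exact: entire_comb.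
  - by apply: emeasurable_funM => //; apply: emeasurable_sum => k; apply: emeasurable_funM.
  - move=> z _; under eq_bigr do rewrite -EFinM.
    by rewrite sumEFin -EFinM lee_fin; have := pt z; rewrite mulrA.
rewrite ge0_integralZl//; last 3 first.
- by apply: emeasurable_sum => k; apply: emeasurable_funM.
- by move=> z _; apply: sume_ge0 => k _; rewrite mule_ge0// lee_fin ?powR_ge0 ?expR_ge0.
- by rewrite lee_fin mulr_ge0// ltW.
rewrite -[E * L * G * _]mulrA [leRHS]EFinM lee_pmul2l ?lte_fin ?mulr_gt0//.
rewrite ge0_integral_sum//; last 2 first.
- by move=> k; apply: emeasurable_funM.
- by move=> k z _; rewrite mule_ge0// lee_fin ?powR_ge0 ?expR_ge0.
rewrite [G * _]mulrC mulr_suml -sumEFin; apply: lee_sum => k _.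
rewrite ge0_integralZl ?GE' ?lee_fin ?powR_ge0//;
  by move=> z _; rewrite lee_fin expR_ge0.
Qed.

End kernels.

(** * Random signs *)

Section signs.
Variable R : realType.

Definition flip n (k : 'I_n) (eps : {ffun 'I_n -> bool}) : {ffun 'I_n -> bool} :=
  [ffun j => if j == k then ~~ eps j else eps j].

Lemma flipK n (k : 'I_n) : involutive (flip k).
Proof.
by move=> eps; apply/ffunP => j; rewrite !ffunE; case: eqP => // _; rewrite negbK.
Qed.

Lemma card_signs n : #|{ffun 'I_n -> bool}| = (2 ^ n)%N.
Proof. by rewrite card_ffun card_bool card_ord. Qed.

(** Flipping the sign of one term changes the sum by twice that term, so the
    two sums cannot both be small. Near [w k] only the [k]-th term of the test
    function matters, and this bound does the work of Khinchin's inequality. *)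
Lemma signs_average (q : R) n (x : 'I_n -> Cplx R) (k : 'I_n) : 0 < q ->
  2 ^+ n * cabs (x k) `^ q <=
  2 * \sum_(eps : {ffun 'I_n -> bool}) cabs (\sum_(j < n) (-1) ^+ eps j * x j) `^ q.
Proof.
move=> q0; pose S (eps : {ffun 'I_n -> bool}) := \sum_(j < n) (-1) ^+ eps j * x j.
have pt eps : cabs (x k) `^ q <= cabs (S eps) `^ q + cabs (S (flip k eps)) `^ q.
  have E : S eps - S (flip k eps) = 2 * ((-1) ^+ eps k * x k).
    rewrite /S (bigD1 k)//= [in X in _ - X](bigD1 k)//= ffunE eqxx.
    rewrite [X in _ - (_ + X)](eq_bigr (fun j => (-1) ^+ eps j * x j)); last first.
      by move=> j jk; rewrite ffunE (negbTE jk).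
    by rewrite signrN; ring.
  have h : cabs (x k) <= Num.max (cabs (S eps)) (cabs (S (flip k eps))).
    have := cabsD (S eps) (- S (flip k eps)); rewrite cabsN E !cabsM cabsX.
    have -> : cabs (-1 : Cplx R) = 1 by rewrite cabsN cabs1.
    have -> : cabs (2 : Cplx R) = 2.
      have := cabs_real (2 : R); rewrite ger0_norm// => <-; congr cabs.
      by rewrite raddfMn.
    rewrite expr1n mul1r.
    by case: (leP (cabs (S eps)) (cabs (S (flip k eps)))); lra.
  apply: le_trans (powR_mono (ltW q0) (cabs_ge0 _) h) _.
  by rewrite maxEle; case: ifP => _; [rewrite lerDr|rewrite lerDl]; exact: powR_ge0.
apply: (@le_trans _ _ (\sum_(eps : {ffun 'I_n -> bool})
    (cabs (S eps) `^ q + cabs (S (flip k eps)) `^ q))).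
  apply: le_trans (ler_sum _ (fun eps _ => pt eps)).
  rewrite sumr_const card_signs -[leRHS]mulr_natl natrX.
  exact: lexx.
rewrite big_split/= [X in _ + X](reindex_inj (inv_inj (flipK k)))/=.
by under [X in _ + X]eq_bigr do rewrite flipK; rewrite mulr_natl mulr2n.
Qed.

End signs.

(** * From the embedding to averages on nets *)

Section necessity.
Variable R : realType.
Variable mu : {measure set (borelC R) -> \bar R}.

(** Average the embedding over all choices of signs in the combinations of
    kernels at the points of the net. On the disc around [w k] the mean of
    |f|^q controls the [k]-th term by [signs_average], and the discs overlap
    boundedly. *)
Lemma carleson_sequences (p q r s : R) (m : nat) : 0 < p -> 0 < q -> 0 < r -> 0 < s ->
  fock_carleson mu m p q ->
  exists2 K : R, 0 < K & forall c w n (a : nat -> R), net s c w -> (forall k, 0 <= a k) ->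
    (\sum_(k < n) (a k `^ q)%:E * averaging mu m q r (w k) <=
     (K * (\sum_(k < n) a k `^ p) `^ (q / p))%:E)%E.
Proof.
move=> p0 q0 r0 s0 [C C0 HC].
have [K K0 KP] := @comb_norm R p s m p0 s0.
have [N N0 NP] := net_overlap s0 (ltW r0).
pose E := bump 2^-1 (r%:C%C : Cplx R) `^ q; have E0 : 0 < E by rewrite powR_gt0// expR_gt0.
have q1 : q^-1 != 0 by rewrite invr_eq0 gt_eqF.
exists (E^-1 * (N * 2 * (C `^ q * K `^ (q / p)))).
  apply: mulr_gt0; first by rewrite invr_gt0.
  by apply: mulr_gt0; [exact: mulr_gt0|apply: mulr_gt0; exact: powR_gt0].
move=> c w n a wnet a0.
set X := \sum_(k < n) a k `^ p; have X0 : 0 <= X by apply: sumr_ge0 => k _; exact: powR_ge0.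
pose W k := (1 + cabs (w k)) ^+ m.
have W0 k : 0 < W k by rewrite exprn_gt0// ltr_wpDr// cabs_ge0.
pose F (eps : {ffun 'I_n -> bool}) := comb (fun k : 'I_n => (-1) ^+ eps k * (a k / W k)) w.
have FE eps : entire (F eps) by exact: entire_comb.
have Fnorm eps : (fockint (F eps) p m setT <= (K * X)%:E)%E.
  apply: le_trans (KP c w n _ wnet) _; rewrite lee_fin ler_wpM2l ?(ltW K0)//.
  apply: ler_sum => k _; rewrite -/(W k) normrM normrX normrN1 expr1n mul1r.
  by rewrite ger0_norm ?divfK ?gt_eqF// divr_ge0// ltW.
have Fcar eps : (\int[mu]_z (cabs (F eps z * gauss z) `^ q)%:E <=
    (C `^ q * K `^ (q / p) * X `^ (q / p))%:E)%E.
  have KX0 : 0 <= K * X by rewrite mulr_ge0// ltW.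
  have FF : fock_sobolev p m (F eps).
    split => //; rewrite fock_sobolev_normE poweR_lty//.
    by apply: le_lt_trans (Fnorm eps) _; rewrite ltry.
  have := HC _ FF; rewrite gauss_LnormE fock_sobolev_normE => H.
  have I0 : (0 <= \int[mu]_z (cabs (F eps z * gauss z) `^ q)%:E)%E.
    by apply: integral_ge0 => z _; rewrite lee_fin powR_ge0.
  have : ((\int[mu]_z (cabs (F eps z * gauss z) `^ q)%:E) `^ q^-1 <= (C * (K * X) `^ p^-1)%:E)%E.
    apply: le_trans H _; rewrite EFinM lee_pmul2l// -poweR_EFin.
    apply: gt0_ler_poweR; rewrite ?in_itv/= ?leey ?andbT ?lee_fin ?fockint_ge0//.
    by rewrite invr_ge0 ltW.
  move=> {}H.
  have := @gt0_ler_poweR R q (ltW q0) _ _ _ _ H.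
  rewrite !in_itv /= !leey !andbT poweR_ge0 lee_fin mulr_ge0 ?powR_ge0 ?(ltW C0)// => /(_ isT isT).
  rewrite -poweRrM mulVf ?gt_eqF// poweRe1//.
  move=> /le_trans; apply; rewrite lee_fin powRM ?powR_ge0 ?(ltW C0)// -powRrM.
  by rewrite powRM ?(ltW K0)// mulrA [p^-1 * q]mulrC.
pose x k z := (a k / W k)%:C%C * kern (w k) z * gauss z : Cplx R.
have xk_disc (k : 'I_n) z : disc (w k) r z ->
    E * (a k `^ q / (1 + cabs (w k)) `^ (m%:R * q)) <= cabs (x k z) `^ q.
  move=> zk; rewrite /x -mulrA cabsM cabs_real cabs_kern_gauss.
  have aW0 : 0 <= a k / W k by rewrite divr_ge0// ltW.
  have b0 : 0 <= bump 2^-1 (z - w k) by exact: expR_ge0.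
  rewrite (ger0_norm aW0) [leLHS]mulrC (powRM _ aW0 b0).
  apply: ler_pM.
  - by rewrite divr_ge0 ?powR_ge0.
  - exact: ltW.
  - rewrite (powRM _ (a0 k)) ?invr_ge0 ?(ltW (W0 k))//; apply: ler_wpM2l; first exact: powR_ge0.
    rewrite (powRV _ (ltW (W0 k))).
    by rewrite /W -powR_mulrn ?addr_ge0 ?cabs_ge0// powRrM.
  apply: powR_mono; [exact: ltW|exact: expR_ge0|].
  rewrite /bump ler_expR lerN2 ler_pM2l// cabs_real (ger0_norm (ltW r0)).
  by apply: lerXn2r; rewrite ?nnegrE ?cabs_ge0 ?(ltW r0)//; exact: ltW.
have FxE eps z : F eps z * gauss z = \sum_(j < n) (-1) ^+ eps j * x j z.
  rewrite /F /comb mulr_suml; apply: eq_bigr => j _.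
  by rewrite /x rmorphM rmorphXn rmorphN1 !mulrA.
pose H z : \bar R := ((2 / 2 ^+ n)%:E * \sum_(eps : {ffun 'I_n -> bool})
   (cabs (F eps z * gauss z) `^ q)%:E)%E.
have xH (k : 'I_n) z : ((cabs (x k z) `^ q)%:E <= H z)%E.
  rewrite /H sumEFin -EFinM lee_fin mulrAC ler_pdivlMr ?exprn_gt0// mulrC.
  have := @signs_average R q n (fun j => x j z) k q0.
  by under eq_bigr do rewrite -FxE.
have mFe eps (A : set (borelC R)) : measurable_fun A (fun z => (cabs (F eps z * gauss z) `^ q)%:E).
  by apply: measurable_gauss_powR; exact: entire_continuous.
have mH : measurable_fun [set: borelC R] H.
  by apply: emeasurable_funM => //; apply: emeasurable_sum => eps; exact: mFe.
have H0 z : (0 <= H z)%E.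
  apply: mule_ge0; first by rewrite lee_fin divr_ge0// exprn_ge0.
  by apply: sume_ge0 => eps _; rewrite lee_fin powR_ge0.
have HI : (\int[mu]_z H z <= (2 * (C `^ q * K `^ (q / p) * X `^ (q / p)))%:E)%E.
  rewrite /H ge0_integralZl//; last 2 first.
  - by apply: emeasurable_sum => eps; exact: mFe.
  - by move=> z _; apply: sume_ge0 => eps _; rewrite lee_fin powR_ge0.
  rewrite ge0_integral_sum//; last by move=> eps z _; rewrite lee_fin powR_ge0.
  apply: (@le_trans _ _ ((2 / 2 ^+ n)%:E * \sum_(eps : {ffun 'I_n -> bool})
      (C `^ q * K `^ (q / p) * X `^ (q / p))%:E)%E).
    apply: lee_wpmul2l; first by rewrite lee_fin divr_ge0// exprn_ge0.
    by apply: lee_sum => eps _; exact: Fcar.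
  rewrite sumEFin sumr_const card_signs -EFinM lee_fin -[X in _ * X <= _]mulr_natl natrX.
  by rewrite [leLHS]mulrA divfK ?expf_neq0.
have over : (\sum_(k < n) \int[mu]_(z in disc (w k) r) H z <= N%:E * \int[mu]_z H z)%E.
  apply: (@sum_integral_overlap _ _ R mu (fun k => disc (w k) r) H N n) => //.
  - exact: ltW.
  - by move=> k; exact: measurable_disc.
  move=> z; apply: le_trans (NP c w z n wnet); apply: ler_sum => k _.
  rewrite indicE; case: (boolP (z \in disc (w k) r)) => //= /set_mem zS.
  by rewrite (_ : cabs (z - w k) <= r)//; exact: ltW.
have low (k : 'I_n) : (E%:E * ((a k `^ q)%:E * averaging mu m q r (w k)) <=
    \int[mu]_(z in disc (w k) r) H z)%E.
  rewrite averagingE !muleA -!EFinM -integral_cst; last exact: measurable_disc.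
  apply: ge0_le_integral => //.
  - exact: measurable_disc.
  - by move=> z _; rewrite lee_fin !mulr_ge0 ?invr_ge0 ?powR_ge0// ltW.
  - exact: measurable_funTS.
  - move=> z zk; apply: le_trans (xH k z); rewrite lee_fin -mulrA.
    exact: xk_disc.
have E1 : (1 = E^-1%:E * E%:E :> \bar R)%E by rewrite -EFinM mulVf ?gt_eqF.
rewrite -[leLHS]mul1e [X in (X * _ <= _)%E]E1 -muleA.
rewrite -!mulrA EFinM; apply: lee_wpmul2l; first by rewrite lee_fin invr_ge0 ltW.
rewrite ge0_sume_distrr; last first.
  by move=> k _; rewrite mule_ge0 ?averaging_ge0// lee_fin powR_ge0.
apply: le_trans (lee_sum _ (fun k _ => low k)) _.
apply: le_trans over _; rewrite EFinM lee_wpmul2l ?lee_fin ?(ltW N0)//.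
by apply: le_trans HI _; rewrite !mulrA.
Qed.

End necessity.

(** * Lower semicontinuity of the averages *)

Section averaging_function.
Variable R : realType.
Variable mu : {measure set (borelC R) -> \bar R}.

Lemma weight_continuous (t e : R) (a0 : Cplx R) : 0 < e -> exists2 d : R, 0 < d &
  forall a : Cplx R, cabs (a0 - a) < d ->
    `|(1 + cabs a0) `^ t - (1 + cabs a) `^ t| < e.
Proof.
move=> e0; have x0 : 0 < 1 + cabs a0 by rewrite ltr_wpDr// cabs_ge0.
have : {for 1 + cabs a0, continuous (fun x : R => x `^ t)}.
  apply/differentiable_continuous; apply/derivable1_diffP; apply: derivable_powR.
  by rewrite in_itv /= x0.
move/cvgrPdist_lt => /(_ e e0)/nbhs_ballP[d /= d0 dP]; exists d => // a ad.
apply: dP; rewrite /ball /= opprD addrACA subrr add0r.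
exact: le_lt_trans (cabs_dist _ _) ad.
Qed.

(** Continuity of the measure along an increasing sequence of discs. *)
Lemma disc_lsc (c r : R) (a0 : Cplx R) : (c%:E < mu (disc a0 r))%E ->
  exists2 d : R, 0 < d & (c%:E < mu (disc a0 (r - d)))%E.
Proof.
move=> cr; pose F n := disc a0 (r - n.+1%:R^-1).
have FU : \bigcup_n F n = disc a0 r.
  apply/seteqP; split => [z [n _ zn]|z zr].
    by apply: (lt_trans (zn : _ < _)); rewrite gtrBl invr_gt0.
  have zr' : cabs (z - a0) < r by [].
  have [n nP] := ltr_add_invr zr'.
  by exists n => //; rewrite /F /disc /= ltrBrDr.
have mF n : measurable (F n) by exact: measurable_disc.
have cv : mu \o F @ \oo --> mu (disc a0 r).
  rewrite -FU; apply: nondecreasing_cvg_mu => //; first by rewrite FU; exact: measurable_disc.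
  move=> i j ij; apply/subsetPset => z /= zi; apply: lt_le_trans (zi : _ < _) _.
  by rewrite lerB// lef_pV2 ?posrE// ler_nat.
have [n cn] : exists n, (c%:E < mu (F n))%E.
  apply: contrapT => no; move: cr; apply/negP; rewrite -leNgt.
  rewrite -(cvg_lim _ cv)//; apply: lime_le; first by apply/cvg_ex; exists (mu (disc a0 r)).
  by apply: nearW => n; rewrite leNgt; apply/negP => cn; apply: no; exists n.
by exists n.+1%:R^-1 => //; rewrite invr_gt0.
Qed.

(** A slightly smaller disc around [a0] already has large measure, and it is
    contained in the disc around every nearby point. *)
Lemma averaging_open (m : nat) (q r c : R) :
  open [set a : Cplx R | (c%:E < averaging mu m q r a)%E].
Proof.
rewrite openE => a0 /= ca; apply/nbhs_cabsP.
have W0 (a : Cplx R) : 0 < (1 + cabs a) `^ (m%:R * q) by rewrite powR_gt0// ltr_wpDr// cabs_ge0.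
have ltE a : (c%:E < averaging mu m q r a)%E =
    ((c * (1 + cabs a) `^ (m%:R * q))%:E < mu (disc a r))%E.
  by rewrite averagingE lte_pdivlMl// -EFinM mulrC.
move: ca; rewrite ltE => /disc_lsc[h h0 ch].
have [c0|c0] := ltP c 0.
  exists 1 => // a _; apply: lt_le_trans (averaging_ge0 _ _ _ _ _).
  by rewrite lte_fin.
have [d d1 d2] : exists2 d : R, c * (1 + cabs a0) `^ (m%:R * q) < d &
    (d%:E <= mu (disc a0 (r - h)))%E.
  case: (mu _) ch => [v| |] //=.
    by rewrite lte_fin => cv; exists v.
  by move=> _; exists (c * (1 + cabs a0) `^ (m%:R * q) + 1); rewrite ?ltrDl ?leey.
have e0 : 0 < (d - c * (1 + cabs a0) `^ (m%:R * q)) / (c + 1).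
  by rewrite divr_gt0 ?subr_gt0// ltr_wpDl.
have [d' d'0 dP] := weight_continuous (m%:R * q) a0 e0.
exists (Num.min d' h); first by rewrite lt_min d'0 h0.
move=> a; rewrite lt_min => /andP[ad ah] /=; rewrite ltE.
apply: (@lt_le_trans _ _ d%:E).
  have c1 : 0 < c + 1 by rewrite ltr_wpDl.
  rewrite lte_fin; have := dP a ad; rewrite ltr_pdivlMr//.
  set u := _ `^ _; set v := _ `^ _ => uv.
  have h1 : c * (v - u) <= c * `|u - v| by rewrite ler_wpM2l// distrC ler_norm.
  by move: h1 uv (normr_ge0 (u - v)); clear; rewrite mulrBr mulrDr mulr1 [`|_| * c]mulrC; lra.
apply: le_trans d2 _; apply: le_measure; rewrite ?inE; [exact: measurable_disc|exact: measurable_disc|].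
move=> z /= zh; apply: le_lt_trans (cabs_triangle a0 z a) _.
by move: zh ah; rewrite /disc /=; clear; lra.
Qed.

Lemma measurable_averaging (m : nat) (q r : R) :
  measurable_fun [set: borelC R] (averaging mu m q r : borelC R -> \bar R).
Proof. by apply: lsc_measurableC => c; exact: averaging_open. Qed.

Lemma area_open_gt0 (A : set (Cplx R)) (a : Cplx R) : open A -> A a ->
  (0 < @area R (A : set (borelC R)))%E.
Proof.
move=> oA Aa; have : nbhs a A by exact: open_nbhs_nbhs.
move=> /nbhs_cabsP[e e0 eA]; case: a Aa eA => x y Aa eA.
have e3 : 0 < e / 3 by rewrite divr_gt0.
apply: (@lt_le_trans _ _ (@area R (square x y (e / 3)))).
  rewrite area_rect; [|by move: e3; clear; lra..].
  by rewrite lte_fin; apply: mulr_gt0; move: e3; clear; lra.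
apply: le_measure; rewrite ?inE; [exact: measurable_rect|exact: open_borelC|].
move=> [u v] [/= h1 h2]; apply: eA; apply: le_lt_trans (cabs_le _) _.
have h3 : `|x - u| <= e / 3 by rewrite ler_norml; move: h1; clear; lra.
have h4 : `|y - v| <= e / 3 by rewrite ler_norml; move: h2; clear; lra.
by move: h3 h4 e0; rewrite /=; clear; lra.
Qed.

(** A nonempty open set has positive area, so a lower semicontinuous function
    is bounded everywhere by its essential supremum. *)
Lemma averaging_Linfty (m : nat) (q r : R) :
  in_Lp (@area R) +oo%E (averaging mu m q r) <->
  (ereal_sup [set averaging mu m q r a | a in [set: Cplx R]] < +oo)%E.
Proof.
have area0 : (0 < @area R setT)%E by apply: (@area_open_gt0 setT 0) => //; exact: openT.
have absE : abse \o averaging mu m q r = averaging mu m q r.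
  by apply/funext => a /=; rewrite gee0_abs// averaging_ge0.
split.
  move=> [_]; rewrite unlock area0 absE => H.
  have [M MP] : exists M : R, (ess_sup (@area R) (averaging mu m q r) <= M%:E)%E.
    case: (ess_sup _ _) H => [v _| //|_]; first by exists v.
    by exists 0; rewrite leNye.
  apply: (@le_lt_trans _ _ M%:E); last by rewrite ltry.
  apply: ge_ereal_sup => _ [a _ <-]; rewrite leNgt; apply/negP => Ma.
  have /ess_supP[A [mA A0 sub]] := MP.
  have := area_open_gt0 (@averaging_open m q r M) Ma.
  rewrite ltNge => /negP; apply; rewrite -A0; apply: le_measure; rewrite ?inE//.
    by apply: open_borelC; exact: averaging_open.
  by move=> z /= Mz; apply: sub => /=; apply/negP; rewrite -ltNge.
move=> H; split; first exact: measurable_averaging.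
rewrite unlock area0 absE; apply: le_lt_trans H; apply/ess_supP; apply: nearW => a.
by apply: ereal_sup_ubound; exists a.
Qed.

End averaging_function.

(** * Lattice cells *)

Section cells.
Variable R : realType.
Implicit Types (s : R) (c : nat -> int * int) (w : nat -> Cplx R).

Definition cell s (n : int * int) : set (borelC R) :=
  rect (s * n.1%:~R) (s * n.1%:~R + s) (s * n.2%:~R) (s * n.2%:~R + s).

Definition node s (n : int * int) : Cplx R := mkC (s * n.1%:~R) (s * n.2%:~R).

Lemma measurable_cell s n : measurable (cell s n).
Proof. exact: measurable_rect. Qed.

Lemma area_cell1 n : @area R (cell 1 n) = 1%:E.
Proof. by rewrite area_rect ?lerDl// !mul1r !(addrC _ 1) !addrK mulr1. Qed.

Lemma half_cellS s n : 0 < s -> half_cell s n `<=` cell s n.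
Proof. by move=> s0 [x y] [/= h1 h2]; split => /=; move: h1 h2 s0; clear; lra. Qed.

Lemma node_cell s n : 0 < s -> cell s n (node s n).
Proof. by move=> s0; split => /=; move: s0; clear; lra. Qed.

Lemma cell_cover s z : 0 < s -> exists n, cell s n z.
Proof.
move=> s0; have key (x : R) : exists n : int, s * n%:~R <= x <= s * n%:~R + s.
  exists (Num.floor (x / s)); have /andP[h1 h2] := floor_itv (x / s).
  move: h1 h2; rewrite ler_pdivlMr// ltr_pdivrMr// intrD mulrDl mul1r [s * _]mulrC.
  by move=> -> /ltW ->.
case: z => x y; have [i xi] := key x; have [j yj] := key y.
by exists (i, j).
Qed.

Lemma cell_net s c w : 0 < s -> injective c -> (forall k, cell s (c k) (w k)) -> net s c w.
Proof.
move=> s0 cinj H; split => // k; have := H k; case: (w k) => a b [/= h1 h2].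
by split; rewrite ler_norml; [move: h1|move: h2]; move: s0; clear; lra.
Qed.

(** A point and the point of the net that belongs to its cell both lie within
    [s] of the same node in each coordinate. *)
Lemma net_cover s r c w (z : Cplx R) : 0 < s -> 4 * s < r -> net s c w ->
  (forall n, exists k, c k = n) -> exists k, cabs (z - w k) < r.
Proof.
move=> s0 sr wnet csurj; have [n nz] := cell_cover z s0; have [k ck] := csurj n.
exists k; have := wnet.2 k; move: nz; rewrite -{}ck.
case: z => x y [/= h1 h2] [/= h3 h4]; apply: le_lt_trans (cabs_le _) _.
have : `|x - complex.Re (w k)| <= 2 * s.
  by rewrite ler_norml; move: h1 h3 s0; rewrite ler_norml; clear; lra.
have : `|y - complex.Im (w k)| <= 2 * s.
  by rewrite ler_norml; move: h2 h4 s0; rewrite ler_norml; clear; lra.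
by rewrite !raddfB /=; move: sr; clear; lra.
Qed.

Lemma lattice_sumE s c (g : Cplx R -> \bar R) : 0 < s -> injective c ->
  (forall n, exists k, c k = n) -> (forall a, (0 <= g a)%E) ->
  (\esum_(a in square_lattice s) g a = \sum_(k <oo) g (node s (c k)))%E.
Proof.
move=> s0 cinj csurj g0; rewrite nneseries_esumT//.
apply: (@reindex_esum R _ _ _ _ (fun k => node s (c k))).
split.
- by move=> k _; exists (c k).
- move=> i j _ _ [/mulfI h1 /mulfI h2]; apply: cinj.
  case: (c i) (c j) h1 h2 => a b [a' b'] /= h1 h2.
  have sn : s != 0 by rewrite gt_eqF.
  by move: (h1 sn) (h2 sn) => /intr_inj -> /intr_inj ->.
- by move=> _ [n _ <-]; have [k <-] := csurj n; exists k.
Qed.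

End cells.

(** * The criteria *)

Section criteria.
Variable R : realType.
Variable mu : {measure set (borelC R) -> \bar R}.

(** Test [carleson_sequences] on the sequence with a single nonzero term, for
    a net through [a]. *)
Lemma carleson_bounded (p q r : R) (m : nat) : 0 < p -> 0 < q -> 0 < r ->
  fock_carleson mu m p q -> exists2 K : R, 0 < K & forall a, (averaging mu m q r a <= K%:E)%E.
Proof.
move=> p0 q0 r0 /(carleson_sequences p0 q0 r0 ltr01)[K K0 KP]; exists K => // a.
have [c cinj csurj] := lattice_enum.
have [n na] := cell_cover a ltr01; have [k0 ck0] := csurj n.
pose w k := if k == k0 then a else node 1 (c k).
have wnet : net 1 c w.
  by apply: cell_net => // k; rewrite /w; case: eqP => [->|_]; [rewrite ck0|exact: node_cell].
have := KP c w k0.+1 (fun k => (k == k0)%:R) wnet (fun k => ler0n _ _).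
rewrite !big_ord_recr /= eqxx !powR1 mul1e {2}/w eqxx.
rewrite [X in (X + _) `^ _]big1 => [|k _]; last first.
  by rewrite ltn_eqF// powR0// gt_eqF.
rewrite add0r powR1 mulr1; apply: le_trans; rewrite leeDr//.
by apply: sume_ge0 => k _; rewrite mule_ge0 ?averaging_ge0// lee_fin powR_ge0.
Qed.

Lemma carleson_of_bounded (p q r M : R) (m : nat) : 0 < p -> p <= q -> 0 < r -> 0 <= M ->
  (forall a, (averaging mu m q r a <= M%:E)%E) -> fock_carleson mu m p q.
Proof.
move=> p0 pq r0 M0 H; have q0 := lt_le_trans p0 pq.
have [c cinj csurj] := lattice_enum; pose s := r / 5.
have s0 : 0 < s by rewrite divr_gt0.
have sr : 4 * s < r by rewrite /s; move: r0; clear; lra.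
have wnet : net s c (fun k => node s (c k)) by apply: cell_net => // k; exact: node_cell.
apply: (carleson_sufficiency (r := r) (T := 0) (tau := fun=> 0) p0 q0 r0 s0 M0 wnet).
- by move=> z; exact: net_cover sr wnet csurj.
- move=> k x /andP[x0 x1]; rewrite add0r EFinM.
  apply: lee_pmul => //; [exact: averaging_ge0|by rewrite lee_fin powR_ge0|].
  rewrite lee_fin; have [->|xn] := eqVneq x 0; first by rewrite powR0// gt_eqF ?divr_gt0.
  by apply: ge1r_powR; rewrite ?lt_def ?xn ?x0// ler_pdivlMr// mul1r.
- by move=> n; rewrite big1.
Qed.

Lemma sup_bounded (q r : R) (m : nat) :
  (ereal_sup [set averaging mu m q r a | a in [set: Cplx R]] < +oo)%E <->
  exists2 M : R, 0 <= M & forall a, (averaging mu m q r a <= M%:E)%E.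
Proof.
split=> [H|[M M0 H]]; last first.
  by apply: (@le_lt_trans _ _ M%:E); [apply: ge_ereal_sup => _ [a _ <-]|rewrite ltry].
have ub a : (averaging mu m q r a <= ereal_sup [set averaging mu m q r a | a in [set: Cplx R]])%E.
  by apply: ereal_sup_ubound; exists a.
have S0 := le_trans (averaging_ge0 mu m q r 0) (ub 0).
exists (fine (ereal_sup [set averaging mu m q r a | a in [set: Cplx R]])).
  exact: fine_ge0.
by move=> a; rewrite fineK// ge0_fin_numE.
Qed.

(** Compare x with t^(p/(p-q)), the value at which t x^(q/p) = x. *)
Lemma young_powR (p q t x : R) : 0 < q -> q < p -> 0 <= t -> 0 <= x ->
  t * x `^ (q / p) <= t `^ (p / (p - q)) + x.
Proof.
move=> q0 qp t0 x0; have p0 := lt_trans q0 qp.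
have pq : 0 < p - q by rewrite subr_gt0.
have k0 : 0 < p / (p - q) by rewrite divr_gt0.
have qp0 : 0 < q / p by rewrite divr_gt0.
have [->|tn] := eqVneq t 0; first by rewrite mul0r addr_ge0// powR_ge0.
have tp : 0 < t by rewrite lt_def tn.
have [xt|tx] := leP x (t `^ (p / (p - q))).
  apply: (@le_trans _ _ (t `^ (p / (p - q)))); last by rewrite lerDl.
  apply: (@le_trans _ _ (t * (t `^ (p / (p - q))) `^ (q / p))).
    by rewrite ler_pM2l//; apply: powR_mono => //; exact: ltW.
  rewrite -powRrM -[X in X * _]powRr1// -powRD; last by rewrite tn implybT.
  by have -> : 1 + p / (p - q) * (q / p) = p / (p - q) by field; rewrite !gt_eqF.
have xp : 0 < x by apply: le_lt_trans tx; exact: powR_ge0.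
apply: (@le_trans _ _ x); last by rewrite lerDr powR_ge0.
have tE : t = (t `^ (p / (p - q))) `^ ((p - q) / p).
  by rewrite -powRrM mulrA divfK ?gt_eqF// divff ?powRr1// gt_eqF.
rewrite {1}tE.
apply: (@le_trans _ _ (x `^ ((p - q) / p) * x `^ (q / p))).
  apply: ler_wpM2r; first exact: powR_ge0.
  by apply: powR_mono; rewrite ?powR_ge0 ?(ltW tx)// divr_ge0// ltW.
rewrite -powRD; last by rewrite (gt_eqF xp) implybT.
by rewrite -mulrDl subrK divff ?gt_eqF// powRr1.
Qed.

(** The sequence a_k = t_k^(1/(p-q)) makes a_k^p and a_k^q t_k both equal to
    t_k^(p/(p-q)), so that the sum X of these powers satisfies X <= K
    X^(q/p), with X finite. *)
Lemma carleson_summable (p q r s : R) (m : nat) : 0 < q -> q < p -> 0 < r -> 0 < s ->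
  fock_carleson mu m p q -> exists2 K : R, 0 < K & forall c w n, net s c w ->
    (\sum_(k < n) averaging mu m q r (w k) `^ (p / (p - q)) <= K%:E)%E.
Proof.
move=> q0 qp r0 s0 H; have p0 := lt_trans q0 qp.
have pq : 0 < p - q by rewrite subr_gt0.
have [B B0 BP] := carleson_bounded p0 q0 r0 H.
have [K K0 KP] := carleson_sequences p0 q0 r0 s0 H.
exists (K `^ (p / (p - q))); first exact: powR_gt0.
move=> c w n wnet; pose t k := fine (averaging mu m q r (w k)).
have tE k : averaging mu m q r (w k) = (t k)%:E.
  by rewrite fineK// ge0_fin_numE ?averaging_ge0// (le_lt_trans (BP _))// ltry.
have t0 k : 0 <= t k by apply: fine_ge0; exact: averaging_ge0.
pose X := \sum_(k < n) t k `^ (p / (p - q)).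
have X0 : 0 <= X by apply: sumr_ge0 => k _; exact: powR_ge0.
have -> : (\sum_(k < n) averaging mu m q r (w k) `^ (p / (p - q)) = X%:E)%E.
  by rewrite -sumEFin; apply: eq_bigr => k _; rewrite tE poweR_EFin.
have := KP c w n (fun k => t k `^ (p - q)^-1) wnet (fun k => powR_ge0 _ _).
have -> : \sum_(k < n) (t k `^ (p - q)^-1) `^ p = X.
  by apply: eq_bigr => k _; rewrite -powRrM mulrC.
have -> : (\sum_(k < n) ((t k `^ (p - q)^-1) `^ q)%:E * averaging mu m q r (w k) = X%:E)%E.
  rewrite -sumEFin; apply: eq_bigr => k _; rewrite tE -EFinM -powRrM; congr (_%:E).
  have [->|tn] := eqVneq (t k) 0.
    by rewrite mulr0 powR0// gt_eqF// divr_gt0.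
  rewrite -[X in _ * X]powRr1// -powRD; last by rewrite tn implybT.
  by congr (_ `^ _); field; rewrite gt_eqF.
rewrite !lee_fin => XK; have [->|Xn] := eqVneq X 0; first exact: powR_ge0.
have Xp : 0 < X by rewrite lt_def Xn.
have h : X `^ ((p - q) / p) <= K.
  rewrite -(ler_pM2r (powR_gt0 (q / p) Xp)) -powRD; last by rewrite Xn implybT.
  by rewrite -mulrDl subrK divff ?gt_eqF// powRr1.
have -> : X = (X `^ ((p - q) / p)) `^ (p / (p - q)).
  by rewrite -powRrM mulrA divfK ?gt_eqF// divff ?powRr1// gt_eqF.
by apply: powR_mono; rewrite ?powR_ge0// divr_ge0// ltW.
Qed.

Lemma carleson_of_net_sum (p q r s T : R) (m : nat) c (w : nat -> Cplx R) :
  0 < q -> q < p -> 0 < r -> 0 < s -> 4 * s < r -> net s c w ->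
  (forall n, exists k, c k = n) ->
  (forall n, (\sum_(k < n) averaging mu m q r (w k) `^ (p / (p - q)) <= T%:E)%E) ->
  fock_carleson mu m p q.
Proof.
move=> q0 qp r0 s0 sr wnet csurj H; have p0 := lt_trans q0 qp.
have pq : 0 < p - q by rewrite subr_gt0.
have k0 : 0 < p / (p - q) by rewrite divr_gt0.
pose t k := fine (averaging mu m q r (w k)).
have tE k : averaging mu m q r (w k) = (t k)%:E.
  rewrite fineK// ge0_fin_numE ?averaging_ge0//.
  apply: (@lty_poweRy _ _ (p / (p - q))); first by rewrite gt_eqF.
  apply: le_lt_trans (ltry T); apply: le_trans (H k.+1).
  by rewrite big_ord_recr /= leeDr// sume_ge0// => i _; exact: poweR_ge0.
have t0 k : 0 <= t k by apply: fine_ge0; exact: averaging_ge0.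
apply: (carleson_sufficiency (r := r) (T := T) (tau := fun k => t k `^ (p / (p - q)))
   p0 q0 r0 s0 ler01 wnet).
- by move=> z; exact: net_cover sr wnet csurj.
- move=> k x /andP[x0 x1]; rewrite mul1r tE -EFinM lee_fin.
  exact: young_powR.
- move=> n; rewrite -lee_fin -sumEFin; apply: le_trans (H n).
  by apply: lee_sum => k _; rewrite tE poweR_EFin.
Qed.

(** Lattices are nets. For the converse a single one, fine enough for the
    discs of radius r to cover the plane, is sufficient. *)
Lemma carleson_lattice_sum (p q r : R) (m : nat) : 0 < q -> q < p -> 0 < r ->
  fock_carleson mu m p q <->
  forall s : R, 0 < s -> (\esum_(a in square_lattice s)
    (averaging mu m q r a `^ (p / (p - q))) < +oo)%E.
Proof.
move=> q0 qp r0; have [c cinj csurj] := lattice_enum.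
have nodes (s : R) : 0 < s -> net s c (fun k => node s (c k)).
  by move=> s0; apply: cell_net => // k; exact: node_cell.
have sumE (s : R) : 0 < s -> (\esum_(a in square_lattice s) (averaging mu m q r a `^ (p / (p - q))) =
    \sum_(k <oo) averaging mu m q r (node s (c k)) `^ (p / (p - q)))%E.
  move=> s0; apply: (lattice_sumE (g := fun a => (averaging mu m q r a `^ (p / (p - q)))%E)) => // a.
  exact: poweR_ge0.
split=> [H s s0|H].
  have [K K0 KP] := carleson_summable q0 qp r0 s0 H.
  rewrite sumE//; apply: le_lt_trans (ltry K); apply: lime_le.
    by apply: is_cvg_nneseries => k _ _; exact: poweR_ge0.
  apply: nearW => n; rewrite big_mkord; exact: (KP _ _ _ (nodes s s0)).
pose s := r / 5; have s0 : 0 < s by rewrite divr_gt0.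
have sr : 4 * s < r by rewrite /s; move: r0; clear; lra.
have := H s s0; rewrite sumE//; set S := (\sum_(k <oo) _)%E => Soo.
have ub n : (\sum_(k < n) averaging mu m q r (node s (c k)) `^ (p / (p - q)) <= S)%E.
  rewrite -(big_mkord xpredT (fun k => averaging mu m q r (node s (c k)) `^ (p / (p - q))))%E.
  by apply: nneseries_lim_ge => k _ _; exact: poweR_ge0.
have S0 : (0 <= S)%E by have := ub 0%N; rewrite big_ord0.
apply: (carleson_of_net_sum (T := fine S) q0 qp r0 s0 sr (nodes s s0) csurj).
by move=> n; rewrite fineK ?ge0_fin_numE.
Qed.

Lemma in_LpE (t : R) (g : borelC R -> \bar R) : 0 < t -> measurable_fun setT g ->
  (forall z, (0 <= g z)%E) ->
  in_Lp (@area R) t%:E g <-> (\int[@area R]_z (g z `^ t) < +oo)%E.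
Proof.
move=> t0 mg g0; rewrite /in_Lp unlock /=.
have -> : (\int[@area R]_z (`|g z| `^ t) = \int[@area R]_z (g z `^ t))%E.
  by apply: eq_integral => z _; rewrite gee0_abs.
split=> [[_]|H].
  by apply: lty_poweRy; rewrite invr_eq0 gt_eqF.
by split => //; exact: poweR_lty.
Qed.

Lemma half_geometric n : \sum_(k < n) 2^-1 ^+ k.+1 <= 1 :> R.
Proof.
have -> : \sum_(k < n) 2^-1 ^+ k.+1 = 1 - 2^-1 ^+ n :> R.
  elim: n => [|n ih]; first by rewrite big_ord0 expr0 subrr.
  by rewrite big_ord_recr /= ih exprS; field.
by rewrite gerBl exprn_ge0.
Qed.

(** If the embedding holds, choose in each unit cell a point where the power
    of the average is nearly at least its mean: the sum of these values,
    bounded by [carleson_summable], dominates the integral. Conversely choose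
    in each half cell of a fine lattice a point where it is nearly at most
    its mean: the integral dominates the sum of these values. Errors 2^-(k+1)
    keep the total error at most 1. *)
Lemma carleson_Lp (p q r : R) (m : nat) : 0 < q -> q < p -> 0 < r ->
  fock_carleson mu m p q <-> in_Lp (@area R) (p / (p - q))%:E (averaging mu m q r).
Proof.
move=> q0 qp r0; have p0 := lt_trans q0 qp.
have pq : 0 < p - q by rewrite subr_gt0.
have k0 : 0 < p / (p - q) by rewrite divr_gt0.
have mavg := measurable_averaging mu m q r.
rewrite in_LpE//; last by move=> z; exact: averaging_ge0.
pose F z : \bar R := (averaging mu m q r z `^ (p / (p - q)))%E.
have F0 z : (0 <= F z)%E by exact: poweR_ge0.
have mF : measurable_fun [set: borelC R] F.
  exact: (measurableT_comp (measurable_poweR _) mavg).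
have [c cinj csurj] := lattice_enum.
have eps0 k : 0 < 2^-1 ^+ k.+1 :> R by rewrite exprn_gt0.
split=> [H|Foo].
  have [K K0 KP] := carleson_summable q0 qp r0 ltr01 H.
  have [B B0 BP] := carleson_bounded p0 q0 r0 H.
  have pick k : exists2 z, cell 1 (c k) z &
      (\int[@area R]_(x in cell 1%R (c k)) F x <= F z * 1%:E + (2^-1 ^+ k.+1)%:E)%E.
    apply: mean_value_ge => //; [exact: measurable_cell|exact: area_cell1|exact: measurable_funTS|].
    apply: (@le_lt_trans _ _ (\int[@area R]_(x in cell 1%R (c k)) (B `^ (p / (p - q)))%:E)%E).
      apply: ge0_le_integral => //; [exact: measurable_cell|exact: measurable_funTS|].
      move=> z _; rewrite -poweR_EFin; apply: gt0_ler_poweR; rewrite ?(ltW k0)//.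
        by rewrite in_itv /= leey averaging_ge0.
      by rewrite in_itv /= leey lee_fin ltW.
    rewrite integral_cst; last exact: measurable_cell.
    by rewrite [X in (_ * X)%E](area_cell1 R (c k)) mule1 ltry.
  have /choice[w wP] : forall k, exists z, cell 1 (c k) z /\
      (\int[@area R]_(x in cell 1%R (c k)) F x <= F z + (2^-1 ^+ k.+1)%:E)%E.
    by move=> k; have [z z1 z2] := pick k; exists z; rewrite mule1 in z2.
  have wnet : net 1 c w by apply: cell_net => // k; exact: (wP k).1.
  apply: (@le_lt_trans _ _ (K + 1)%:E); last by rewrite ltry.
  apply: (integral_cover (A := fun k => cell 1 (c k))) => //.
  - by move=> k; exact: measurable_cell.
  - by move=> z; have [n nz] := cell_cover z ltr01; have [k ck] := csurj n; exists k; rewrite ck.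
  move=> n; apply: (@le_trans _ _ (\sum_(k < n) (F (w k) + (2^-1 ^+ k.+1)%:E))%E).
    by apply: lee_sum => k _; exact: (wP k).2.
  rewrite big_split/= EFinD; apply: leeD; first exact: KP wnet.
  by rewrite sumEFin lee_fin; exact: half_geometric.
pose s := r / 5; have s0 : 0 < s by rewrite divr_gt0.
have sr : 4 * s < r by rewrite /s; move: r0; clear; lra.
have V0 : 0 < (s / 2) ^+ 2 by rewrite exprn_gt0// divr_gt0.
have pick k : exists2 z, half_cell s (c k) z &
    (F z * ((s / 2) ^+ 2)%:E <= \int[@area R]_(x in half_cell s (c k)) F x + (2^-1 ^+ k.+1)%:E)%E.
  apply: mean_value_le => //; [exact: measurable_half_cell|exact: area_half_cell|exact: measurable_funTS|].
  apply: le_lt_trans Foo; apply: ge0_subset_integral => //; exact: measurable_half_cell.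
have /choice[w wP] : forall k, exists z, half_cell s (c k) z /\
    (F z * ((s / 2) ^+ 2)%:E <= \int[@area R]_(x in half_cell s (c k)) F x + (2^-1 ^+ k.+1)%:E)%E.
  by move=> k; have [z z1 z2] := pick k; exists z.
have wnet : net s c w by apply: cell_net => // k; apply: half_cellS => //; exact: (wP k).1.
have I0 : (0 <= \int[@area R]_z F z)%E by exact: integral_ge0.
have Ifin : (\int[@area R]_z F z)%E \is a fin_num by rewrite ge0_fin_numE.
apply: (carleson_of_net_sum (T := (fine (\int[@area R]_z F z) + 1) / (s / 2) ^+ 2)
  q0 qp r0 s0 sr wnet csurj) => n.
rewrite EFinM lee_pdivlMr// ge0_sume_distrl; last by move=> k _; exact: F0.
apply: (@le_trans _ _ (\sum_(k < n)
    (\int[@area R]_(x in half_cell s (c k)) F x + (2^-1 ^+ k.+1)%:E))%E).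
  by apply: lee_sum => k _; exact: (wP k).2.
rewrite big_split/= EFinD fineK//; apply: leeD; last by rewrite sumEFin lee_fin; exact: half_geometric.
rewrite -[leRHS]mul1e.
apply: (@sum_integral_overlap _ _ R (@area R) (fun k => half_cell s (c k)) F 1 n) => //.
- by move=> k; exact: measurable_half_cell.
- by move=> x; exact: half_cell_sum.
Qed.

End criteria.
Theorem theorem3 (R : realType) (m : nat) (r : R)
    (mu : {measure set (borelC R) -> \bar R}) (r_gt0 : 0 < r) :
  (forall p q : R, 0 < p -> p <= q ->
     (fock_carleson mu m p q <->
        (ereal_sup [set averaging mu m q r a | a in [set: Cplx R]] < +oo)%E) /\
     (fock_carleson mu m p q <->
        in_Lp (@area R) +oo%E (averaging mu m q r)))
  /\
  (forall p q : R, 0 < q -> q < p ->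
     (fock_carleson mu m p q <->
        forall s : R, 0 < s ->
          (\esum_(a in square_lattice s)
             (averaging mu m q r a `^ (p / (p - q))) < +oo)%E) /\
     (fock_carleson mu m p q <->
        in_Lp (@area R) (p / (p - q))%:E (averaging mu m q r))).
Proof.
split=> p q.
  move=> p0 pq; have q0 := lt_le_trans p0 pq.
  suff H : fock_carleson mu m p q <->
      (ereal_sup [set averaging mu m q r a | a in [set: Cplx R]] < +oo)%E.
    by split => //; rewrite averaging_Linfty.
  rewrite sup_bounded; split=> [/(carleson_bounded p0 q0 r_gt0)[K K0 KP]|[M M0 MP]].
    by exists K => //; exact: ltW.
  exact: carleson_of_bounded MP.
move=> q0 qp; split; [exact: carleson_lattice_sum|exact: carleson_Lp].
Qed.
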